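(* Up to orthogonal projective equivalence there exist exactly $3$ irreducible Euclidean $\vee$-systems in $\mathbb{R}^3$ all of whose vectors have the same length. The associated hyperplane arrangements $\{\alpha^\perp:\alpha\in\mathcal{A}\}$ of these three $\vee$-systems $\mathcal{A}$ are, up to linear equivalence, the arrangements of mirrors (reflecting planes) of the full reflection groups of the regular tetrahedron, the cube, and the regular icosahedron, respectively.
   Context: $\mathbb{R}^d$ carries its standard Euclidean inner product $(\cdot,\cdot)$. Euclidean $\vee$-system in $\mathbb{R}^d$: a finite set $\mathcal{A}=\{\alpha_1,\dots,\alpha_n\}\subset\mathbb{R}^d\setminus\{0\}$ of pairwise non-proportional vectors such that: (V1) $\sum_{i=1}^n (x,\alpha_i)^2=|x|^2$ for all $x\in\mathbb{R}^d$; (V2) for every linear $2$-plane $\Pi\subset\mathbb{R}^d$ with $|\mathcal{A}\cap\Pi|\ge 3$ there is $\nu(\Pi)\in\mathbb{R}$ with $\sum_{i:\alpha_i\in\Pi}(x,\alpha_i)^2=\nu(\Pi)|x|^2$ for all $x\in\Pi$; (V3) for every linear $2$-plane $\Pi$ with $\mathcal{A}\cap\Pi=\{\alpha_i,\alpha_j\}$, $i\ne j$, one has $(\alpha_i,\alpha_j)=0$. $\mathcal{A}$ is reducible if there is a non-trivial direct sum decomposition $\mathbb{R}^d=P\oplus P'$ into linear subspaces with $\mathcal{A}=(\mathcal{A}\cap P)\cup(\mathcal{A}\cap P')$; it is irreducible if it is not reducible. Two systems $\{\alpha_i\}_{i=1}^n$ and $\{\beta_i\}_{i=1}^n$ in $\mathbb{R}^d$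 are orthogonal projectively equivalent if, after relabelling, there is $G\in\mathrm{O}(d)$ with $\beta_i=\pm G(\alpha_i)$ for all $i$. Two hyperplane arrangements in $\mathbb{R}^d$ are linearly equivalent if some $F\in\mathrm{GL}(d,\mathbb{R})$ carries the hyperplanes of one onto those of the other. *)

(* Defs.v *)
From mathcomp Require Import all_boot all_order all_algebra finmap.
From mathcomp Require Import boolp classical_sets functions reals.

Set Implicit Arguments.
Unset Strict Implicit.
Unset Printing Implicit Defensive.

Import Order.TTheory GRing.Theory Num.Theory.
Local Open Scope classical_set_scope.
Local Open Scope fset_scope.
Local Open Scope ring_scope.

(* Vectors of R^d are row vectors, so a matrix [G] acts by [x |-> x *m G]. *)

Section Euclidean.
Variables (R : realType) (d : nat).
Implicit Types (x y a b : 'rV[R]_d) (A B : {fset 'rV[R]_d}).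

Definition dot x y : R := \sum_(i < d) x 0 i * y 0 i.

(* MathComp-Analysis' [`|x|] on row vectors is the sup norm. *)
Definition enorm x : R := Num.sqrt (dot x x).

Definition orthogonal_group : set 'M[R]_d := [set G | G *m G^T = 1%:M].

Definition vsystem_frame A : Prop :=
  forall x, \sum_(a <- A) dot x a ^+ 2 = enorm x ^+ 2.

Definition vsystem_plane_many A : Prop :=
  forall P : {vspace 'rV[R]_d}, \dim P = 2%N ->
    (3 <= #|` [fset a in A | a \in P]|)%N ->
    exists nu : R, forall x, x \in P ->
      \sum_(a <- A | a \in P) dot x a ^+ 2 = nu * enorm x ^+ 2.

Definition vsystem_plane_two A : Prop :=
  forall P : {vspace 'rV[R]_d}, \dim P = 2%N ->
    forall a b, a != b -> [fset c in A | c \in P] = [fset a; b] ->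
    dot a b = 0.

Definition euclidean_vsystem A : Prop :=
  [/\ 0 \notin A,
      forall a b, a \in A -> b \in A -> a != b -> forall c : R, b <> c *: a,
      vsystem_frame A,
      vsystem_plane_many A
    & vsystem_plane_two A].

Definition reducible A : Prop :=
  exists P P' : {vspace 'rV[R]_d},
    [/\ P != 0%VS, P' != 0%VS, directv (P + P'), (P + P')%VS = fullv
      & A = [fset a in A | a \in P] `|` [fset a in A | a \in P']].

Definition irreducible A : Prop := ~ reducible A.

Definition equal_lengths A : Prop :=
  forall a b, a \in A -> b \in A -> enorm a = enorm b.

(* The bijection [f] is the relabelling. *)
Definition orth_proj_equiv A B : Prop :=
  exists2 G, orthogonal_group G &
  exists2 f : 'rV[R]_d -> 'rV[R]_d, set_bij [set` A] [set` B] f &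
    forall a, a \in A -> f a = a *m G \/ f a = - (a *m G).

Definition hyperplane a : set 'rV[R]_d := [set x | dot a x = 0].

Definition arrangement_of A : set (set 'rV[R]_d) :=
  [set hyperplane a | a in [set` A]].

Definition linearly_equivalent (H K : set (set 'rV[R]_d)) : Prop :=
  exists2 F : 'M[R]_d, F \in unitmx &
    [set [set x *m F | x in h] | h in H] = K.

Definition reflection (n : 'rV[R]_d) : 'M[R]_d :=
  1%:M - (2 / dot n n) *: (n^T *m n).

Definition mirrors (W : set 'M[R]_d) : set (set 'rV[R]_d) :=
  [set hyperplane n | n in [set n | n != 0 /\ W (reflection n)]].

Definition convex_hull (S : set 'rV[R]_d) : set 'rV[R]_d :=
  [set x | exists m (v : 'I_m -> 'rV[R]_d) (c : 'I_m -> R),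
    [/\ forall i, S (v i), forall i, 0 <= c i, \sum_i c i = 1
      & x = \sum_i c i *: v i]].

(* For a solid centred at the origin; improper isometries are included. *)
Definition symmetry_group (P : set 'rV[R]_d) : set 'M[R]_d :=
  [set G | orthogonal_group G /\ [set x *m G | x in P] = P].

End Euclidean.

Section RegularSolids.
Variable R : realType.

Definition vec3 (x y z : R) : 'rV[R]_3 := \row_(i < 3) [:: x; y; z]`_i.

Definition tetrahedron : set 'rV[R]_3 :=
  convex_hull [set vec3 1 1 1; vec3 1 (-1) (-1);
                   vec3 (-1) 1 (-1); vec3 (-1) (-1) 1].

Definition cube : set 'rV[R]_3 :=
  convex_hull [set v | forall i, v 0 i = 1 \/ v 0 i = -1].

Definition golden_ratio : R := (1 + Num.sqrt 5) / 2.

(* The vertices are the cyclic permutations of (0, +-1, +-golden_ratio). *)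
Definition icosahedron : set 'rV[R]_3 :=
  convex_hull [set v | exists s t : bool,
    let x := (-1) ^+ s in let y := (-1) ^+ t * golden_ratio in
    [\/ v = vec3 0 x y, v = vec3 x y 0 | v = vec3 y 0 x]].

End RegularSolids.

(* Main.v *)
Require Import Defs.
From mathcomp Require Import all_boot all_order all_algebra finmap.
From mathcomp Require Import boolp classical_sets functions reals.
From mathcomp Require Import ring lra.

Set Implicit Arguments.
Unset Strict Implicit.
Unset Printing Implicit Defensive.
Import Order.TTheory GRing.Theory Num.Theory.
Local Open Scope ring_scope.

(** Divide all vectors by their common length.  What remains of the conditions is
    that the vectors span and that in each plane containing two of them they form
    a tight frame.  A tight frame of unit vectors in a plane never leaves a gap
    above pi/2 between neighbouring lines, because the squares of the vectors, as
    complex numbers, have sum zero.  So the inner normals of the walls of a chamber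
    of the arrangement form pairwise angles at least pi/2, hence are independent,
    and all chambers are simplicial cones, that is, spherical triangles with angles
    at most pi/2 ([simple_generators]).

    Let theta be the smallest angle between two vectors of the system, and take a
    chamber with the angle theta.  The angles of a spherical triangle have a sum
    above pi, so each of the two other angles exceeds pi/2 - theta.  A planar
    computation shows that such an angle is pi/2, with two lines in its plane, or
    pi/3, with three ([wide_pair]).  If both are pi/2, the third vector is orthogonal
    to all others and the system is reducible; if both are pi/3, then theta is
    above pi/3, which is impossible.  So the angles are pi/2, pi/3, theta, and theta
    is above pi/6 ([seed_exists]).

    The third vector of this chamber also controls the plane with the angle theta:
    its inner products with the vectors of that plane are at most cos theta.
    Together with tightness this forces the lines of the plane to be equally
    spaced and theta to be pi/3, pi/4 or pi/5 ([narrow_pair]).  Every plane through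
    two walls of the chamber is then symmetric under the reflections in these
    walls, so the three neighbouring chambers are mirror images of the first one
    ([neighbour], [seed_planes]), and so on for all chambers.  Along a gallery from
    the chamber to its opposite, given by the longest word of the reflection group,
    each vector of the system occurs as the wall that is crossed
    ([walls_exhaust]).  So theta determines the system up to isometry
    ([model_complete]), and the length is determined by the trace of the frame
    condition.

    Conversely the root systems A3, B3 and H3, with all roots scaled to one length,
    are such systems: the quadratic form attached to a plane is invariant under
    the reflections in its roots and so it is scalar
    ([reflection_closed_planes]).  They are not equivalent, as their vectors have
    different lengths.  Written in coordinates adapted to the tetrahedron, the cube
    and the icosahedron, the roots are the normals of the mirrors themselves
    ([mirrors_of_solid]), so that the identity is the linear equivalence.  The finite
    verifications about roots and vertices are computations with pairs of integers
    that represent elements of Z, Z[sqrt 2] and Z[golden ratio]. *)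

(** * Inner products *)

Section Dot.
Variables (R : realType) (d : nat).
Implicit Types (x y z : 'rV[R]_d) (k : R).

Lemma dotC x y : dot x y = dot y x.
Proof. by apply: eq_bigr => i _; rewrite mulrC. Qed.

Lemma dotDl x y z : dot (x + y) z = dot x z + dot y z.
Proof. by rewrite -big_split; apply: eq_bigr => i _; rewrite mxE mulrDl. Qed.

Lemma dotZl k x y : dot (k *: x) y = k * dot x y.
Proof. by rewrite [RHS]mulr_sumr; apply: eq_bigr => i _; rewrite mxE mulrA. Qed.

Lemma dotNl x y : dot (- x) y = - dot x y.
Proof. by rewrite -scaleN1r dotZl mulN1r. Qed.

Lemma dot0l y : dot 0 y = 0.
Proof. by rewrite -(scale0r 0) dotZl mul0r. Qed.

Lemma dotDr x y z : dot z (x + y) = dot z x + dot z y.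
Proof. by rewrite dotC dotDl !(dotC z). Qed.

Lemma dotZr k x y : dot y (k *: x) = k * dot y x.
Proof. by rewrite dotC dotZl (dotC y). Qed.

Lemma dotNr x y : dot y (- x) = - dot y x.
Proof. by rewrite dotC dotNl (dotC y). Qed.

Lemma dot0r y : dot y 0 = 0.
Proof. by rewrite dotC dot0l. Qed.

Definition dotE := (dotDl, dotDr, dotNl, dotNr, dotZl, dotZr, dot0l, dot0r).

Lemma dot_suml (I : Type) (r : seq I) (P : pred I) (F : I -> 'rV[R]_d) y :
  dot (\sum_(i <- r | P i) F i) y = \sum_(i <- r | P i) dot (F i) y.
Proof.
by elim/big_rec2: _ => [|i a b _ <-]; rewrite ?dot0l ?dotDl.
Qed.

Lemma dot_sumr (I : Type) (r : seq I) (P : pred I) (F : I -> 'rV[R]_d) y :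
  dot y (\sum_(i <- r | P i) F i) = \sum_(i <- r | P i) dot y (F i).
Proof. by rewrite dotC dot_suml; apply: eq_bigr => i _; rewrite dotC. Qed.

Lemma dot_ge0 x : 0 <= dot x x.
Proof. by apply: sumr_ge0 => i _; rewrite -expr2 sqr_ge0. Qed.

Lemma dot_eq0 x : (dot x x == 0) = (x == 0).
Proof.
apply/eqP/eqP => [h|->]; last exact: dot0l.
apply/rowP => i; rewrite mxE; apply/eqP.
rewrite -[_ == 0]orbb -mulf_eq0; apply/eqP.
by move: i isT; apply: psumr_eq0P h => i _; rewrite -expr2 sqr_ge0.
Qed.

Lemma dot_gt0 x : (0 < dot x x) = (x != 0).
Proof. by rewrite lt_def dot_eq0 dot_ge0 andbT. Qed.

Lemma enorm_sq x : enorm x ^+ 2 = dot x x.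
Proof. by rewrite /enorm sqr_sqrtr // dot_ge0. Qed.

Lemma dot_mulmx x y (M : 'M_d) : dot (x *m M) y = dot x (y *m M^T).
Proof.
have dotM (u v : 'rV[R]_d) : dot u v = (u *m v^T) 0 0.
  by rewrite mxE; apply: eq_bigr => i _; rewrite mxE.
by rewrite !dotM trmx_mul trmxK mulmxA.
Qed.

Lemma span2P (a b c : 'rV[R]_d) :
  reflect (exists s t : R, c = s *: a + t *: b) (c \in <<[:: a; b]>>%VS).
Proof.
rewrite span_cons span_seq1; apply: (iffP memv_addP).
  move=> [_ /vlineP[x ->] [_ /vlineP[y ->] ->]]; by exists x, y.
by move=> [x [y ->]]; exists (x *: a); rewrite ?memvZ ?memv_line //;
   exists (y *: b); rewrite ?memvZ ?memv_line.
Qed.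

Lemma mulmx_outer x p (a : 'rV[R]_d) : x *m (p^T *m a) = dot x p *: a.
Proof.
rewrite mulmxA [x *m p^T]mx11_scalar mul_scalar_mx; congr (_ *: _).
by rewrite mxE; apply: eq_bigr => i _; rewrite mxE.
Qed.

Lemma dot_preserving_orthogonal (G : 'M[R]_d) :
  (forall x y, dot (x *m G) (y *m G) = dot x y) -> orthogonal_group G.
Proof.
move=> iso; rewrite /orthogonal_group /=; apply/row_matrixP => i.
rewrite !rowE mulmx1; set e := delta_mx _ _.
apply/eqP; rewrite -subr_eq0 -dot_eq0; set w := _ - _.
have we : w = e *m G *m G^T - e by rewrite /w mulmxA.
rewrite {1}we dotDl dotNl subr_eq0; apply/eqP.
by rewrite dot_mulmx trmxK iso.
Qed.

End Dot.

(** * Reflections and sets closed under them *)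

Section ReflectionClosed.
Variables (R : realType) (d : nat).
Notation V := 'rV[R]_d.
Implicit Types (A : {fset V}) (a b c x y z : V).

Definition refl a x := x - (2 * dot a x / dot a a) *: a.

Lemma dot_refl a x y : dot (refl a x) y = dot x (refl a y).
Proof. by rewrite /refl !dotE (dotC x a); ring. Qed.

Lemma reflK a : a != 0 -> involutive (refl a).
Proof.
rewrite -dot_gt0 => /lt0r_neq0 a0 x; rewrite /refl !dotE.
rewrite -addrA -opprD -scalerDl [X in X *: a](_ : _ = 0); last by field.
by rewrite scale0r subr0.
Qed.

Lemma reflN a x : refl a (- x) = - refl a x.
Proof. by rewrite /refl dotNr mulrN mulNr scaleNr opprD. Qed.

Lemma refl_self a : a != 0 -> refl a a = - a.
Proof.
rewrite -dot_gt0 => /lt0r_neq0 a0; rewrite /refl mulfK // scaler_nat mulr2n.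
by rewrite opprD addrA subrr add0r.
Qed.

Lemma refl_orth a x : dot a x = 0 -> refl a x = x.
Proof. by move=> ax; rewrite /refl ax mulr0 mul0r scale0r subr0. Qed.

Lemma distinct_lines_free A a b (x y : R) : 0 \notin A ->
  (forall a b, a \in A -> b \in A -> a != b -> forall c : R, b <> c *: a) ->
  a \in A -> b \in A -> a != b -> x *: a + y *: b = 0 -> x = 0 /\ y = 0.
Proof.
move=> A0 nl aA bA nab E; have [y0|yn] := eqVneq y 0.
  split=> //; move: E; rewrite y0 scale0r addr0 => /eqP; rewrite scaler_eq0.
  by case/orP=> /eqP // a0; move: A0; rewrite -a0 aA.
case: (nl a b aA bA nab (- (x / y))); apply: (scalerI yn).
by rewrite scalerA mulrN mulrCA divff // mulr1 scaleNr; apply/eqP; rewrite -addr_eq0 addrC E.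
Qed.

(** The form [Q] that the vectors in a plane define is invariant under the reflections in
    these vectors, so that each of them is an eigenvector of [Q]; three pairwise
    independent eigenvectors in a plane make [Q] scalar.  A plane with only two
    vectors [a], [b] contains the mirror image of [b] in [a], which must be [b]. *)
Lemma reflection_closed_planes A : 0 \notin A ->
  (forall a b, a \in A -> b \in A -> a != b -> forall c : R, b <> c *: a) ->
  (forall a b, a \in A -> b \in A -> refl a b \in A \/ - refl a b \in A) ->
  vsystem_plane_many A /\ vsystem_plane_two A.
Proof.
move=> A0 nl closed; have ne0 a : a \in A -> a != 0.
  by move=> aA; apply: contraNneq A0 => <-.
have nN a b : a \in A -> b \in A -> a <> - b.
  move=> aA bA ab; have [E|nab] := eqVneq b a.
    by move: ab (ne0 b bA); rewrite -E => /eqP; rewrite -addr_eq0 -mulr2n -scaler_nat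
      scaler_eq0 pnatr_eq0 /= => ->.
  by apply: (nl b a bA aA nab (-1)); rewrite scaleN1r.
have reflP (P : {vspace V}) a b : a \in P -> b \in P -> refl a b \in P.
  by move=> aP bP; rewrite memvB ?memvZ.
split=> [P dimP ge3|P dimP a b nab E]; last first.
  have [aA aP] : a \in A /\ a \in P.
    by have : a \in [fset a; b]%fset; [rewrite !inE eqxx|rewrite -E !inE => /andP[]].
  have [bA bP] : b \in A /\ b \in P.
    by have : b \in [fset a; b]%fset; [rewrite !inE eqxx orbT|rewrite -E !inE => /andP[]].
  have aa : dot a a != 0 by rewrite dot_eq0 ne0.
  have inab v : v \in A -> v \in P -> v = a \/ v = b.
    move=> vA vP; have : v \in [fset a; b]%fset by rewrite -E !inE /= vA vP.
    by rewrite !inE => /orP[]/eqP ->; [left|right].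
  pose k := 2 * dot a b / dot a a.
  have free2 := distinct_lines_free A0 nl aA bA nab.
  have [s sE] : exists s : R, (s = 1 \/ s = -1) /\
      (s *: (b - k *: a) = a \/ s *: (b - k *: a) = b).
    case: (closed a b aA bA) => /inab h; [exists 1|exists (-1)]; split; try by [left|right].
      by rewrite scale1r; apply: h; apply: reflP.
    by rewrite scaleN1r; apply: h; rewrite memvN; apply: reflP.
  case: sE => s1 [|] sE.
    have [] := free2 (s * k + 1) (- s).
      by rewrite -[X in _ = X](subrr a) -{3}sE scalerBr scalerA scalerDl scale1r
        scaleNr opprB addrAC addrC addrA.
    by move=> _ /eqP; rewrite oppr_eq0; case: s1 => -> /eqP; lra.
  have [] := free2 (- (s * k)) (s - 1).
    by rewrite -[X in _ = X](subrr b) -{2}sE scalerBr scalerA scalerBl scale1r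
      scaleNr addrA; congr (_ - _); rewrite addrC.
  move=> sk _; have /eqP : k = 0 by case: s1 sk => ->; lra.
  by rewrite /k !mulf_eq0 invr_eq0 (negPf aa) orbF pnatr_eq0 /= => /eqP.
pose L := [seq a <- A | a \in P].
have LP a : a \in L -> a \in A /\ a \in P by rewrite mem_filter => /andP[].
pose Q x y := \sum_(e <- L) dot x e * dot y e.
have Qinv a x y : a \in L -> Q (refl a x) (refl a y) = Q x y.
  move=> /LP[aA aP]; have a0 := ne0 a aA.
  pose rho e := if refl a e \in A then refl a e else - refl a e.
  have rhoL e : e \in L -> rho e \in L.
    move=> /LP[eA eP]; rewrite mem_filter /rho; case: ifPn => h.
      by rewrite reflP.
    by rewrite memvN reflP //; case: (closed a e aA eA) => // h'; rewrite h' in h.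
  have inj : {in L &, injective rho}.
    move=> e f /LP[eA _] /LP[fA _].
    have cases : rho e = rho f -> e = f \/ e = - f.
      rewrite /rho; case: ifP => _; case: ifP => _ h.
      - by left; exact: (inv_inj (reflK a0)).
      - by right; apply: (inv_inj (reflK a0)); rewrite reflN.
      - by right; apply: (inv_inj (reflK a0)); rewrite reflN -h opprK.
      - by left; apply: (inv_inj (reflK a0)); exact: oppr_inj.
    by case/cases => // /(nN _ _ eA fA).
  have uL : uniq L by rewrite filter_uniq ?fset_uniq.
  have ur : uniq (map rho L) by rewrite map_inj_in_uniq.
  have sub : {subset map rho L <= L} by move=> _ /mapP[e eL ->]; exact: rhoL.
  have pL : perm_eq (map rho L) L.
    apply: uniq_perm => //; have [|_] := uniq_min_size ur sub; last by [].
    by rewrite size_map.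
  rewrite /Q -[RHS](perm_big _ pL) big_map; apply: eq_bigr => e _ /=.
  by rewrite !dot_refl /rho; case: ifP => _; rewrite ?dotNr ?mulrNN.
pose lam a := Q a a / dot a a.
have QD x y z : Q (x + y) z = Q x z + Q y z.
  by rewrite /Q -big_split; apply: eq_bigr => e _; rewrite dotDl mulrDl.
have QZ (k : R) y z : Q (k *: y) z = k * Q y z.
  by rewrite /Q mulr_sumr; apply: eq_bigr => e _; rewrite dotZl mulrA.
have QC x y : Q x y = Q y x by apply: eq_bigr => e _; rewrite mulrC.
have Qeigen a y : a \in L -> Q a y = lam a * dot a y.
  move=> aL; have [aA aP] := LP a aL; have a0 := ne0 a aA.
  have aa : dot a a != 0 by rewrite dot_eq0.
  have orth x : dot a x = 0 -> Q a x = 0.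
    move=> ax; have := Qinv a a x aL; rewrite refl_self // refl_orth //.
    by rewrite -scaleN1r QZ => h; lra.
  have yE : y = (dot a y / dot a a) *: a + (y - (dot a y / dot a a) *: a).
    by rewrite addrC subrK.
  have y'0 : Q a (y - (dot a y / dot a a) *: a) = 0.
    by apply: orth; rewrite !dotE divfK // subrr.
  by rewrite {1}yE QC QD QZ [Q (_ - _) a]QC y'0 addr0 /lam; field.
case E : (enum_fset [fset a in A | a \in P]%fset) ge3 => [|a [|b [|c s]]] // _.
have uF := fset_uniq [fset a in A | a \in P]%fset; rewrite E /= !inE !negb_or in uF.
case/andP: uF => /and3P[nab nac _] /andP[/andP[nbc _] _].
have FP e : e \in [:: a, b, c & s] -> e \in L.
  rewrite -E -[_ \in _]/(e \in [fset a in A | a \in P]%fset) !inE /= => h.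
  by rewrite mem_filter andbC.
have [aL bL cL] : [/\ a \in L, b \in L & c \in L].
  by split; apply: FP; rewrite !inE eqxx ?orbT.
have [[aA aP] [bA bP] [cA cP]] : [/\ a \in A /\ a \in P, b \in A /\ b \in P & c \in A /\ c \in P].
  by split; apply: LP.
have free_ab : free [:: a; b].
  rewrite free_cons seq1_free (ne0 b bA) andbT span_seq1; apply/negP => /vlineP[k ak].
  by apply: (nl b a bA aA _ k ak); rewrite eq_sym.
have PE : P = <<[:: a; b]>>%VS.
  apply/esym/eqP; rewrite eqEdim dimP (eqP free_ab) leqnn andbT.
  by apply/span_subvP => e; rewrite !inE => /orP[]/eqP ->.
have [x [y cE]] : exists x y : R, c = x *: a + y *: b.
  by apply/span2P; rewrite -PE.
have xn : x != 0.
  apply/eqP => x0; apply: (nl b c bA cA nbc y).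
  by rewrite cE x0 scale0r add0r.
have yn : y != 0.
  apply/eqP => y0; apply: (nl a c aA cA nac x).
  by rewrite cE y0 scale0r addr0.
have [l1 l2] : lam a = lam c /\ lam b = lam c.
  pose u := (x * (lam c - lam a)) *: a + (y * (lam c - lam b)) *: b.
  have u0 z : dot u z = 0.
    have Qc : Q c z = x * (lam a * dot a z) + y * (lam b * dot b z).
      by rewrite [in LHS]cE QD !QZ !Qeigen.
    have dc : dot c z = x * dot a z + y * dot b z by rewrite [in LHS]cE !dotE.
    by have := Qeigen c z cL; rewrite Qc dc /u !dotE => h; lra.
  have /eqP := u0 u; rewrite dot_eq0 => /eqP /(distinct_lines_free A0 nl aA bA nab)[].
  move/eqP; rewrite mulf_eq0 (negPf xn) subr_eq0 /= => /eqP -> /eqP.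
  by rewrite mulf_eq0 (negPf yn) subr_eq0 /= => /eqP ->.
exists (lam c) => z; rewrite PE => /span2P[x1 [y1 zE]].
rewrite enorm_sq -PE -big_filter -/L.
rewrite (eq_bigr (fun e => dot z e * dot z e)) => [|e _]; last by rewrite expr2.
rewrite -/(Q z z).
have -> : Q z z = x1 * (lam a * dot a z) + y1 * (lam b * dot b z).
  by rewrite {1}zE QD !QZ !Qeigen.
by rewrite l1 l2 {3}zE !dotE; ring.
Qed.
End ReflectionClosed.

(** * Tight planes *)

Section Planes.
Variables (R : realType) (d : nat).
Notation V := 'rV[R]_d.
Implicit Types (U : seq V) (a b c : V).

Definition pm U v := (v \in U) || (- v \in U).

(** A finite set of lines, each given by one unit vector.  The last condition covers
    planes with two vectors as well as with more, since two orthogonal unit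
    vectors are a tight frame of their plane. *)
Record planar_tight U : Prop := PlanarTight {
  tight_uniq : uniq U;
  tight_unit : forall u, u \in U -> dot u u = 1;
  tight_line : forall u, u \in U -> - u \notin U;
  tight_span : <<U>>%VS = fullv;
  tight_plane : forall a b, pm U a -> pm U b -> a != b -> a != - b ->
    exists nu : R, forall x y : R,
      \sum_(c <- U | c \in <<[:: a; b]>>%VS) dot (x *: a + y *: b) c ^+ 2 =
      nu * dot (x *: a + y *: b) (x *: a + y *: b) }.

(** The simple roots of their plane, for a suitable choice of signs of the other
    vectors in it. *)
Definition simple_pair U a b :=
  forall x y : R, pm U (x *: a + y *: b) -> 0 <= x * y.

Lemma pmN U v : pm U (- v) = pm U v.
Proof. by rewrite /pm opprK orbC. Qed.

Lemma pm_unit U v : planar_tight U -> pm U v -> dot v v = 1.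
Proof.
move=> tU /orP[|] /(tight_unit tU) //.
by rewrite !dotE opprK.
Qed.

Lemma pm_neq0 U v : planar_tight U -> pm U v -> v != 0.
Proof. by move=> tU /(pm_unit tU); rewrite -dot_gt0 => ->. Qed.

(** Strict Cauchy-Schwarz for two distinct lines.  It is the Gram determinant by which
    coordinates in a plane are divided. *)
Lemma gram2_gt0 a b : dot a a = 1 -> dot b b = 1 -> a != b -> a != - b ->
  0 < 1 - dot a b ^+ 2.
Proof.
move=> a1 b1; rewrite -subr_eq0 -addr_eq0 -!dot_gt0 !dotE a1 b1 (dotC b a).
move=> h1 h2; rewrite -[X in X - _](expr1n _ 2) subr_sqr.
by apply: mulr_gt0; lra.
Qed.

Lemma unit_pair_free a b : dot a a = 1 -> dot b b = 1 -> a != b -> a != - b ->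
  free [:: a; b].
Proof.
move=> a1 b1 nab nabN; have b0 : b != 0 by rewrite -dot_gt0 b1 ltr01.
rewrite free_cons seq1_free b0 andbT span_seq1; apply/negP => /vlineP[k ak].
have : k ^+ 2 = 1 by move: a1; rewrite ak !dotE b1 mulr1 expr2.
move/eqP; rewrite sqrf_eq1 => /orP[]/eqP kE; move: nab nabN;
  by rewrite ak kE ?scale1r ?scaleN1r eqxx.
Qed.

Lemma normr_same_sign (x y : R) : 0 <= x * y ->
  `|x| = x /\ `|y| = y \/ `|x| = - x /\ `|y| = - y.
Proof.
move=> xy; have [x0|x0|x0] := ltgtP 0 x.
- by left; rewrite !ger0_norm ?(ltW x0) //; rewrite pmulr_rge0 in xy.
- by right; rewrite !ler0_norm ?(ltW x0) //; rewrite nmulr_rge0 in xy.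
- rewrite -x0 normr0 oppr0; have [y0|y0] := leP 0 y; [left|right].
    by rewrite ger0_norm.
  by rewrite ltr0_norm.
Qed.

(** Tightness equates the sums of squares in the orthogonal directions [a + b] and
    [a - b], up to their lengths, and the sums in the directions [a] and [b].  On
    the coordinates of the vectors of the plane these become the two final sums.
    [O] leaves out [a] and [b], whence the successor twice of its size. *)
Lemma plane_coords U a b (g := dot a b) : planar_tight U ->
  pm U a -> pm U b -> a != b -> a != - b ->
  simple_pair U a b ->
  exists O : seq (R * R), [/\ uniq O,
    forall e, e \in O -> [/\ 0 < e.1, 0 < e.2 & pm U (e.1 *: a + e.2 *: b)],
    forall x y : R, 0 < x -> 0 < y -> pm U (x *: a + y *: b) -> (x, y) \in O,
    \sum_(e <- O) (e.1 * e.2) * (2 * (1 - g ^+ 2)) = - ((size O).+2%:R * g)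
    & \sum_(e <- O) (e.1 ^+ 2 - e.2 ^+ 2) = 0].
Proof.
move=> tU pa pb nab nabN xy_ge0.
have a1 := pm_unit tU pa; have b1 := pm_unit tU pb.
have D0 := gram2_gt0 a1 b1 nab nabN; rewrite -/g in D0.
have Dn : 1 - g ^+ 2 != 0 by rewrite gt_eqF.
pose X c := (dot c a - g * dot c b) / (1 - g ^+ 2).
pose Y c := (dot c b - g * dot c a) / (1 - g ^+ 2).
have XE (x y : R) : X (x *: a + y *: b) = x.
  by rewrite /X !dotE a1 b1 (dotC b a) -/g; field.
have YE (x y : R) : Y (x *: a + y *: b) = y.
  by rewrite /Y !dotE a1 b1 (dotC b a) -/g; field.
have Xa : X a = 1 by have := XE 1 0; rewrite scale1r scale0r addr0.
have Ya : Y a = 0 by have := YE 1 0; rewrite scale1r scale0r addr0.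
have Xb : X b = 0 by have := XE 0 1; rewrite scale1r scale0r add0r.
have Yb : Y b = 1 by have := YE 0 1; rewrite scale1r scale0r add0r.
have XN c : X (- c) = - X c by rewrite /X !dotE; ring.
have YN c : Y (- c) = - Y c by rewrite /Y !dotE; ring.
pose P := <<[:: a; b]>>%VS.
have coord c : c \in P -> c = X c *: a + Y c *: b.
  by move=> /span2P[x [y ->]]; rewrite XE YE.
pose Q := [seq c <- U | c \in P].
have QP c : c \in Q -> c \in P /\ c \in U by rewrite mem_filter => /andP[].
have XY0 c : c \in Q -> 0 <= X c * Y c.
  by case/QP=> cP cU; apply: xy_ge0; rewrite -coord // /pm cU.
(* Of a vector and its opposite, one has both coordinates nonnegative. *)
pose co (c : V) : R * R := (`|X c| : R, `|Y c| : R).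
pose L : seq (R * R) := map co Q.
have co_inj : {in Q &, injective co}.
  move=> c c' cQ cQ' [eX eY]; have [cP cU] := QP _ cQ; have [cP' cU'] := QP _ cQ'.
  have h := XY0 _ cQ; have h' := XY0 _ cQ'.
  have [e|e] : (X c = X c' /\ Y c = Y c') \/ (X c = - X c' /\ Y c = - Y c').
    have /eqP := eX; rewrite eqr_norm2 => /orP[]/eqP EX;
    have /eqP := eY; rewrite eqr_norm2 => /orP[]/eqP EY; rewrite EX EY in h *;
      [by left| | |by right];
      have /eqP : X c' * Y c' = 0 by lra.
    - by rewrite mulf_eq0 => /orP[]/eqP ->; [right|left]; rewrite !oppr0.
    - by rewrite mulf_eq0 => /orP[]/eqP ->; [left|right]; rewrite !oppr0.
  - by rewrite (coord c cP) (coord c' cP') e.1 e.2.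
  - have E : c = - c' by rewrite (coord c cP) (coord c' cP') e.1 e.2 !scaleNr opprD.
    by have := tight_line tU cU'; rewrite -E cU.
have uL : uniq L by rewrite map_inj_in_uniq // filter_uniq // (tight_uniq tU).
have inL c : pm U c -> c \in P -> co c \in L.
  move=> /orP[cU|cU] cP; first by apply: map_f; rewrite mem_filter cP.
  have -> : co c = co (- c) by rewrite /co XN YN !normrN.
  by apply: map_f; rewrite mem_filter memvN cP.
have aP : a \in P by rewrite memv_span // mem_head.
have bP : b \in P by rewrite memv_span // !inE eqxx orbT.
have L10 : (1, 0) \in L by have := inL a pa aP; rewrite /co Xa Ya normr1 normr0.
have L01 : (0, 1) \in L by have := inL b pb bP; rewrite /co Xb Yb normr1 normr0.
have neq10 : ((1, 0) : R * R) != (0, 1) by rewrite xpair_eqE oner_eq0.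
pose O : seq (R * R) := rem (0, 1) (rem (1, 0) L).
have pL : perm_eq L ((1, 0) :: (0, 1) :: O).
  rewrite (perm_trans (perm_to_rem L10)) // perm_cons perm_to_rem //.
  by rewrite mem_rem_uniq // !inE L01 andbT eq_sym.
have inO (e : R * R) : (e \in O) = [&& e != (0, 1), e != (1, 0) & e \in L].
  by rewrite /O mem_rem_uniq ?rem_uniq // inE mem_rem_uniq // inE.
have L1 e : e \in L -> [/\ e.1 ^+ 2 + e.2 ^+ 2 + 2 * g * (e.1 * e.2) = 1,
   0 <= e.1, 0 <= e.2 & pm U (e.1 *: a + e.2 *: b)].
  case/mapP=> c cQ -> /=; have [cP cU] := QP _ cQ; have h := XY0 _ cQ.
  rewrite !real_normK ?num_real // !normr_ge0 -normrM ger0_norm //; split=> //.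
    transitivity (dot c c); last by rewrite (tight_unit tU cU).
    by rewrite [in RHS](coord c cP) !dotE a1 b1 (dotC b a) -/g; ring.
  have [[-> ->]|[-> ->]] := normr_same_sign h.
    by rewrite -coord // /pm cU.
  by rewrite -pmN !scaleNr opprD !opprK -coord // /pm cU.
have [nu Hnu] := tight_plane tU pa pb nab nabN.
have sumQ (F : R * R -> R) : \sum_(c <- U | c \in P) F (co c) =
    F (1, 0) + F (0, 1) + \sum_(e <- O) F e.
  by rewrite -big_filter -(big_map co predT) (perm_big _ pL) /= !big_cons addrA.
have Hsum (x y : R) : \sum_(c <- U | c \in P)
    (((x + y * g) ^+ 2 * (X c) ^+ 2 + (x * g + y) ^+ 2 * (Y c) ^+ 2
      + 2 * (x + y * g) * (x * g + y) * (X c * Y c))) =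
    nu * (x ^+ 2 + y ^+ 2 + 2 * g * (x * y)).
  transitivity (nu * dot (x *: a + y *: b) (x *: a + y *: b)); last first.
    by rewrite !dotE a1 b1 (dotC b a) -/g; ring.
  rewrite -Hnu; apply: eq_bigr => c cP.
  by rewrite [in RHS](coord c cP) !dotE a1 b1 (dotC b a) -/g; ring.
have toco c : c \in Q -> (X c ^+ 2 = (co c).1 ^+ 2) * (Y c ^+ 2 = (co c).2 ^+ 2)
    * (X c * Y c = (co c).1 * (co c).2).
  move=> cQ; rewrite /= !real_normK ?num_real // -normrM ger0_norm //; exact: XY0.
have HsumO (x y : R) : 
    (x + y * g) ^+ 2 + (x * g + y) ^+ 2 + \sum_(e <- O)
    ((x + y * g) ^+ 2 * e.1 ^+ 2 + (x * g + y) ^+ 2 * e.2 ^+ 2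
      + 2 * (x + y * g) * (x * g + y) * (e.1 * e.2)) =
    nu * (x ^+ 2 + y ^+ 2 + 2 * g * (x * y)).
  rewrite -Hsum; pose F (e : R * R) :=
    (x + y * g) ^+ 2 * e.1 ^+ 2 + (x * g + y) ^+ 2 * e.2 ^+ 2
      + 2 * (x + y * g) * (x * g + y) * (e.1 * e.2).
  transitivity (\sum_(c <- U | c \in P) F (co c)).
    by rewrite sumQ /F /=; congr (_ + _); ring.
  rewrite big_seq_cond [RHS]big_seq_cond; apply: eq_bigr => c /andP[cU cP].
  have cQ : c \in Q by rewrite mem_filter cP.
  by rewrite /F !(toco _ cQ).
have S2 : \sum_(e <- O) (e.1 ^+ 2 + e.2 ^+ 2 + 2 * g * (e.1 * e.2)) = (size O)%:R.
  rewrite big_seq; transitivity (\sum_(e <- O | e \in O) (1 : R)).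
    by apply: eq_bigr => e; rewrite inO => /and3P[_ _ /L1[]].
  by rewrite -big_seq big_const_seq count_predT iter_addr_0.
pose A := \sum_(e <- O) e.1 ^+ 2; pose B := \sum_(e <- O) e.2 ^+ 2.
pose C := \sum_(e <- O) e.1 * e.2.
have {}S2 : A + B + 2 * g * C = (size O)%:R.
  by rewrite -S2 !big_split /= -mulr_sumr.
have H (x y : R) : (x + y * g) ^+ 2 * (1 + A) + (x * g + y) ^+ 2 * (1 + B)
    + 2 * (x + y * g) * (x * g + y) * C = nu * (x ^+ 2 + y ^+ 2 + 2 * g * (x * y)).
  by rewrite -HsumO !big_split /= -!mulr_sumr -/A -/B -/C; ring.
have AB : A = B.
  have H10 := H 1 0; have H01 := H 0 1.
  have /eqP : (A - B) * (1 - g ^+ 2) = 0 by nra.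
  by rewrite mulf_eq0 (negPf Dn) orbF subr_eq0 => /eqP.
have CE : C * (2 * (1 - g ^+ 2)) = - ((size O).+2%:R * g).
  (* The orthogonal directions [a + b] and [a - b]. *)
  have Hp := H 1 1; have Hm := H 1 (- 1).
  have E1 := congr1 (fun z => z * (1 - g)) Hp.
  have E2 := congr1 (fun z => z * (1 + g)) Hm.
  have /eqP : (C + g * (1 + A)) * (1 - g ^+ 2) = 0.
    by rewrite -AB in E1 E2; rewrite /= in E1 E2; lra.
  rewrite mulf_eq0 (negPf Dn) orbF => /eqP E.
  have -> : (size O).+2%:R = (size O)%:R + 2 :> R by rewrite -addn2 natrD.
  by rewrite -S2 -AB; lra.
exists O; split.
- by rewrite !rem_uniq.
- move=> e; rewrite inO => /and3P[n1 n2 eL]; have [E x0 y0 ->] := L1 _ eL.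
  split=> //; rewrite lt_def ?x0 ?y0 andbT.
    apply: contraNN n1 => /eqP e0; rewrite e0 in E.
    by rewrite [e]surjective_pairing xpair_eqE e0 eqxx /=; apply/eqP; nra.
  apply: contraNN n2 => /eqP e0; rewrite e0 in E.
  by rewrite [e]surjective_pairing xpair_eqE e0 eqxx andbT; apply/eqP; nra.
- move=> x y x0 y0 /inL; rewrite inO /co XE YE !gtr0_norm // => -> //.
    by rewrite !xpair_eqE (gt_eqF x0) (gt_eqF y0) andbF.
  by apply/span2P; exists x, y.
- by rewrite -mulr_suml.
- by rewrite sumrB -/A -/B AB subrr.
Qed.
End Planes.

(** * Tight lines in a sector of the plane *)

Section PlanarSectors.
Variable R : realType.
Implicit Types (O : seq (R * R)) (e : R * R) (x y be ka t : R).

(** For a unit vector the numbers [x ^+ 2 * (1 - be ^+ 2)] and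
    [y ^+ 2 * (1 - be ^+ 2)] are the squared sines of its angles with the two sides
    of the sector.  Their product is smallest when one of the two angles is; the
    quadratic form of the proof compares the product with this extreme value. *)
Lemma coord_prod_gt be ka x y : 0 < x -> 0 < y -> 0 <= be -> be <= ka ->
  be ^+ 2 < 1 - ka ^+ 2 ->
  x ^+ 2 + y ^+ 2 - 2 * be * (x * y) = 1 ->
  1 - ka ^+ 2 <= x ^+ 2 * (1 - be ^+ 2) -> 1 - ka ^+ 2 <= y ^+ 2 * (1 - be ^+ 2) ->
  be < x * y * (1 - be ^+ 2).
Proof.
move=> x0 y0 be0 beka lt1 xy1 hX hY; have bb := mulr_ge0 be0 be0.
have xy0 := mulr_gt0 x0 y0.
have ka2 : be ^+ 2 <= ka ^+ 2 by rewrite ler_pXn2r ?nnegrE // (le_trans be0).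
set s := 1 - ka ^+ 2 in lt1 hX hY *.
have s1 : be ^+ 2 <= 1 - s by rewrite /s; lra.
set W := x * y * _.
pose D := 1 - be ^+ 2; have D0 : 0 < D by rewrite /D; lra.
have W0 : 0 < W by exact: mulr_gt0.
have [-> //|bn] := eqVneq be 0.
have bp : 0 < be by rewrite lt_def bn.
rewrite ltNge; apply/negP => Wbe.
have WE : W ^+ 2 = (x ^+ 2 * D) * (y ^+ 2 * D) by rewrite /W -/D; ring.
have XY : x ^+ 2 * D + y ^+ 2 * D = D + 2 * be * W.
  have := congr1 (fun z => z * D) xy1; rewrite /= mul1r /W -/D => h; lra.
have P0 : 0 <= (x ^+ 2 * D - s) * (y ^+ 2 * D - s) by rewrite mulr_ge0 ?subr_ge0.
have f0 : 0 <= W ^+ 2 - s * (D + 2 * be * W) + s ^+ 2.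
  by rewrite -XY WE; apply: le_trans P0 _; lra.
have s0 : 0 < s by rewrite -expr2 in bb; lra.
have Ws : s <= W.
  rewrite -(ler_pXn2r (n := 2)) ?nnegrE ?(ltW s0) ?(ltW W0) // WE expr2.
  by apply: ler_pM; rewrite ?(ltW s0).
have h1 : 0 <= (be - W) * (W + be - 2 * be * s).
  by apply: mulr_ge0; nra.
(* The value at [W = be] of the quadratic polynomial in [f0]. *)
have h2 : (be ^+ 2 - s) * (1 - s) < 0.
  by rewrite nmulr_rlt0 ?subr_lt0 // subr_gt0; rewrite -subr_gt0; nra.
by rewrite /D in f0; nra.
Qed.

(** The numbers [be] and [ka] are the cosines of the angle of the two walls and of the
    smallest angle; the inequality between them says that these angles have a sum
    above pi/2.  Every vector inside then contributes more than [2 * be] to the first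
    sum, which is too much as soon as there are two of them. *)
Lemma wide_sector be ka O : 0 <= be -> be <= ka -> be ^+ 2 < 1 - ka ^+ 2 ->
  (forall e, e \in O -> [/\ 0 < e.1, 0 < e.2,
     e.1 ^+ 2 + e.2 ^+ 2 - 2 * be * (e.1 * e.2) = 1,
     1 - ka ^+ 2 <= e.1 ^+ 2 * (1 - be ^+ 2)
   & 1 - ka ^+ 2 <= e.2 ^+ 2 * (1 - be ^+ 2)]) ->
  \sum_(e <- O) (e.1 * e.2) * (2 * (1 - be ^+ 2)) = (size O).+2%:R * be ->
  \sum_(e <- O) (e.1 ^+ 2 - e.2 ^+ 2) = 0 ->
  be = 0 /\ O = [::] \/ be = 1 / 2 /\ O = [:: (1, 1)].
Proof.
move=> be0 beka lt1 OP S1 S2.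
have gtO e : e \in O -> 2 * be < (e.1 * e.2) * (2 * (1 - be ^+ 2)).
  by case/OP => x0 y0 E hx hy; have := coord_prod_gt x0 y0 be0 beka lt1 E hx hy; lra.
case: O OP S1 S2 gtO => [|e [|e' O]] OP S1 S2 gtO.
- by left; rewrite big_nil /= in S1; split=> //; lra.
- right; rewrite !big_seq1 /= in S1 S2.
  have [x0 y0 E _ _] := OP e (mem_head _ _).
  have xy : e.1 = e.2.
    by apply/eqP; rewrite -(eqrXn2 (n := 2)) ?(ltW x0) ?(ltW y0) //; apply/eqP; lra.
  have D0 : 0 < 1 - be by nra.
  have xE : e.1 ^+ 2 * (2 * (1 - be)) = 1 by rewrite -xy in E; lra.
  have b3 : 1 + be = 3 * be.
    transitivity ((e.1 ^+ 2 * (2 * (1 - be))) * (1 + be)); first by rewrite xE; ring.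
    by rewrite -[RHS]S1 -xy; ring.
  have b2 : be = 1 / 2 by lra.
  split=> //; rewrite [e]surjective_pairing -xy.
  suff -> : e.1 = 1 by [].
  apply/eqP; rewrite -(eqrXn2 (n := 2)) ?(ltW x0) // expr1n; apply/eqP.
  by rewrite b2 in xE; lra.
- exfalso; set L := e :: e' :: O in OP S1 gtO.
  have : \sum_(e <- L) (2 * be) < \sum_(e <- L) (e.1 * e.2) * (2 * (1 - be ^+ 2)).
    rewrite big_seq [X in _ < X]big_seq; apply: ltr_sum => //.
    by apply/hasP; exists e; rewrite mem_head.
  rewrite S1 big_const_seq count_predT iter_addr_0 -[X in X < _]mulr_natr /=.
  have -> : (size O).+4%:R = (size O)%:R + 4 :> R by rewrite -addn4 natrD.
  by have := mulr_ge0 (ler0n R (size O)) be0; lra.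
Qed.

(** Here [t] is twice the cosine of the smallest angle theta, which is also the angle
    of the two sides.  The inequality [x <= t] keeps the line of [(x, y)] within 2 theta
    of the second side.  On one side of it this leaves only [(t, 1)]; on the other
    it leaves the sector between [(1, t)] and [(t, t ^+ 2 - 1)], which the two
    final inequalities cut out. *)
Lemma narrow_arc t x y : t < 2 -> 1 <= x -> 1 <= y -> x <= t ->
  x ^+ 2 + y ^+ 2 - t * (x * y) = 1 ->
  (x = t /\ y = 1) \/ (0 <= t * y - (t ^+ 2 - 1) * x /\ 0 <= t * x - y).
Proof.
move=> t2 x1 y1 xt E.
have q0 : 0 <= t * x - y.
  by rewrite -(pmulr_rge0 _ (lt_le_trans ltr01 y1)); nra.
have YE : (y - t * x / 2) ^+ 2 - (1 - t ^+ 2 / 2) ^+ 2 =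
   (1 - t ^+ 2 / 4) * (t - x) * (t + x).
  by lra.
have cY : `|1 - t ^+ 2 / 2| <= `|y - t * x / 2|.
  rewrite -(ler_pXn2r (n := 2)) ?nnegrE // !real_normK ?num_real // -subr_ge0 YE.
  by rewrite !mulr_ge0 //; nra.
have c1 := ler_norm (1 - t ^+ 2 / 2); have := ler_norm (- (1 - t ^+ 2 / 2)).
rewrite normrN => c2.
have [Y0|Y0] := leP 0 (y - t * x / 2).
  rewrite (ger0_norm Y0) in cY; right; split=> //.
  have [tt2|tt2] := leP 2 (t ^+ 2); last by nra.
  have h : 0 <= (t ^+ 2 - 2) * (t - x) by rewrite mulr_ge0 ?subr_ge0.
  by nra.
rewrite (ltr0_norm Y0) in cY; left.
by split; nra.
Qed.

(** The sector between [(1, t)] and [(t, t ^+ 2 - 1)] has the smallest angle as its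
    opening, so that two vectors in it at no smaller angle are its two ends.  In
    coordinates [p], [q] on the ends, a unit vector has [1 <= p + q], and this bounds
    inner products from below. *)
Lemma arc_pair t e e' (p q : R * R -> R)
  (pE : forall e, p e = t * e.2 - (t ^+ 2 - 1) * e.1)
  (qE : forall e, q e = t * e.1 - e.2) :
  1 <= t -> t < 2 ->
  e.1 ^+ 2 + e.2 ^+ 2 - t * (e.1 * e.2) = 1 ->
  e'.1 ^+ 2 + e'.2 ^+ 2 - t * (e'.1 * e'.2) = 1 ->
  0 <= p e -> 0 <= q e -> 0 <= p e' -> 0 <= q e' ->
  e.1 * e'.1 + e.2 * e'.2 - t / 2 * (e.1 * e'.2 + e'.1 * e.2) <= t / 2 ->
  e = (1, t) /\ e' = (t, t ^+ 2 - 1) \/ e' = (1, t) /\ e = (t, t ^+ 2 - 1).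
Proof.
move=> t1 t2 E E' p0 q0 p0' q0' le_t.
have xE f : f.1 = p f + t * q f by rewrite pE qE; ring.
have yE f : f.2 = t * p f + (t ^+ 2 - 1) * q f by rewrite pE qE; ring.
have nE f : f.1 ^+ 2 + f.2 ^+ 2 - t * (f.1 * f.2) =
    p f ^+ 2 + q f ^+ 2 + t * (p f * q f) by rewrite pE qE; ring.
have dE : e.1 * e'.1 + e.2 * e'.2 - t / 2 * (e.1 * e'.2 + e'.1 * e.2) =
    t / 2 * ((p e + q e) * (p e' + q e')) + (1 - t / 2) * (p e * p e' + q e * q e').
  by rewrite !pE !qE; field.
rewrite nE in E; rewrite nE in E'; rewrite dE in le_t.
have sum_ge1 f : 0 <= p f -> 0 <= q f -> p f ^+ 2 + q f ^+ 2 + t * (p f * q f) = 1 ->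
    1 <= p f + q f.
  move=> h1 h2 h; rewrite -(ler_pXn2r (n := 2)) ?nnegrE ?addr_ge0 //.
  by have := mulr_ge0 h1 h2; nra.
have s1 := sum_ge1 e p0 q0 E; have s2 := sum_ge1 e' p0' q0' E'.
have s12 : 1 <= (p e + q e) * (p e' + q e') by rewrite mulr_ege1.
have pp := mulr_ge0 p0 p0'; have qq := mulr_ge0 q0 q0'.
have /eqP z : p e * p e' + q e * q e' = 0 by apply/eqP; rewrite eq_le addr_ge0 // andbT; nra.
move: z; rewrite paddr_eq0 // !mulf_eq0 => /andP[hp hq].
have sqr1 f : 0 <= f -> f ^+ 2 = 1 -> f = 1 :> R.
  by move=> f0 f1; apply/eqP; rewrite -(eqrXn2 (n := 2)) // f1 expr1n.
have {hp hq} [[hp hq]|[hp hq]] : (p e = 0 /\ q e' = 0) \/ (q e = 0 /\ p e' = 0).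
  by case/orP: hp => /eqP h; case/orP: hq => /eqP h';
    [nra|left|right|nra].
- right; have qe : q e = 1 by apply: sqr1 => //; rewrite hp in E; lra.
  have pe : p e' = 1 by apply: sqr1 => //; rewrite hq in E'; lra.
  rewrite [e]surjective_pairing [e']surjective_pairing !xE !yE hp hq qe pe.
  by split; congr (_, _); ring.
- left; have qe : p e = 1 by apply: sqr1 => //; rewrite hp in E; lra.
  have pe : q e' = 1 by apply: sqr1 => //; rewrite hq in E'; lra.
  rewrite [e]surjective_pairing [e']surjective_pairing !xE !yE hp hq qe pe.
  by split; congr (_, _); ring.
Qed.
End PlanarSectors.

Section NarrowSector.
Variable R : realType.
Implicit Types (O : seq (R * R)) (e f : R * R) (x y t : R).

Lemma eqr_sqr_pos x y : 0 < x -> 0 < y -> x ^+ 2 = y ^+ 2 -> x = y.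
Proof.
by move=> x0 y0 xy; apply/eqP; rewrite -(eqrXn2 (n := 2)) ?(ltW x0) ?(ltW y0) // xy.
Qed.

(** Four lines of a plane are tight only as two orthogonal pairs, because four unit
    complex numbers with sum zero are two opposite pairs.  The condition [e.1 <= t]
    then leaves only the angle pi/4. *)
Lemma two_in_sector t e f : 0 < t -> t < 2 ->
  1 <= e.1 -> 1 <= e.2 -> e.1 <= t -> 1 <= f.1 -> 1 <= f.2 ->
  e.1 ^+ 2 + e.2 ^+ 2 - t * (e.1 * e.2) = 1 ->
  f.1 ^+ 2 + f.2 ^+ 2 - t * (f.1 * f.2) = 1 ->
  (e.1 * e.2 + f.1 * f.2) * (4 - t ^+ 2) = 4 * t ->
  e.1 ^+ 2 - e.2 ^+ 2 + (f.1 ^+ 2 - f.2 ^+ 2) = 0 ->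
  f.1 ^+ 2 <= f.2 ^+ 2 ->
  [/\ t ^+ 2 = 2, e = (t, 1) & f = (1, t)].
Proof.
move=> t0 t2 x1 y1 xt x1' y1' E E' S1 S2 le_f.
set w := e.1 * e.2 in E S1; set w' := f.1 * f.2 in E' S1.
have sq (x y : R) : (x ^+ 2 + y ^+ 2) ^+ 2 = (x ^+ 2 - y ^+ 2) ^+ 2 + 4 * (x * y) ^+ 2.
  by ring.
have Q := sq e.1 e.2; have Q' := sq f.1 f.2; rewrite -/w -/w' in Q Q'.
have D0 : 0 < 4 - t ^+ 2 by nra.
have EE : e.1 ^+ 2 + e.2 ^+ 2 = 1 + t * w by lra.
have EE' : f.1 ^+ 2 + f.2 ^+ 2 = 1 + t * w' by lra.
have DD : e.1 ^+ 2 - e.2 ^+ 2 = - (f.1 ^+ 2 - f.2 ^+ 2) by lra.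
rewrite EE DD sqrrN in Q; rewrite EE' in Q'.
have ww : w = w'.
  have h := congr1 (fun z => z * (w - w')) S1; rewrite /= in h.
  have /eqP : (w - w') * (2 * t) = 0 by lra.
  by rewrite mulf_eq0 subr_eq0 => /orP[/eqP //|/eqP]; lra.
have wE : (4 - t ^+ 2) * w = 2 * t by rewrite -ww in S1; lra.
have D1 : f.2 ^+ 2 - f.1 ^+ 2 = 1.
  apply/eqP; rewrite -(eqrXn2 (n := 2)) ?subr_ge0 // expr1n; apply/eqP.
  by have h := congr1 (fun z => z * w) wE; rewrite /= in h; rewrite -ww in Q'; lra.
have XE : e.1 ^+ 2 * (4 - t ^+ 2) = 4.
  have -> : e.1 ^+ 2 = 1 + t * w / 2 by lra.
  by have h := congr1 (fun z => z * t) wE; rewrite /= in h; lra.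
have tt : t ^+ 2 = 2.
  have xt2 : e.1 ^+ 2 <= t ^+ 2 by rewrite ler_pXn2r ?nnegrE //; lra.
  have : 0 <= (t ^+ 2 - e.1 ^+ 2) * (4 - t ^+ 2) by apply: mulr_ge0; [rewrite subr_ge0 | exact: ltW].
  rewrite mulrBl XE => h; apply/eqP; rewrite -subr_eq0 -sqrf_eq0 eq_le sqr_ge0 andbT.
  by lra.
have X2 : e.1 ^+ 2 = 2 by rewrite tt in XE; lra.
have w2 : w = t by rewrite tt in wE; lra.
rewrite -ww w2 -expr2 tt in EE'.
have eX : e.1 = t by apply: eqr_sqr_pos; lra.
have eY : e.2 = 1 by apply: eqr_sqr_pos; rewrite ?expr1n; lra.
have fX : f.1 = 1 by apply: eqr_sqr_pos; rewrite ?expr1n; lra.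
have fY : f.2 = t by apply: eqr_sqr_pos; lra.
by split=> //; rewrite [LHS]surjective_pairing ?eX ?eY ?fX ?fY.
Qed.

(** Discarding [(t, 1)], the remaining elements lie in a sector whose opening is
    the minimal angle; so there are at most two of them, and two of them are
    the ends of that sector. *)
Lemma three_in_sector t O : 0 < t -> t < 2 -> uniq O -> (2 < size O)%N ->
  (forall e, e \in O -> [/\ 1 <= e.1, 1 <= e.2, e.1 <= t
     & e.1 ^+ 2 + e.2 ^+ 2 - t * (e.1 * e.2) = 1]) ->
  (forall e f, e \in O -> f \in O -> e != f ->
     e.1 * f.1 + e.2 * f.2 - t / 2 * (e.1 * f.2 + f.1 * e.2) <= t / 2) ->
  perm_eq O [:: (t, 1); (1, t); (t, t ^+ 2 - 1)].
Proof.
move=> t0 t2 uO sO OP far.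
pose p e := t * e.2 - (t ^+ 2 - 1) * e.1; pose q e := t * e.1 - e.2.
have arc e : e \in O -> e != (t, 1) -> 0 <= p e /\ 0 <= q e.
  case/OP=> x1 y1 xt E ne; have [[x y]|//] := narrow_arc t2 x1 y1 xt E.
  by case/eqP: ne; rewrite [e]surjective_pairing x y.
have sub : {subset O <= [:: (t, 1); (1, t); (t, t ^+ 2 - 1)]}.
  move=> e eO; rewrite inE; have [//|ne /=] := eqVneq e (t, 1).
  have [f fO /andP[nef nf]] : exists2 f, f \in O & (f != e) && (f != (t, 1)).
    apply/hasP; apply: contraTT sO => /hasPn h; rewrite -leqNgt.
    apply: (@leq_trans (size [:: e; (t, 1)])) => //; apply: uniq_leq_size => //.
    by move=> f /h; rewrite !inE negb_and !negbK.
  have [pe qe] := arc e eO ne; have [pf qf] := arc f fO nf.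
  have [x1 _ xt E] := OP e eO; have [_ _ _ E'] := OP f fO.
  have t1 : 1 <= t by lra.
  have [] := @arc_pair _ t e f p q (fun=> erefl) (fun=> erefl) t1 t2 E E' pe qe pf qf.
  - by apply: far => //; rewrite eq_sym.
  - by case=> ->; rewrite !inE eqxx ?orbT.
  - by case=> _ ->; rewrite !inE eqxx ?orbT.
apply: uniq_perm => //; first exact: leq_size_uniq uO sub sO.
by have [_] := uniq_min_size uO sub sO.
Qed.

(** With three, four or five lines the sector of the smallest angle forces the lines to
    be equally spaced; [t] is then twice the cosine of pi/3, pi/4 or pi/5. *)
Lemma narrow_sector t O : 0 < t -> t < 2 -> uniq O ->
  (forall e, e \in O -> [/\ 1 <= e.1, 1 <= e.2, e.1 <= t
     & e.1 ^+ 2 + e.2 ^+ 2 - t * (e.1 * e.2) = 1]) ->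
  (forall e f, e \in O -> f \in O -> e != f ->
     e.1 * f.1 + e.2 * f.2 - t / 2 * (e.1 * f.2 + f.1 * e.2) <= t / 2) ->
  \sum_(e <- O) (e.1 * e.2) * (2 * (1 - (t / 2) ^+ 2)) = (size O).+2%:R * (t / 2) ->
  \sum_(e <- O) (e.1 ^+ 2 - e.2 ^+ 2) = 0 ->
  [/\ (t, 1) \in O, (1, t) \in O & [\/ t = 1, t ^+ 2 = 2 | t ^+ 2 = t + 1]].
Proof.
move=> t0 t2 uO OP far S1 S2.
have [s3|s2] := ltnP 2 (size O).
  have pO := three_in_sector t0 t2 uO s3 OP far.
  rewrite !(perm_mem pO) !inE !eqxx !orbT; split=> //; constructor 3.
  have [t1 _ _ _] : [/\ 1 <= t, 1 <= (1 : R), t <= t & t ^+ 2 + 1 ^+ 2 - t * (t * 1) = 1].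
    by apply: (OP (t, 1)); rewrite (perm_mem pO) mem_head.
  rewrite (perm_big _ pO) !big_cons big_nil /= addr0 in S2.
  have : t = t ^+ 2 - 1; last by lra.
  have [] : 1 <= t /\ 1 <= t ^+ 2 - 1.
    have [] : [/\ 1 <= t, 1 <= t ^+ 2 - 1, t <= t & t ^+ 2 + (t ^+ 2 - 1) ^+ 2 - t * (t * (t ^+ 2 - 1)) = 1].
      by apply: (OP (t, t ^+ 2 - 1)); rewrite (perm_mem pO) !inE eqxx !orbT.
    by [].
  move=> _ t3; apply: eqr_sqr_pos; lra.
case: O s2 uO OP far S1 S2 => [|e [|f []]] // _ uO OP far S1 S2.
- by move: S1; rewrite big_nil /=; lra.
- have [x1 y1 _ E] := OP e (mem_head _ _).
  move: S1 S2; rewrite !big_seq1 /= => S1 S2.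
  have xy : e.1 = e.2 by apply: eqr_sqr_pos; lra.
  have xE : e.1 ^+ 2 * (2 - t) = 1 by rewrite -xy in E; lra.
  have tE : t = 1.
    have : (e.1 ^+ 2 * (2 - t)) * ((2 + t) / 2) = 3 * (t / 2) by rewrite -S1 -xy; field.
    by rewrite xE; lra.
  have e1 : e.1 = 1 by apply: eqr_sqr_pos; rewrite ?tE in xE *; lra.
  have -> : e = (t, 1) by rewrite [e]surjective_pairing -xy e1 tE.
  by rewrite tE mem_head; split=> //; constructor.
- have [x1 y1 xt E] := OP e (mem_head _ _).
  have [x1' y1' xt' E'] : [/\ 1 <= f.1, 1 <= f.2, f.1 <= t
     & f.1 ^+ 2 + f.2 ^+ 2 - t * (f.1 * f.2) = 1] by apply: OP; rewrite !inE eqxx orbT.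
  move: S1 S2; rewrite !big_cons !big_nil /= !addr0 => S1 S2.
  have {}S1 : (e.1 * e.2 + f.1 * f.2) * (4 - t ^+ 2) = 4 * t by lra.
  have [le_f|lt_f] := leP (f.1 ^+ 2) (f.2 ^+ 2).
    have [tt -> ->] := two_in_sector t0 t2 x1 y1 xt x1' y1' E E' S1 S2 le_f.
    by rewrite !inE !eqxx !orbT; split=> //; constructor.
  rewrite addrC in S1; rewrite addrC in S2.
  have [tt -> ->] := two_in_sector t0 t2 x1' y1' xt' x1 y1 E' E S1 S2 ltac:(lra).
  by rewrite !inE !eqxx !orbT; split=> //; constructor.
Qed.
End NarrowSector.

(** * Finitely generated cones *)

Section Cones.
Variables (R : realType) (d : nat).
Notation V := 'rV[R]_d.
Implicit Types (U B S : seq V) (a b c h p q s : V).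

Definition in_cone S v :=
  exists2 k : V -> R, forall s, 0 <= k s & v = \sum_(s <- S) k s *: s.

Lemma in_cone_perm S S' v : perm_eq S S' -> in_cone S v -> in_cone S' v.
Proof. by move=> pS [k k0 ->]; exists k => //; rewrite (perm_big _ pS). Qed.

Lemma in_cone_mem S v : uniq S -> v \in S -> in_cone S v.
Proof.
move=> uS vS; exists (fun s => (s == v)%:R); first by move=> s; exact: ler0n.
rewrite (bigD1_seq v) //= eqxx scale1r big1 ?addr0 // => s /negPf ->.
by rewrite scale0r.
Qed.

Lemma in_coneZ S v (k : R) : 0 <= k -> in_cone S v -> in_cone S (k *: v).
Proof.
move=> k0 [f f0 ->]; exists (fun s => k * f s); first by move=> s; exact: mulr_ge0.
by rewrite scaler_sumr; apply: eq_bigr => s _; rewrite scalerA.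
Qed.

Lemma in_coneD S v w : in_cone S v -> in_cone S w -> in_cone S (v + w).
Proof.
move=> [f f0 ->] [g g0 ->]; exists (fun s => f s + g s).
  by move=> s; exact: addr_ge0.
by rewrite -big_split; apply: eq_bigr => s _; rewrite scalerDl.
Qed.

Lemma in_cone_cons s S v : in_cone S s -> in_cone (s :: S) v -> in_cone S v.
Proof.
move=> Ss [k k0 ->]; rewrite big_cons; apply: in_coneD; first exact: in_coneZ.
by exists k.
Qed.

(** In a nonnegative combination that equals [e], the functional [p] and then [q] leave
    only multiples of [e] itself. *)
Lemma extremal_generator B S e p q : {subset S <= B} -> in_cone S e -> e != 0 ->
  dot p e = 0 -> dot q e = 0 ->
  (forall b, b \in B -> 0 <= dot p b) ->
  (forall b, b \in B -> dot p b = 0 -> 0 <= dot q b) ->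
  (forall b, b \in B -> dot p b = 0 -> dot q b = 0 -> b = e) ->
  e \in S.
Proof.
move=> SB [k k0 eE] e0 pe qe p0 q0 pq.
have /hasP[s sS ks] : has (fun s => k s != 0) S.
  apply: contraR e0 => /hasPn h; apply/eqP; rewrite eE big_seq big1 // => s /h.
  by rewrite negbK => /eqP ->; rewrite scale0r.
have zero (f : V -> R) : (forall s, s \in S -> 0 <= k s * f s) ->
    \sum_(s <- S) k s * f s = 0 -> forall s, s \in S -> k s * f s = 0.
  move=> f0 /eqP; rewrite big_seq psumr_eq0 // => /allP f00 u uS.
  by have := f00 u uS; rewrite uS => /eqP.
have ps : forall s, s \in S -> k s * dot p s = 0.
  apply: (zero (dot p)) => [u uS|]; first by rewrite mulr_ge0 // p0 // SB.
  by rewrite -[RHS]pe [in RHS]eE dot_sumr; apply: eq_bigr => u _; rewrite dotZr.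
have qs : forall s, s \in S -> k s * dot q s = 0.
  apply: (zero (dot q)) => [u uS|].
    have /eqP := ps u uS; rewrite mulf_eq0 => /orP[/eqP ->|/eqP pu].
      by rewrite mul0r.
    by rewrite mulr_ge0 // q0 // SB.
  by rewrite -[RHS]qe [in RHS]eE dot_sumr; apply: eq_bigr => u _; rewrite dotZr.
rewrite -(pq s) ?SB //; apply/eqP.
  by have /eqP := ps s sS; rewrite mulf_eq0 (negPf ks).
by have /eqP := qs s sS; rewrite mulf_eq0 (negPf ks).
Qed.

(** Pairwise obtuse vectors in an open half-space are independent: the positive
    and the negative part of a relation are equal, and their inner product
    is nonpositive. *)
Lemma obtuse_free S h : uniq S -> (forall s, s \in S -> 0 < dot h s) ->
  (forall s s', s \in S -> s' \in S -> s != s' -> dot s s' <= 0) -> free S.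
Proof.
move=> uS h0 obt; apply/(freeP (X := in_tuple S)) => k kS i.
have nS (j : 'I_(size S)) : (in_tuple S)`_j \in S by exact: mem_nth.
pose kp j := Num.max (k j) 0; pose km j := Num.max (- k j) 0.
have kp0 j : 0 <= kp j by rewrite le_max lexx orbT.
have km0 j : 0 <= km j by rewrite le_max lexx orbT.
have kE j : k j = kp j - km j.
  by rewrite /kp /km; case: leP => h1; case: leP => h2; lra.
have kk j : kp j * km j = 0.
  by rewrite /kp /km; case: leP => h1; case: leP => h2; nra.
pose u := \sum_j kp j *: (in_tuple S)`_j.
have uE : u = \sum_j km j *: (in_tuple S)`_j.
  apply/eqP; rewrite -subr_eq0 -sumrB -[X in _ == X]kS; apply/eqP.
  by apply: eq_bigr => j _; rewrite kE scalerBl.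
have u0 : u = 0.
  apply/eqP; rewrite -dot_eq0 eq_le dot_ge0 andbT {2}uE dot_suml.
  apply: sumr_le0 => j _; rewrite dot_sumr; apply: sumr_le0 => l _.
  rewrite dotZl dotZr mulrA; have [->|jl] := eqVneq j l; first by rewrite kk mul0r.
  by rewrite mulr_ge0_le0 ?mulr_ge0 // obt // nth_uniq // .
have zero (f : 'I_(size S) -> R) : (forall j, 0 <= f j) ->
    \sum_j f j *: (in_tuple S)`_j = 0 -> f i = 0.
  move=> f0 fS; have : \sum_j f j * dot h (in_tuple S)`_j = 0.
    by rewrite -[RHS](dot0r h) -[in RHS]fS dot_sumr; apply: eq_bigr => j _; rewrite dotZr.
  move/eqP; rewrite psumr_eq0 => [/allP/(_ i)|j _]; last by rewrite mulr_ge0 // ltW // h0.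
  rewrite mem_index_enum => /(_ isT) /=; rewrite mulf_eq0 (gt_eqF (h0 _ (nS i))) orbF.
  by move/eqP.
by rewrite kE (zero kp) // (zero km) ?subrr // -uE.
Qed.

(** This replaces a lexicographic order, given by two functionals, by a single
    functional. *)
Lemma perturb B p q : (forall b, b \in B -> 0 <= dot p b) ->
  (forall b, b \in B -> dot p b = 0 -> 0 < dot q b) ->
  exists k : R, forall b, b \in B -> 0 < dot (k *: p + q) b.
Proof.
move=> p0 q0; have [k0 [k0_ge0 kP]] : exists k : R, 0 <= k /\
    forall b, b \in B -> dot p b != 0 -> - dot q b < k * dot p b.
  elim: B p0 q0 => [|b B IH] p0 q0; first by exists 0.
  have [k [kk kP]] : exists k : R, 0 <= k /\
    forall b, b \in B -> dot p b != 0 -> - dot q b < k * dot p b.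
    by apply: IH => [u uB|u uB]; [apply: p0|apply: q0]; rewrite inE uB orbT.
  have [pb|pb] := eqVneq (dot p b) 0.
    exists k; split=> // u; rewrite inE => /orP[/eqP ->|]; [by rewrite pb eqxx|exact: kP].
  have pb0 : 0 < dot p b by rewrite lt_def pb p0 // mem_head.
  exists (k + (`|dot q b| + 1) / dot p b); split.
    by apply: addr_ge0 => //; apply: divr_ge0; [exact: addr_ge0|exact: ltW].
  move=> u; rewrite inE => /orP[/eqP -> _|uB pu].
    rewrite mulrDl divfK //; have := ler_norm (- dot q b); rewrite normrN.
    by have := mulr_ge0 kk (ltW pb0); lra.
  apply: lt_le_trans (kP u uB pu) _; rewrite ler_wpM2r ?p0 ?inE ?uB ?orbT //.
  by rewrite lerDl; apply: divr_ge0; [exact: addr_ge0|exact: ltW].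
exists k0 => b bB; rewrite !dotE.
have [pb|pb] := eqVneq (dot p b) 0; first by rewrite pb mulr0 add0r q0.
by have := kP b bB pb; lra.
Qed.

End Cones.

(** * Simple systems *)

Section SimpleSystems.
Variables (R : realType) (d : nat).
Notation V := 'rV[R]_d.
Implicit Types (U B S : seq V) (a b c h p q s u v : V).

Definition regular U h := forall u, u \in U -> dot h u != 0.
Definition positive U h := [seq if 0 < dot h u then u else - u | u <- U].

Lemma positiveP U h v : regular U h ->
  (v \in positive U h) = pm U v && (0 < dot h v).
Proof.
move=> rh; apply/mapP/andP => [[u uU ->]|[/orP[]vU hv]].
- case: ifPn => h0; first by rewrite /pm uU.
  by rewrite pmN /pm uU dotNr oppr_gt0 lt_def leNgt h0 eq_sym rh.
- by exists v => //; rewrite hv.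
- by exists (- v) => //; rewrite dotNr oppr_gt0 ltNge ltW //= opprK.
Qed.

Lemma positiveN U h v : regular U h -> pm U v ->
  v \in positive U h \/ - v \in positive U h.
Proof.
move=> rh pv; have nz : dot h v != 0.
  by case/orP: pv => /rh //; rewrite dotNr oppr_eq0.
rewrite !positiveP // pmN pv dotNr oppr_gt0 /=.
by case: ltgtP nz => //; [left|right].
Qed.

(** Expand [x *: s + y *: s'] in the cone and solve for [s]: the coefficient of [s] stays
    positive, because the functional [h] is positive on all other terms. *)
Lemma acute_redundant U h S s s' : planar_tight U -> regular U h ->
  {subset s :: S <= positive U h} -> uniq (s :: S) -> s' \in S ->
  (forall v, v \in positive U h -> in_cone (s :: S) v) ->
  (exists x y : R, [/\ 0 < x, y < 0 & x *: s + y *: s' \in positive U h]) ->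
  in_cone S s.
Proof.
move=> tU rh SB /= /andP[_ uS] s'S gen [x [y [x0 y0 cB]]].
have [k k0 kE] := gen _ cB.
have hpos v : v \in s :: S -> 0 < dot h v.
  by move/SB; rewrite positiveP // => /andP[].
have := kE; rewrite big_cons.
set T := \sum_(v <- S) _ => TE.
have E : (x - k s) *: s = T - y *: s'.
  have xE : x *: s = k s *: s + T - y *: s' by rewrite -TE addrK.
  by rewrite scalerBl xE addrC -addrA addKr.
have cT : in_cone S (T - y *: s').
  apply: in_coneD; first by exists k.
  by rewrite -scaleNr; apply: in_coneZ; [lra|exact: in_cone_mem].
have xk : 0 < x - k s.
  have : 0 < dot h ((x - k s) *: s).
    rewrite E dotDr dotNr dotZr ltr_wpDl //.
      rewrite dot_sumr big_seq sumr_ge0 // => v vS; rewrite dotZr mulr_ge0 // ltW //.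
      by rewrite hpos // inE vS orbT.
    by rewrite -mulNr mulr_gt0 ?oppr_gt0 ?hpos // inE s'S orbT.
  by rewrite dotZr pmulr_lgt0 // hpos // mem_head.
rewrite -[s](scalerK (lt0r_neq0 xk)) E; apply: in_coneZ => //.
by rewrite invr_ge0 ltW.
Qed.

(** In a minimal generating set no two vectors form an acute angle: tightness of their
    plane would yield a vector of the system outside their cone, and one of the two
    would be redundant. *)
Lemma obtuse_generators U h : planar_tight U -> regular U h ->
  exists S, [/\ uniq S, {subset S <= positive U h},
    forall v, v \in positive U h -> in_cone S v
    & forall s s', s \in S -> s' \in S -> s != s' -> dot s s' <= 0].
Proof.
move=> tU rh.
have uB : uniq (positive U h).
  rewrite map_inj_in_uniq ?(tight_uniq tU) // => u v uU vU.
  have := tight_line tU uU; have := tight_line tU vU.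
  case: ifP => _; case: ifP => _ //; last by move=> _ _ /oppr_inj.
    by move=> nv _ E; rewrite -E uU in nv.
  by move=> _ nu E; rewrite E vU in nu.
have : exists S, [/\ uniq S, {subset S <= positive U h} &
    forall v, v \in positive U h -> in_cone S v].
  by exists (positive U h); split=> // v; exact: in_cone_mem.
move=> [S [uS SB gen]].
elim: {S}(size S) {-2}S (leqnn (size S)) uS SB gen => [|n IH] S sS uS SB gen.
  by exists S; split=> // s s'; case: S sS {uS SB gen}.
have [ob|] := boolP (all (fun s => all (fun s' => (s != s') ==> (dot s s' <= 0)) S) S).
  exists S; split=> // s s' sS' s'S nss.
  by have /allP/(_ _ s'S) := allP ob s sS'; rewrite nss.
rewrite -has_predC => /hasP[s sS' /=]; rewrite -has_predC => /hasP[s' s'S /=].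
rewrite negb_imply -ltNge => /andP[nss acute].
have drop r : r \in S -> in_cone (rem r S) r -> exists S, [/\ uniq S,
    {subset S <= positive U h}, forall v, v \in positive U h -> in_cone S v
    & forall s s', s \in S -> s' \in S -> s != s' -> dot s s' <= 0].
  move=> rS rC; apply: (IH (rem r S)).
  - by rewrite size_rem //; case: (size S) sS.
  - exact: rem_uniq.
  - by move=> v /mem_rem /SB.
  - move=> v /gen /(in_cone_perm (perm_to_rem rS)); exact: in_cone_cons.
have rem_ok r r' : r \in S -> r' \in S -> r != r' ->
  (exists x y : R, [/\ 0 < x, y < 0 & x *: r + y *: r' \in positive U h]) ->
  in_cone (rem r S) r.
  move=> rS r'S nrr; have pS := perm_to_rem rS.
  apply: (@acute_redundant U h (rem r S) r r' tU rh).
  - by move=> v; rewrite -(perm_mem pS) => /SB.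
  - by rewrite -(perm_uniq pS).
  - by rewrite mem_rem_uniq // !inE eq_sym nrr.
  - by move=> v /gen; exact: in_cone_perm.
have posS r : r \in S -> pm U r /\ 0 < dot h r.
  by move/SB; rewrite positiveP // => /andP[].
have [ps hs] := posS _ sS'; have [ps' hs'] := posS _ s'S.
have nssN : s != - s'.
  by apply: contraTneq hs => ->; rewrite dotNr oppr_gt0 -leNgt ltW.
have [x [y [pc xy]]] : exists x y : R, pm U (x *: s + y *: s') /\ x * y < 0.
  apply: contrapT => no.
  have [x y pxy|O [_ OP _ S1 _]] := plane_coords tU ps ps' nss nssN.
    by rewrite leNgt; apply/negP => xy; apply: no; exists x, y.
  have : 0 <= \sum_(e <- O) e.1 * e.2 * (2 * (1 - dot s s' ^+ 2)).
    rewrite big_seq sumr_ge0 // => e /OP[e1 e2 _].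
    rewrite !mulr_ge0 ?(ltW e1) ?(ltW e2) //.
    by apply/ltW/gram2_gt0; rewrite ?(pm_unit tU).
  by rewrite S1 oppr_ge0 pmulr_rle0 // leNgt acute.
have [x' [y' [cB xy']]] : exists x y : R,
    x *: s + y *: s' \in positive U h /\ x * y < 0.
  have [cB|cB] := positiveN rh pc; first by exists x, y.
  by exists (- x), (- y); rewrite !scaleNr -opprD mulrNN.
have [x0|x0] := leP x' 0.
  have x0' : x' < 0.
    by rewrite lt_neqAle x0 andbT; apply: contraTneq xy' => ->; rewrite mul0r ltxx.
  have y0 : 0 < y' by rewrite -(nmulr_rlt0 _ x0').
  by apply: (drop s'); last (apply: (rem_ok s' s); rewrite 1?eq_sym //; exists y', x'; rewrite addrC).
have y0 : y' < 0 by rewrite -(pmulr_rlt0 _ x0).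
by apply: (drop s) => //; apply: (rem_ok s s') => //; exists x', y'.
Qed.

(** Hence all chambers of the arrangement are simplicial. *)
Lemma simple_generators U h : planar_tight U -> regular U h ->
  exists S, [/\ size S = d, free S, {subset S <= positive U h} &
    forall v, v \in positive U h -> in_cone S v].
Proof.
move=> tU rh; have [S [uS SB gen obt]] := obtuse_generators tU rh.
exists S; have fS : free S.
  by apply: (@obtuse_free _ _ S h uS _ obt) => s /SB; rewrite positiveP // => /andP[].
split=> //; have := fS; rewrite /free => /eqP <-.
suff -> : <<S>>%VS = fullv by rewrite dimvf; exact: mul1n.
apply/eqP; rewrite eqEsubv subvf -[X in (X <= _)%VS](tight_span tU); apply/span_subvP => u uU.
have coneS v : in_cone S v -> v \in <<S>>%VS.
  move=> [k _ ->]; rewrite big_seq memv_suml // => s sS.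
  by rewrite memvZ // memv_span.
have pu : pm U u by rewrite /pm uU.
by have [/gen/coneS //|/gen/coneS] := positiveN rh pu; rewrite memvN.
Qed.

End SimpleSystems.

(** * Chambers and their neighbours *)

Section Chambers.
Variable R : realType.
Notation V := 'rV[R]_3.
Implicit Types (U S : seq V) (a b c h p q r u v : V) (x y z : R).

Definition same_sign x y z :=
  [/\ 0 <= x, 0 <= y & 0 <= z] \/ [/\ x <= 0, y <= 0 & z <= 0].

(** The vectors [a], [b], [c] are the inner normals of the walls of a simplicial
    chamber: no hyperplane of the system meets it exactly when the coordinates of
    each vector on them have one sign. *)
Definition chamber U a b c := [/\ pm U a, pm U b, pm U c, free [:: a; b; c] &
  forall v, pm U v ->
    exists x y z, v = x *: a + y *: b + z *: c /\ same_sign x y z].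

Lemma scalar_dot (f : {scalar V}) : exists p, forall v, dot p v = f v.
Proof.
exists (\row_j f (delta_mx 0 j)) => v.
rewrite [in RHS](row_sum_delta v) linear_sum; apply: eq_bigr => j _.
by rewrite linearZ /= mxE mulrC.
Qed.

Lemma free_dual a b c : free [:: a; b; c] -> exists p q r,
  [/\ forall x y z, dot p (x *: a + y *: b + z *: c) = x,
      forall x y z, dot q (x *: a + y *: b + z *: c) = y
    & forall x y z, dot r (x *: a + y *: b + z *: c) = z].
Proof.
move=> fX; pose X := [tuple a; b; c]; have {}fX : free X by [].
have [p pE] := scalar_dot (coord X 0); have [q qE] := scalar_dot (coord X 1).
have [r rE] := scalar_dot (coord X (2%:R : 'I_3)).
have XE (i : 'I_3) x y z : coord X i (x *: a + y *: b + z *: c) =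
    x * (i == 0)%:R + y * (i == 1)%:R + z * (i == 2%:R)%:R.
  have ea : coord X i a = (i == 0)%:R by rewrite eq_sym -(coord_free 0 i fX).
  have eb : coord X i b = (i == 1)%:R by rewrite eq_sym -(coord_free 1 i fX).
  have ec : coord X i c = (i == 2%:R)%:R by rewrite eq_sym -(coord_free 2%:R i fX).
  by rewrite !linearD !linearZ /= ea eb ec.
by exists p, q, r; split=> x y z; rewrite ?pE ?qE ?rE [LHS]XE /=; ring.
Qed.

Lemma free3_coord a b c v : free [:: a; b; c] ->
  exists x y z : R, v = x *: a + y *: b + z *: c.
Proof.
move=> fabc; have : v \in <<[:: a; b; c]>>%VS.
  suff -> : <<[:: a; b; c]>>%VS = fullv by rewrite memvf.
  by apply/eqP; rewrite eqEdim subvf dimvf (eqP fabc).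
rewrite span_cons => /memv_addP[_ /vlineP[x ->] [w /span2P[y [z ->]] ->]].
by exists x, y, z; rewrite addrA.
Qed.

Lemma chamber_sign U a b c x y z : chamber U a b c ->
  pm U (x *: a + y *: b + z *: c) -> same_sign x y z.
Proof.
case=> _ _ _ /free_dual[p [q [r [pE qE rE]]]] ch /ch[x' [y' [z' [E s]]]].
have ex := congr1 (dot p) E; have ey := congr1 (dot q) E.
have ez := congr1 (dot r) E; move: s.
by rewrite -(pE x' y' z') -ex -(qE x' y' z') -ey -(rE x' y' z') -ez pE qE rE.
Qed.

Lemma chamber_rot U a b c : chamber U a b c -> chamber U b c a.
Proof.
case=> pa pb pc f ch; split=> //.
  have pe : perm_eq [:: b; c; a] [:: a; b; c] by rewrite (perm_rot 1 [:: a; b; c]).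
  by rewrite (perm_free pe).
move=> v /ch[x [y [z [-> s]]]]; exists y, z, x; split; first by rewrite -addrA addrC.
by case: s => [[]|[]] *; [left|right].
Qed.

Lemma chamber_swap U a b c : chamber U a b c -> chamber U b a c.
Proof.
case=> pa pb pc f ch; split=> //.
  have pe : perm_eq [:: b; a; c] [:: a; b; c] by rewrite (perm_catCA [:: b] [:: a] [:: c]).
  by rewrite (perm_free pe).
move=> v /ch[x [y [z [-> s]]]]; exists y, x, z; split; first by rewrite [y *: _ + _]addrC.
by case: s => [[]|[]] *; [left|right].
Qed.

Lemma chamber_of_generators U S h a b c : regular U h ->
  size S = 3 -> free S -> {subset S <= positive U h} ->
  (forall v, v \in positive U h -> in_cone S v) ->
  a \in S -> b \in S -> c \in S -> uniq [:: a; b; c] -> chamber U a b c.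
Proof.
move=> rh sS fS SB gen aS bS cS uabc.
have sub : {subset [:: a; b; c] <= S}.
  by move=> v; rewrite !inE => /or3P[]/eqP ->.
have sz : (size S <= size [:: a; b; c])%N by rewrite sS.
have pS : perm_eq S [:: a; b; c].
  rewrite perm_sym; apply: uniq_perm => //; first exact: free_uniq.
  by have [_] := uniq_min_size uabc sub sz.
have posS v : v \in S -> pm U v by move/SB; rewrite positiveP // => /andP[].
split; rewrite ?posS // -?(perm_free pS) // => v pv.
have coneE w : w \in positive U h -> exists x y z,
    [/\ w = x *: a + y *: b + z *: c, 0 <= x, 0 <= y & 0 <= z].
  move=> /gen[k k0 ->]; exists (k a), (k b), (k c).
  by rewrite (perm_big _ pS) !big_cons big_nil /= addr0 addrA.
have [/coneE|/coneE] := positiveN rh pv => -[x [y [z [E x0 y0 z0]]]].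
  by exists x, y, z; split=> //; left.
exists (- x), (- y), (- z); split; last by right; rewrite !oppr_le0.
by rewrite -[v]opprK E !scaleNr !opprD.
Qed.

Lemma unit_multiple a k : dot a a = 1 -> dot (k *: a) (k *: a) = 1 ->
  0 < k -> k = 1.
Proof.
move=> a1; rewrite !dotE a1 mulr1 -expr2 => k2 k0.
by apply/eqP; rewrite -(eqrXn2 (n := 2)) ?(ltW k0) // k2 expr1n.
Qed.

(** Crossing the wall orthogonal to [a] changes the sign of [a] only.  Within the
    planes through [a] the new extremal rays are the lines next to [a]; these
    planes are faces of the new positive cone, so these rays are extremal there,
    and three of them are all. *)
Lemma neighbour U a b c (tb tc : R) : planar_tight U -> chamber U a b c ->
  pm U (b + tb *: a) -> pm U (c + tc *: a) ->
  (forall x y, 0 <= x -> 0 < y -> pm U (x *: a + y *: b) -> x <= tb * y) ->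
  (forall x y, 0 <= x -> 0 < y -> pm U (x *: a + y *: c) -> x <= tc * y) ->
  chamber U (- a) (b + tb *: a) (c + tc *: a).
Proof.
move=> tU ch pb' pc' maxb maxc; have [pa pb pc fabc chP] := ch.
have [p [q [r [pE qE rE]]]] := free_dual fabc.
have a1 := pm_unit tU pa.
pose L x y z : V := x *: a + y *: b + z *: c.
have aE : a = L 1 0 0 by rewrite /L scale1r !scale0r !addr0.
have bE : b + tb *: a = L tb 1 0 by rewrite /L scale1r scale0r addr0 addrC.
have cE : c + tc *: a = L tc 0 1 by rewrite /L scale1r scale0r addr0 addrC.
have dE := (dotDl, dotNl, pE, qE, rE).
have multa x : pm U (L x 0 0) -> 0 <= x -> L x 0 0 = a.
  rewrite /L !scale0r !addr0 => /(pm_unit tU) x1 x0.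
  rewrite (unit_multiple a1 x1) ?scale1r // lt_def x0 andbT.
  by apply/eqP => xz; move: x1; rewrite xz scale0r dot0l; lra.
have reg0 : regular U (p + q + r).
  move=> u uU; have pu : pm U u by rewrite /pm uU.
  have [x [y [z [uE s]]]] := chP u pu; apply: contraTneq (pm_neq0 tU pu) => u0.
  rewrite uE !dE in u0; rewrite uE negbK.
  have [-> -> ->] : [/\ x = 0, y = 0 & z = 0] by case: s => [[]|[]] *; split; lra.
  by rewrite !scale0r !addr0.
(* The vectors that are positive on both sides of the wall of [a]. *)
pose B := [seq v <- positive U (p + q + r) | v != a].
have BP v : v \in B -> [/\ v != a, pm U v &
    exists x y z, [/\ v = L x y z, 0 <= x, 0 <= y & 0 <= z]].
  rewrite mem_filter positiveP // => /and3P[va pv hv]; split=> //.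
  have [x [y [z [vE s]]]] := chP v pv; exists x, y, z; split=> //;
  by move: hv; rewrite vE !dE; case: s => [[]|[]] *; lra.
have Byz v : v \in B -> dot (q + r) v = 0 -> False.
  move/BP => [va pv [x [y [z [vE x0 y0 z0]]]]]; rewrite vE !dE => yz.
  case/eqP: va; rewrite vE in pv *; have [yE zE] : y = 0 /\ z = 0 by split; lra.
  by rewrite yE zE in pv *; apply: multa.
have [k kP] : exists k : R, forall b, b \in B -> 0 < dot (k *: (q + r) + (- p)) b.
  apply: perturb => v vB; last by move/(Byz v vB).
  by have [_ _ [x [y [z [-> x0 y0 z0]]]]] := BP v vB; rewrite !dE addr_ge0.
set h := k *: (q + r) + (- p) in kP.
have ha : dot h a = -1 by rewrite aE /h dotDl dotZl !dE; ring.
have split_pm v : pm U v -> [\/ v = a, v = - a, v \in B | - v \in B].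
  move=> pv; have [->|va] := eqVneq v a; first by constructor 1.
  have [->|vna] := eqVneq v (- a); first by constructor 2.
  have [vp|vp] := positiveN reg0 pv; [constructor 3|constructor 4].
    by rewrite mem_filter va.
  by rewrite mem_filter vp eqr_oppLR vna.
have regh : regular U h.
  move=> u uU; have pu : pm U u by rewrite /pm uU.
  have [->|->|/kP|/kP] := split_pm u pu; rewrite ?dotNr ?ha ?opprK ?oppr_eq0 ?oner_eq0 //.
    by move/lt0r_neq0.
  by rewrite oppr_gt0 => /ltr0_neq0.
have posP v : v \in positive U h -> v = - a \/ v \in B.
  rewrite positiveP // => /andP[/split_pm s]; case: s => [->|->|vB|vB] hv.
  - by exfalso; move: hv; rewrite ha; lra.
  - by left.
  - by right.
  - by exfalso; have := kP _ vB; rewrite dotNr; lra.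
have [S [sS fS SB gen]] := simple_generators tU regh.
have naB : - a \in positive U h by rewrite positiveP // pmN pa dotNr ha opprK ltr01.
have posqr v : v \in positive U h -> 0 <= dot q v /\ 0 <= dot r v.
  move=> /posP[->|/BP[_ _ [x [y [z [-> x0 y0 z0]]]]]]; last by rewrite !dE.
  by rewrite aE !dotNr !dE oppr0.
have naS : - a \in S.
  apply: (@extremal_generator _ _ (positive U h) S (- a) (q + r) (q + r)) => //.
  - exact: gen.
  - by rewrite oppr_eq0 (pm_neq0 tU).
  - by rewrite aE dotNr !dE addr0 oppr0.
  - by rewrite aE dotNr !dE addr0 oppr0.
  - by move=> v /posqr[q0 r0]; rewrite dotDl addr_ge0.
  - by move=> v /posqr[q0 r0] _; rewrite dotDl addr_ge0.
  - by move=> v /posP[//|vB] /(Byz v vB).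
(* The plane of [a] and [w] is the face on which [r1] vanishes, and [t *: q1 - p] vanishes
   on its extremal ray [w']. *)
have side (w w' : V) (t : R) (q1 r1 : V) :
    pm U w' -> w' = w + t *: a -> dot q1 w = 1 -> dot r1 w = 0 -> dot p w = 0 ->
    dot q1 a = 0 -> dot r1 a = 0 ->
    (forall v, v \in positive U h -> 0 <= dot q1 v /\ 0 <= dot r1 v) ->
    (forall v, v \in B -> dot r1 v = 0 ->
       exists x y, [/\ v = x *: a + y *: w, 0 <= x & 0 < y]) ->
    (forall x y, 0 <= x -> 0 < y -> pm U (x *: a + y *: w) -> x <= t * y) ->
    w' \in S.
  move=> pw' w'E q1w r1w pw q1a r1a pos1 rB maxw.
  have pa1 : dot p a = 1 by rewrite aE pE.
  have w'1 := pm_unit tU pw'.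
  have w'B : w' \in positive U h.
    have [//|/pos1[]] := positiveN regh pw'.
    by rewrite w'E dotNr dotDr dotZr q1w q1a; lra.
  apply: (@extremal_generator _ _ (positive U h) S w' r1 (t *: q1 - p)) => //.
  - exact: gen.
  - exact: pm_neq0 pw'.
  - by rewrite w'E dotDr dotZr r1w r1a mulr0 addr0.
  - rewrite w'E dotDl dotNl dotZl !dotDr !dotZr q1w q1a pw pa1; ring.
  - by move=> v /pos1[].
  - move=> v vP rv; have [->|vB] := posP v vP.
      by rewrite !dotE q1a pa1; lra.
    have [x [y [vE x0 y0]]] := rB v vB rv; have [_ pv _] := BP v vB.
    rewrite vE in pv; have := maxw x y x0 y0 pv.
    by rewrite vE !dotE q1a q1w pw pa1; lra.
  - move=> v vP rv; have [->|vB] := posP v vP.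
      by rewrite !dotE q1a pa1 => e; exfalso; lra.
    have [x [y [vE x0 y0]]] := rB v vB rv; have [_ pv _] := BP v vB.
    rewrite {1}vE !dotE q1a q1w pw pa1 => xE.
    have {}vE : v = y *: w'.
      by rewrite vE w'E scalerDr scalerA addrC; congr (_ + _ *: _); lra.
    have := pm_unit tU pv; rewrite vE => y1.
    by rewrite (unit_multiple w'1 y1 y0) scale1r.
have bL : b = L 0 1 0 by rewrite /L scale1r !scale0r add0r addr0.
have cL : c = L 0 0 1 by rewrite /L scale1r !scale0r !add0r.
have [pa1 qa1 ra1] : [/\ dot p a = 1, dot q a = 0 & dot r a = 0].
  by rewrite aE !dE.
have [pb1 qb1 rb1] : [/\ dot p b = 0, dot q b = 1 & dot r b = 0].
  by rewrite bL !dE.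
have [pc1 qc1 rc1] : [/\ dot p c = 0, dot q c = 0 & dot r c = 1].
  by rewrite cL !dE.
have b'S : b + tb *: a \in S.
  apply: (side b _ tb q r) => // v vB rv.
  have [va pv [x [y [z [vE x0 y0 z0]]]]] := BP v vB.
  rewrite vE rE in rv; exists x, y; rewrite vE /L rv scale0r addr0; split=> //.
  rewrite lt_def y0 andbT; apply/eqP => yE; apply: (Byz v vB).
  by rewrite vE !dE yE rv addr0.
have c'S : c + tc *: a \in S.
  apply: (side c _ tc r q) => //; first by move=> v /posqr[].
  move=> v vB rv; have [va pv [x [y [z [vE x0 y0 z0]]]]] := BP v vB.
  rewrite vE qE in rv; exists x, z; rewrite vE /L rv scale0r addr0; split=> //.
  rewrite lt_def z0 andbT; apply/eqP => zE; apply: (Byz v vB).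
  by rewrite vE !dE zE rv addr0.
apply: (chamber_of_generators regh sS fS SB gen) => //.
rewrite /= !inE negb_or andbT -andbA; apply/and3P; split.
- by apply/eqP => /(congr1 (dot q)); rewrite bE {1}aE dotNr !dE; lra.
- by apply/eqP => /(congr1 (dot r)); rewrite cE {1}aE dotNr !dE; lra.
- by apply/eqP => /(congr1 (dot q)); rewrite cE bE !dE; lra.
Qed.

End Chambers.

(** * Angles of a chamber *)

Section Seeds.
Variable R : realType.
Notation V := 'rV[R]_3.
Implicit Types (U S : seq V) (a b c h p q r u v : V) (x y z t ka : R).

Definition apart_by U ka := forall u v, pm U u -> pm U v ->
  u != v -> u != - v -> `|dot u v| <= ka.

(** The right-hand side is the squared sine of the angle with [a]. *)
Lemma apart_coord_bound U ka a b x y : planar_tight U -> apart_by U ka ->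
  pm U a -> pm U b -> a != b -> a != - b -> 0 < y ->
  pm U (x *: a + y *: b) -> 1 - ka ^+ 2 <= y ^+ 2 * (1 - dot a b ^+ 2).
Proof.
move=> tU far pa pb nab nabN y0 pv; set v := _ + _ in pv.
have [[a1 b1] v1] := (pm_unit tU pa, pm_unit tU pb, pm_unit tU pv).
have D0 := gram2_gt0 a1 b1 nab nabN.
have E : y ^+ 2 * (1 - dot a b ^+ 2) = 1 - dot v a ^+ 2.
  by rewrite -[in RHS]v1 /v !dotE a1 b1 (dotC b a); ring.
have pos : 0 < y ^+ 2 * (1 - dot a b ^+ 2) by rewrite mulr_gt0 ?exprn_gt0.
have vnz : (v != a) && (v != - a).
  apply/andP; split; apply: contraTneq pos => va; rewrite E va ?dotNl a1; lra.
case/andP: vnz => na naN; have h := far _ _ pv pa na naN.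
have : `|dot v a| ^+ 2 <= ka ^+ 2.
  by rewrite ler_pXn2r ?nnegrE // (le_trans _ h).
by rewrite E real_normK ?num_real //; lra.
Qed.

Lemma simple_pair_obtuse U a b : planar_tight U ->
  pm U a -> pm U b -> a != b -> a != - b ->
  simple_pair U a b -> dot a b <= 0.
Proof.
move=> tU pa pb nab nabN simple.
have [O [_ OP _ S1 _]] := plane_coords tU pa pb nab nabN simple.
rewrite -(pmulr_rle0 _ (ltr0Sn R (size O).+1)) -oppr_ge0 -S1.
rewrite big_seq sumr_ge0 // => e /OP[e1 e2 _].
rewrite !mulr_ge0 ?(ltW e1) ?(ltW e2) //.
by apply/ltW/gram2_gt0; rewrite ?(pm_unit tU).
Qed.

(** An angle whose sum with the smallest angle exceeds pi/2 leaves room for at most one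
    further line between its sides, and then tightness leaves only pi/2 and pi/3. *)
Lemma wide_pair U ka a b : planar_tight U -> apart_by U ka ->
  pm U a -> pm U b -> a != b -> a != - b ->
  simple_pair U a b ->
  dot a b ^+ 2 < 1 - ka ^+ 2 ->
  (dot a b = 0 /\ forall x y, 0 < x -> 0 < y -> ~ pm U (x *: a + y *: b)) \/
  [/\ dot a b = - (1 / 2), pm U (a + b) &
     forall x y, 0 < x -> 0 < y -> pm U (x *: a + y *: b) -> x = 1 /\ y = 1].
Proof.
move=> tU far pa pb nab nabN simple wide.
have [a1 b1] := (pm_unit tU pa, pm_unit tU pb).
have g0 := simple_pair_obtuse tU pa pb nab nabN simple.
have [O [uO OP inO S1 S2]] := plane_coords tU pa pb nab nabN simple.
have nba : b != a by rewrite eq_sym.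
have nbaN : b != - a by rewrite -eqr_oppLR eq_sym.
have [|||e eO||//|[g OE]|[g OE]] := @wide_sector _ (- dot a b) ka O.
- by rewrite oppr_ge0.
- by rewrite -(ler0_norm g0); exact: far.
- by rewrite sqrrN.
- have [e1 e2 pe] := OP e eO; split=> //.
  + by rewrite -[RHS](pm_unit tU pe) !dotE a1 b1 (dotC b a); ring.
  + rewrite sqrrN (dotC a b); apply: (apart_coord_bound tU far pb pa nba nbaN e1 (x := e.2)).
    by rewrite addrC.
  + by rewrite sqrrN; exact: (apart_coord_bound tU far pa pb nab nabN e2 pe).
- by rewrite sqrrN S1 mulrN.
- left; split; first by lra.
  by move=> x y x0 y0 /(inO _ _ x0 y0); rewrite OE.
- right; split; first by lra.
    by have := OP (1, 1); rewrite OE mem_head => /(_ isT)[_ _]; rewrite !scale1r.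
  by move=> x y x0 y0 /(inO _ _ x0 y0); rewrite OE inE => /eqP[-> ->].
Qed.

(** The bound on [x] comes from the third wall of a seed, whose inner product with the
    vector is half of [x] up to sign. *)
Lemma narrow_pair U t a b : planar_tight U -> apart_by U (t / 2) ->
  pm U a -> pm U b -> a != b -> a != - b ->
  simple_pair U a b ->
  dot a b = - (t / 2) -> 0 < t -> t < 2 ->
  (forall x y, 0 < x -> 0 < y -> pm U (x *: a + y *: b) -> x <= t) ->
  [/\ pm U (b + t *: a), pm U (a + t *: b),
    [\/ t = 1, t ^+ 2 = 2 | t ^+ 2 = t + 1] &
    forall x y, 0 < x -> 0 < y -> pm U (x *: a + y *: b) ->
      x <= t * y /\ y <= t * x].
Proof.
move=> tU far pa pb nab nabN simple ab t0 t2 xt.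
have [a1 b1] := (pm_unit tU pa, pm_unit tU pb).
have nba : b != a by rewrite eq_sym.
have nbaN : b != - a by rewrite -eqr_oppLR eq_sym.
have [O [uO OP inO S1 S2]] := plane_coords tU pa pb nab nabN simple.
have D0 : 0 < 1 - (t / 2) ^+ 2 by nra.
have bnd x y : 0 < x -> 0 < y -> pm U (x *: a + y *: b) ->
    [/\ 1 <= x, 1 <= y & x ^+ 2 + y ^+ 2 - t * (x * y) = 1].
  move=> x0 y0 pv.
  have h1 := apart_coord_bound tU far pa pb nab nabN y0 pv.
  have h2 : 1 - (t / 2) ^+ 2 <= x ^+ 2 * (1 - dot b a ^+ 2).
    by apply: (apart_coord_bound tU far pb pa nba nbaN x0 (x := y)); rewrite addrC.
  rewrite (dotC b) ab sqrrN in h1 h2.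
  rewrite -[X in X <= _]mul1r ler_pM2r // in h1.
  rewrite -[X in X <= _]mul1r ler_pM2r // in h2.
  split.
  - by rewrite -(ler_pXn2r (n := 2)) ?nnegrE ?(ltW x0) // expr1n.
  - by rewrite -(ler_pXn2r (n := 2)) ?nnegrE ?(ltW y0) // expr1n.
  - by rewrite -[RHS](pm_unit tU pv) !dotE a1 b1 (dotC b a) ab; field.
have [|e f eO fO nef|||tO1 tO2 tE] := narrow_sector t0 t2 uO.
- move=> e eO; have [e1 e2 pe] := OP e eO; have [h1 h2 h3] := bnd _ _ e1 e2 pe.
  by split=> //; exact: xt pe.
- have [e1 e2 pe] := OP e eO; have [f1 f2 pf] := OP f fO.
  have [e1' e2' _] := bnd _ _ e1 e2 pe; have [f1' f2' _] := bnd _ _ f1 f2 pf.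
  pose ve := e.1 *: a + e.2 *: b; pose vf := f.1 *: a + f.2 *: b.
  have D : dot ve vf = e.1 * f.1 + e.2 * f.2 - t / 2 * (e.1 * f.2 + f.1 * e.2).
    by rewrite /ve /vf !dotE a1 b1 (dotC b a) ab; ring.
  rewrite -D; apply: le_trans (ler_norm _) _; apply: far => //.
    apply: contra nef => /eqP E.
    have Ea := congr1 (dot a) E; have Eb := congr1 (dot b) E.
    rewrite /ve /vf !dotE a1 b1 (dotC b a) ab in Ea Eb.
    have Ea' := congr1 (fun z => t * z) Ea; have Eb' := congr1 (fun z => t * z) Eb.
    rewrite /= in Ea' Eb'; rewrite [e]surjective_pairing [f]surjective_pairing xpair_eqE.
    have /eqP : (e.1 - f.1) * (1 - (t / 2) ^+ 2) = 0 by lra.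
    have /eqP : (e.2 - f.2) * (1 - (t / 2) ^+ 2) = 0 by lra.
    by rewrite !mulf_eq0 (gt_eqF D0) !orbF !subr_eq0 => -> ->.
  apply/eqP => E.
  have Ea := congr1 (dot a) E; have Eb := congr1 (dot b) E.
  rewrite /ve /vf !dotE a1 b1 (dotC b a) ab in Ea Eb.
  have Eb' := congr1 (fun z => t * z) Eb; rewrite /= in Eb'.
  have /eqP : (e.1 + f.1) * (1 - (t / 2) ^+ 2) = 0 by lra.
  by rewrite mulf_eq0 (gt_eqF D0) orbF gt_eqF //; lra.
- by move: S1; rewrite ab sqrrN mulrN opprK.
- exact: S2.
split=> //.
- by have [_ _] := OP _ tO1; rewrite /= scale1r addrC.
- by have [_ _] := OP _ tO2; rewrite /= scale1r.
- move=> x y x0 y0 /(bnd _ _ x0 y0)[x1 y1 E]; split.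
    by rewrite -subr_ge0 -(pmulr_rge0 _ x0); nra.
  by rewrite -subr_ge0 -(pmulr_rge0 _ y0); nra.
Qed.

(** * Chambers with angles pi/2, pi/3 and the smallest angle *)

(** A chamber with angles pi/2, pi/3 and theta, where [t] is twice the cosine of theta
    and theta is the smallest angle of the system.  The bound on [t] says that theta
    exceeds pi/6, which makes the angle pi/3 wide for [wide_pair]. *)
Record seed U t a b c : Prop := Seed {
  seed_chamber : chamber U a b c;
  seed_ab : dot a b = - (t / 2);
  seed_ac : dot a c = - (1 / 2);
  seed_bc : dot b c = 0;
  seed_apart : apart_by U (t / 2);
  seed_gt0 : 0 < t;
  seed_lt3 : t ^+ 2 < 3 }.

Lemma chamber_pair U a b c : chamber U a b c ->
  [/\ a != b, a != - b & simple_pair U a b].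
Proof.
move=> ch; have [_ _ _ /free_dual[p [q [r [pE qE rE]]]] _] := ch.
have qa : dot q a = 0 by rewrite -(qE 1 0 0) scale1r !scale0r !addr0.
have qb : dot q b = 1 by rewrite -(qE 0 1 0) scale1r !scale0r add0r addr0.
split.
- by apply: contraTneq (oner_neq0 R) => E; rewrite -qb -E qa eqxx.
- by apply: contraTneq (oner_neq0 R) => E; rewrite -qb -[b]opprK -E dotNr qa oppr0 eqxx.
- move=> x y; rewrite -[_ + _]addr0 -(scale0r c) => /(chamber_sign ch).
  by case=> [[? ? _]|[? ? _]]; [exact: mulr_ge0|exact: mulr_le0].
Qed.

(** The Gram determinant is, up to a positive factor, the squared length of the part of
    [c] that is orthogonal to [a] and [b]. *)
Lemma gram3_gt0 a b c : dot a a = 1 -> dot b b = 1 -> dot c c = 1 ->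
  0 < 1 - dot a b ^+ 2 -> free [:: a; b; c] ->
  0 < 1 - dot a b ^+ 2 - dot a c ^+ 2 - dot b c ^+ 2
      + 2 * (dot a b * dot a c * dot b c).
Proof.
move=> a1 b1 c1 D0 /free_dual[p [q [r [pE qE rE]]]].
set g := dot a b in D0 *; set h := dot a c; set k := dot b c.
(* The projection of [c] orthogonal to [a] and [b], without its denominator. *)
pose w := (g * k - h) *: a + (g * h - k) *: b + (1 - g ^+ 2) *: c.
have w0 : w != 0.
  by apply: contraTneq D0 => w0; rewrite -(rE (g * k - h) (g * h - k) (1 - g ^+ 2)) -/w w0 dot0r ltxx.
move: w0; rewrite -dot_gt0 /w !dotE a1 b1 c1 (dotC b a) (dotC c a) (dotC c b).
rewrite -/g -/h -/k => E; rewrite -(pmulr_rgt0 _ D0); move: E.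
by congr (0 < _); ring.
Qed.

(** Each plane through two walls of a seed is known: in the plane with the smallest angle
    the lines are equally spaced, the angle pi/3 belongs to three lines and the
    angle pi/2 to two. *)
Lemma seed_planes U t a b c : planar_tight U -> seed U t a b c ->
  [/\ [/\ pm U (b + t *: a), pm U (a + t *: b) & pm U (a + c)],
    forall x y, 0 < x -> 0 < y -> pm U (x *: a + y *: b) -> x <= t * y /\ y <= t * x,
    forall x y, 0 < x -> 0 < y -> pm U (x *: a + y *: c) -> x = 1 /\ y = 1,
    forall x y, 0 < x -> 0 < y -> ~ pm U (x *: b + y *: c) &
    [\/ t = 1, t ^+ 2 = 2 | t ^+ 2 = t + 1]].
Proof.
move=> tU [ch ab ac bc far t0 t3].
have t2 : t < 2 by nra.
have [pa pb pc fabc _] := ch.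
have [nab nabN simple_ab] := chamber_pair ch.
have [nac nacN simple_ac] := chamber_pair (chamber_rot (chamber_swap ch)).
have [nbc nbcN simple_bc] := chamber_pair (chamber_rot ch).
have wac := wide_pair tU far pa pc nac nacN simple_ac.
have wbc := wide_pair tU far pb pc nbc nbcN simple_bc.
have [[]|[_ pac ac_max]] := wac ltac:(rewrite ac; nra); first by rewrite ac; lra.
have [[_ bc_max]|[]] := wbc ltac:(rewrite bc; nra); last by rewrite bc; lra.
have [p [q [r [pE qE rE]]]] := free_dual fabc.
have [pat pbt tE ab_max] : [/\ pm U (b + t *: a), pm U (a + t *: b),
    [\/ t = 1, t ^+ 2 = 2 | t ^+ 2 = t + 1] &
    forall x y, 0 < x -> 0 < y -> pm U (x *: a + y *: b) ->
      x <= t * y /\ y <= t * x].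
  apply: (narrow_pair tU far pa pb nab nabN simple_ab ab t0 t2) => x y x0 y0 pv.
  have rc : dot r c = 1 by rewrite -(rE 0 0 1) scale1r !scale0r !add0r.
  have rv : dot r (x *: a + y *: b) = 0 by rewrite -(rE x y 0) scale0r addr0.
  have nv : x *: a + y *: b != c.
    by apply/eqP => E; move: rv; rewrite E rc; lra.
  have nvN : x *: a + y *: b != - c.
    by apply/eqP => E; move: rv; rewrite E dotNr rc; lra.
  have := far _ _ pv pc nv nvN.
  by rewrite !dotE ac bc mulr0 addr0 mulrN normrN ger0_norm ?mulr_ge0; lra.
by split.
Qed.

(** By [neighbour] and [seed_planes], the chamber behind a wall is the mirror image of
    the seed, and so it is a seed again. *)
Lemma seed_step_a U t a b c : planar_tight U -> seed U t a b c ->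
  seed U t (- a) (b + t *: a) (a + c).
Proof.
move=> tU sd; have [[pat _ pac] ab_max ac_max _ _] := seed_planes tU sd.
case: sd => ch ab ac bc far t0 t3; have [pa pb pc _ _] := ch.
have a1 := pm_unit tU pa.
split=> //; rewrite ?dotE ?a1 ?ab ?ac ?bc ?(dotC b a) ?ab; try by field.
suff : chamber U (- a) (b + t *: a) (c + 1 *: a) by rewrite scale1r [c + a]addrC.
apply: neighbour => //; first by rewrite scale1r addrC.
- move=> x y; rewrite le_eqVlt => /orP[/eqP <-|x0] y0 => [_|].
    by rewrite mulr_ge0 ?ltW.
  by case/ab_max.
- move=> x y; rewrite le_eqVlt => /orP[/eqP <-|x0] y0 => [_|].
    by rewrite mul1r ltW.
  by case/ac_max => // -> ->; rewrite mulr1.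
Qed.

Lemma seed_step_b U t a b c : planar_tight U -> seed U t a b c ->
  seed U t (a + t *: b) (- b) c.
Proof.
move=> tU sd; have [[_ pbt _] ab_max _ bc_max _] := seed_planes tU sd.
case: sd => ch ab ac bc far t0 t3; have [pa pb pc _ _] := ch.
have b1 := pm_unit tU pb.
split=> //; rewrite ?dotE ?b1 ?ab ?ac ?bc ?(dotC b a) ?ab; try by field.
suff /chamber_swap : chamber U (- b) (a + t *: b) (c + 0 *: b).
  by rewrite scale0r addr0.
apply: neighbour => //; first exact: chamber_swap.
- by rewrite scale0r addr0.
- move=> x y; rewrite le_eqVlt => /orP[/eqP <-|x0] y0 => [_|].
    by rewrite mulr_ge0 ?ltW.
  by rewrite addrC => /(ab_max _ _ y0 x0)[].
- move=> x y; rewrite le_eqVlt => /orP[/eqP <-|x0] y0 => [_|/bc_max].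
    by rewrite mul0r.
  by move=> /(_ x0 y0).
Qed.

Lemma seed_step_c U t a b c : planar_tight U -> seed U t a b c ->
  seed U t (a + c) b (- c).
Proof.
move=> tU sd; have [[_ _ pac] _ ac_max bc_max _] := seed_planes tU sd.
case: sd => ch ab ac bc far t0 t3; have [pa pb pc _ _] := ch.
have c1 := pm_unit tU pc.
split=> //; rewrite ?dotE ?c1 ?(dotC c b) ?ab ?ac ?bc; try by field.
suff /chamber_rot : chamber U (- c) (a + 1 *: c) (b + 0 *: c).
  by rewrite scale1r scale0r addr0.
apply: neighbour => //; first by do 2!apply: chamber_rot.
- by rewrite scale1r.
- by rewrite scale0r addr0.
- move=> x y; rewrite le_eqVlt => /orP[/eqP <-|x0] y0 => [_|].
    by rewrite mul1r ltW.
  by rewrite addrC => /(ac_max _ _ y0 x0)[-> ->]; rewrite mulr1.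
- move=> x y; rewrite le_eqVlt => /orP[/eqP <-|x0] y0 => [_|].
    by rewrite mul0r.
  by rewrite addrC => /(bc_max _ _ y0 x0).
Qed.

(** * Existence of such a chamber *)

Definition splits U := exists a b c, free [:: a; b; c] /\
  forall u, u \in U -> (u \in <<[:: a; b]>>%VS) || (u \in <[c]>%VS).

(** A wall orthogonal to the two others survives in the chamber on its other side,
    so the coordinate of a vector of [U] on it has both signs, unless the two
    other coordinates vanish. *)
Lemma orthogonal_wall_splits U a b c : planar_tight U -> chamber U a b c ->
  (forall x y, 0 < x -> 0 < y -> ~ pm U (x *: a + y *: c)) ->
  (forall x y, 0 < x -> 0 < y -> ~ pm U (x *: b + y *: c)) -> splits U.
Proof.
move=> tU ch noa nob; have [pa pb pc fabc chP] := ch.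
suff ch' : chamber U (- c) (a + 0 *: c) (b + 0 *: c).
  exists a, b, c; split=> // u uU; have pu : pm U u by rewrite /pm uU.
  have [x [y [z [uE s]]]] := chP u pu.
  have s' : same_sign (- z) x y.
    apply: (chamber_sign ch'); rewrite scaleNr scalerN opprK !scale0r !addr0.
    by rewrite -addrA addrC -uE.
  have [z0|[x0 y0]] : z = 0 \/ x = 0 /\ y = 0.
    case: s => [[x0 y0 z0]|[x0 y0 z0]]; case: s' => [[z1 x1 y1]|[z1 x1 y1]];
      by [left; lra|right; split; lra].
  - by apply/orP; left; apply/span2P; exists x, y; rewrite uE z0 scale0r addr0.
  - by apply/orP; right; rewrite uE x0 y0 !scale0r !add0r memvZ // memv_line.
apply: neighbour => //; first by do 2!apply: chamber_rot.
- by rewrite scale0r addr0.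
- by rewrite scale0r addr0.
- move=> x y; rewrite le_eqVlt => /orP[/eqP <-|x0] y0 => [_|]; first by rewrite mul0r.
  by rewrite addrC => /(noa _ _ y0 x0).
- move=> x y; rewrite le_eqVlt => /orP[/eqP <-|x0] y0 => [_|]; first by rewrite mul0r.
  by rewrite addrC => /(nob _ _ y0 x0).
Qed.

Lemma seq_argmax (T : eqType) (f : T -> R) (s : seq T) : s != [::] ->
  exists2 e, e \in s & forall e', e' \in s -> f e' <= f e.
Proof.
elim: s => // e [|e1 s] IH _.
  by exists e; rewrite ?mem_head // => e'; rewrite inE => /eqP ->.
have [m mS mM] := IH isT; have [le|lt] := leP (f e) (f m).
  exists m; first by rewrite inE mS orbT.
  by move=> e'; rewrite inE => /orP[/eqP ->|/mM].
exists e; first exact: mem_head.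
move=> e'; rewrite inE => /orP[/eqP ->//|/mM h]; exact: le_trans h (ltW lt).
Qed.

Lemma closest_pair U : planar_tight U -> exists a b, [/\ pm U a, pm U b, a != b,
  a != - b & dot a b <= 0 /\ apart_by U (- dot a b)].
Proof.
move=> tU; pose L := [seq e <- [seq (a, b) | a <- U, b <- U] | e.1 != e.2].
have LP a b : ((a, b) \in L) = [&& a != b, a \in U & b \in U].
  by rewrite mem_filter; congr (_ && _);
     apply/allpairsP/andP => [[[u v] [/= uU vU [-> ->]]]|[aU bU]] //; exists (a, b).
have L0 : L != [::].
  apply/eqP => LE; have h a b : a \in U -> b \in U -> a = b.
    move=> aU bU; apply/eqP; apply: contraT => nab.
    by have := LP a b; rewrite LE in_nil nab aU bU.
  have : (\dim <<U>> <= 1)%N.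
    apply: leq_trans (dim_span _) _; case: U tU h {L LP LE} => [|a [|b U]] // tU h.
    have := tight_uniq tU; rewrite /= inE negb_or.
    by rewrite (h a b) ?inE ?eqxx ?orbT.
  by rewrite (tight_span tU) dimvf.
have [[a b] abL mx] := seq_argmax (fun e : V * V => `|dot e.1 e.2|) L0.
have mx_pm u v : pm U u -> pm U v -> u != v -> u != - v ->
    `|dot u v| <= `|dot a b|.
  move=> /orP[uU|uU] /orP[vU|vU] nuv nuvN.
  - by have := mx (u, v); rewrite LP nuv uU vU => /(_ isT).
  - by have := mx (u, - v); rewrite LP nuvN uU vU /= dotNr normrN => /(_ isT).
  - have := mx (- u, v); rewrite LP eqr_oppLR nuvN uU vU /= dotNl normrN.
    exact.
  - by have := mx (- u, - v); rewrite LP eqr_opp nuv uU vU /= dotNr dotNl opprK => /(_ isT).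
move: abL; rewrite LP => /and3P[nab aU bU].
have nabN : a != - b by apply: contraTneq aU => ->; exact: tight_line.
have pa : pm U a by rewrite /pm aU. have pb : pm U b by rewrite /pm bU.
have [ab|ab] := leP (dot a b) 0.
  by exists a, b; split=> //; split=> //; rewrite -(ler0_norm ab).
exists a, (- b); rewrite pmN opprK; split=> //; rewrite dotNr opprK oppr_le0 ltW //.
by split=> //; rewrite -(gtr0_norm ab).
Qed.

(** The chamber is found next to the normal of the plane of the pair: [r] orders the
    vectors outside this plane and [s] those in it. *)
Lemma chamber_of_closest_pair U a b : planar_tight U ->
  pm U a -> pm U b -> a != b -> a != - b -> dot a b <= 0 ->
  apart_by U (- dot a b) -> exists c, chamber U a b c.
Proof.
move=> tU pa pb nab nabN ab0 far.
have [a1 b1] := (pm_unit tU pa, pm_unit tU pb).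
have D0 := gram2_gt0 a1 b1 nab nabN.
have nba : b != a by rewrite eq_sym.
have nbaN : b != - a by rewrite -eqr_oppLR eq_sym.
have simple : simple_pair U a b.
  move=> x y pv; rewrite leNgt; apply/negP => xy.
  have v1 := pm_unit tU pv; set v := _ + _ in pv v1.
  have far1 w : pm U w -> dot v w ^+ 2 < 1 -> dot v w ^+ 2 <= dot a b ^+ 2.
    move=> pw lt1; have vw : (v != w) && (v != - w).
      apply/andP; split; apply: contraTneq lt1 => ->.
        by rewrite (pm_unit tU pw) expr1n ltxx.
      by rewrite dotNl (pm_unit tU pw) sqrrN expr1n ltxx.
    case/andP: vw => n1 n2; have h := far _ _ pv pw n1 n2.
    rewrite -[_ ^+ 2]real_normK ?num_real // -[X in _ <= X]sqrrN.
    by rewrite ler_pXn2r ?nnegrE // oppr_ge0.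
  have [xn yn] : x != 0 /\ y != 0.
    by split; apply: contraTneq xy => ->; rewrite ?mul0r ?mulr0 ltxx.
  have x2 : 0 < x ^+ 2 by rewrite lt_def sqr_ge0 sqrf_eq0 xn.
  have y2 : 0 < y ^+ 2 by rewrite lt_def sqr_ge0 sqrf_eq0 yn.
  have vE : x ^+ 2 + y ^+ 2 + 2 * dot a b * (x * y) = 1.
    by rewrite -[RHS]v1 /v !dotE a1 b1 (dotC b a); ring.
  have va : dot v a ^+ 2 = 1 - y ^+ 2 * (1 - dot a b ^+ 2).
    by rewrite -[X in X - _]vE /v !dotE a1 (dotC b a); ring.
  have vb : dot v b ^+ 2 = 1 - x ^+ 2 * (1 - dot a b ^+ 2).
    by rewrite -[X in X - _]vE /v !dotE b1; ring.
  have h1 := far1 a pa; have h2 := far1 b pb; rewrite va in h1; rewrite vb in h2.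
  have {}h1 : 1 <= y ^+ 2.
    have := h1 ltac:(have := mulr_gt0 y2 D0; lra).
    by rewrite -[X in _ -> X <= _]mul1r -(ler_pM2r D0); lra.
  have {}h2 : 1 <= x ^+ 2.
    have := h2 ltac:(have := mulr_gt0 x2 D0; lra).
    by rewrite -(ler_pM2r D0); lra.
  have : 0 <= dot a b * (x * y) by rewrite mulr_le0 // ltW.
  lra.
have [c fabc] : exists c, free [:: a; b; c].
  have [u uU uab] : exists2 u, u \in U & u \notin <<[:: a; b]>>%VS.
    apply/hasP; rewrite has_predC -[~~ _]negbK; apply/negP; rewrite negbK => /allP h.
    have : ({: V} <= <<[:: a; b]>>)%VS.
      by rewrite -(tight_span tU); apply/span_subvP.
    move/dimvS; rewrite dimvf => le3.
    by have := leq_trans le3 (dim_span _).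
  exists u; rewrite (perm_free (_ : perm_eq _ [:: u; a; b])); last first.
    by rewrite (perm_catC [:: a; b] [:: u]).
  by rewrite free_cons uab unit_pair_free.
have [p [q [r [pE qE rE]]]] := free_dual fabc.
have coord v := free3_coord v fabc.
pose s := p + q.
have aL : a = 1 *: a + 0 *: b + 0 *: c by rewrite scale1r !scale0r !addr0.
have bL : b = 0 *: a + 1 *: b + 0 *: c by rewrite scale1r !scale0r add0r addr0.
have [pa1 qa1 ra1] : [/\ dot p a = 1, dot q a = 0 & dot r a = 0].
  by split; rewrite [in LHS]aL ?(pE, qE, rE).
have [pb1 qb1 rb1] : [/\ dot p b = 0, dot q b = 1 & dot r b = 0].
  by split; rewrite [in LHS]bL ?(pE, qE, rE).
have r0 v : pm U v -> dot r v = 0 -> exists x y,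
    [/\ v = x *: a + y *: b, 0 <= x * y & x + y != 0].
  move=> pv; have [x [y [z vE]]] := coord v; rewrite vE rE => z0.
  have {}vE : v = x *: a + y *: b by rewrite vE z0 scale0r addr0.
  have xy := simple x y; rewrite -vE in xy; have {}xy := xy pv.
  exists x, y; rewrite z0 scale0r addr0; split=> //.
  apply: contraTneq (pm_neq0 tU pv) => xy0; rewrite vE negbK.
  have /eqP : x ^+ 2 = 0 by apply/eqP; rewrite eq_le sqr_ge0 andbT; nra.
  rewrite sqrf_eq0 => /eqP x0; have y0 : y = 0 by lra.
  by rewrite x0 y0 !scale0r addr0.
(* The lexicographic order by [r] and then [s] decides the signs. *)
pose B := [seq if (0 < dot r u) || ((dot r u == 0) && (0 < dot s u)) then u else - u
  | u <- U].
have BP v : v \in B -> [/\ pm U v, 0 <= dot r v & dot r v = 0 -> 0 < dot s v].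
  case/mapP=> u uU ->; have pu : pm U u by rewrite /pm uU.
  case: ifPn => [/orP[ru|/andP[/eqP ru su]]|]; first by split=> //; lra.
    by split=> //; rewrite ru.
  rewrite negb_or negb_and -!leNgt => /andP[ru su].
  rewrite pmN !dotNr oppr_ge0; split=> // /eqP; rewrite oppr_eq0 => ru0.
  move: su; rewrite ru0 /= => su; rewrite oppr_gt0 lt_neqAle su andbT.
  have [x [y [uE _ xy0]]] := r0 u pu (eqP ru0).
  by rewrite uE /s !dotE pa1 qa1 pb1 qb1 !mulr0 !mulr1 !addr0 add0r.
have BN u : u \in U -> u \in B \/ - u \in B.
  move=> uU; have : (if (0 < dot r u) || ((dot r u == 0) && (0 < dot s u)) then u else - u) \in B.
    by apply/mapP; exists u.
  by case: ifP => _; [left|right].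
have [k kP] : exists k : R, forall v, v \in B -> 0 < dot (k *: r + s) v.
  by apply: perturb => v /BP[].
set h := _ + _ in kP.
have regh : regular U h.
  move=> u /BN[/kP/lt0r_neq0 //|/kP]; rewrite dotNr oppr_gt0; exact: ltr0_neq0.
have posB v : v \in positive U h -> v \in B.
  rewrite positiveP // => /andP[/orP[] vU hv].
    have [//|/kP] := BN _ vU; rewrite dotNr; lra.
  have [/kP|] := BN _ vU; last by rewrite opprK.
  by rewrite dotNr; lra.
have Bpos v : v \in B -> v \in positive U h.
  by move=> vB; rewrite positiveP // kP // andbT; have [] := BP v vB.
have [S [sS fS SB gen]] := simple_generators tU regh.
have side w w' (q1 p1 : V) : pm U w -> dot r w = 0 -> dot q1 w = 0 -> dot s w = 1 ->
    (forall v, pm U v -> dot r v = 0 -> 0 < dot s v ->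
       exists x y, [/\ v = x *: w + y *: w', dot q1 v = y, 0 <= y & 0 < x + y]) ->
    w \in S.
  move=> pw rw qw sw H; have wpos : w \in positive U h.
    rewrite positiveP // pw; rewrite /h dotDl dotZl rw mulr0 add0r sw; exact: ltr01.
  apply: (@extremal_generator _ _ (positive U h) S w r q1) => //.
  - exact: gen.
  - exact: pm_neq0 pw.
  - by move=> v /posB/BP[].
  - move=> v /posB/BP[pv _ sv] rv; have [x [y [_ -> //]]] := H v pv rv (sv rv).
  - move=> v /posB/BP[pv _ sv] rv qv; have [x [y [vE qE' _ xy]]] := H v pv rv (sv rv).
    have y0 : y = 0 by rewrite -qE'.
    have vw : v = x *: w by rewrite vE y0 scale0r addr0.
    rewrite y0 addr0 in xy; have := pm_unit tU pv; rewrite vw => x1.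
    by rewrite (unit_multiple (pm_unit tU pw) x1 xy) scale1r.
have aS : a \in S.
  apply: (side a b q p) => //; first by rewrite /s dotDl pa1 qa1 addr0.
  move=> v pv /(r0 v pv)[x [y [-> xy xy0]]].
  rewrite /s !dotE pa1 qa1 pb1 qb1 !mulr0 !mulr1 !addr0 !add0r => xy1.
  by exists x, y; split=> //; nra.
have bS : b \in S.
  apply: (side b a p q) => //; first by rewrite /s dotDl pb1 qb1 add0r.
  move=> v pv /(r0 v pv)[x [y [-> xy xy0]]].
  rewrite /s !dotE pa1 qa1 pb1 qb1 !mulr0 !mulr1 !addr0 !add0r => xy1.
  by exists y, x; rewrite [y + x]addrC [y *: b + _]addrC; split=> //; nra.
have [e eS /andP[ea eb]] : exists2 e, e \in S & (e != a) && (e != b).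
  apply/hasP; apply: contraT => /hasPn hS.
  have : (size S <= size [:: a; b])%N; last by rewrite sS.
  apply: uniq_leq_size; first exact: free_uniq.
  by move=> v /hS; rewrite !inE negb_and !negbK.
exists e; apply: (chamber_of_generators regh sS fS SB gen) => //.
by rewrite /= !inE !negb_or nab ![_ == e]eq_sym ea eb.
Qed.

(** One angle of the chamber is the smallest angle of the system.  Positivity of the
    Gram determinant makes the other two wide, so each is pi/2 or pi/3.  Two right
    angles split the system, and two angles pi/3 force the smallest angle above
    pi/3. *)
Lemma seed_exists U : planar_tight U -> ~ splits U -> exists t a b c, seed U t a b c.
Proof.
move=> tU nsp; have [a [b [pa pb nab nabN [ab0 far]]]] := closest_pair tU.
have [c ch] := chamber_of_closest_pair tU pa pb nab nabN ab0 far.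
have [_ _ pc fabc _] := ch.
have [[a1 b1] c1] := (pm_unit tU pa, pm_unit tU pb, pm_unit tU pc).
have D0 := gram2_gt0 a1 b1 nab nabN.
have G := gram3_gt0 a1 b1 c1 D0 fabc.
have [nac nacN simple_ac] := chamber_pair (chamber_rot (chamber_swap ch)).
have [nbc nbcN simple_bc] := chamber_pair (chamber_rot ch).
have ac0 := simple_pair_obtuse tU pa pc nac nacN simple_ac.
have bc0 := simple_pair_obtuse tU pb pc nbc nbcN simple_bc.
have prod : dot a b * dot a c * dot b c <= 0 by rewrite mulr_ge0_le0 // mulr_le0.
have wac : dot a c ^+ 2 < 1 - (- dot a b) ^+ 2.
  by rewrite sqrrN; have := sqr_ge0 (dot b c); lra.
have wbc : dot b c ^+ 2 < 1 - (- dot a b) ^+ 2.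
  by rewrite sqrrN; have := sqr_ge0 (dot a c); lra.
have farac : `|dot a c| <= - dot a b := far _ _ pa pc nac nacN.
have farbc : `|dot b c| <= - dot a b := far _ _ pb pc nbc nbcN.
rewrite ler0_norm // in farac; rewrite ler0_norm // in farbc.
have far2 : apart_by U ((- (2 * dot a b)) / 2) by have -> : (- (2 * dot a b)) / 2 = - dot a b by field.
case: (wide_pair tU far pa pc nac nacN simple_ac wac) => [[ac noac]|[ac _ _]];
case: (wide_pair tU far pb pc nbc nbcN simple_bc wbc) => [[bc nobc]|[bc _ _]].
- by case: nsp; exact: (orthogonal_wall_splits tU ch).
- exists (- (2 * dot a b)), b, a, c; split=> //; first exact: chamber_swap.
  + by rewrite dotC; field.
  + by rewrite bc in farbc; lra.
  + by rewrite ac bc in G; lra.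
- exists (- (2 * dot a b)), a, b, c; split=> //.
  + by field.
  + by rewrite ac in farac; lra.
  + by rewrite ac bc in G; lra.
- by rewrite ac bc in G; rewrite ac in farac; nra.
Qed.
End Seeds.

(** * Galleries *)

Section Galleries.
Variables (V : zmodType) (tm : V -> V).
Implicit Types (T : V * V * V) (w : seq nat).

(** The chamber behind wall [i], for a chamber whose Coxeter diagram has edges from the
    first wall to the two others, where [tm] is multiplication by twice the cosine
    of the angle of the first two.  The underlying group is arbitrary, so that the
    same galleries run in exact coordinates and in real space. *)
Definition reflect_chamber (i : nat) T : V * V * V :=
  let: (a, b, c) := T in
  match i with
  | 0 => (- a, b + tm a, a + c)
  | 1 => (a + tm b, - b, c)
  | _ => (a + c, b, - c)
  end.

Definition wall (i : nat) T : V :=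
  let: (a, b, c) := T in match i with 0 => a | 1 => b | _ => c end.

Fixpoint walls w T : seq V :=
  if w is i :: w' then wall i T :: walls w' (reflect_chamber i T) else [::].

Definition gallery_end w T := foldl (fun T i => reflect_chamber i T) T w.

(** The longest element of a rank 3 reflection group maps every wall of a chamber
    to the negative of a wall, in type A up to the automorphism of the
    diagram, which exchanges the last two walls. *)
Definition opposite T T' : bool :=
  let: (a, b, c) := T in (T' == (- a, - b, - c)) || (T' == (- a, - c, - b)).

End Galleries.

Definition map_chamber (V V' : Type) (f : V -> V') (T : V * V * V) : V' * V' * V' :=
  let: (a, b, c) := T in (f a, f b, f c).

Lemma gallery_morph (V V' : zmodType) (tm : V -> V) (tm' : V' -> V') (f : V -> V') :
  {morph f : x y / x + y} -> {morph f : x / - x} -> (forall v, f (tm v) = tm' (f v)) ->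
  forall w T, walls tm' w (map_chamber f T) = map f (walls tm w T) /\
    gallery_end tm' w (map_chamber f T) = map_chamber f (gallery_end tm w T).
Proof.
move=> fD fN ft; elim=> [|i w IH] T //.
have E : reflect_chamber tm' i (map_chamber f T) = map_chamber f (reflect_chamber tm i T).
  by case: T => [[a b] c]; case: i => [|[|i]] /=; rewrite ?fD ?fN ?ft.
have Ew : wall i (map_chamber f T) = f (wall i T).
  by case: T {E} => [[a b] c]; case: i => [|[|i]].
have [h1 h2] := IH (reflect_chamber tm i T).
by split; [rewrite /= E Ew h1|rewrite -h2 -E].
Qed.

Section SeedGalleries.
Variable R : realType.
Notation V := 'rV[R]_3.
Implicit Types (U : seq V) (a b c u v : V) (x y z t : R) (w : seq nat).

Let seed3 U t (T : V * V * V) := let: (a, b, c) := T in seed U t a b c.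
Let nonneg (T : V * V * V) v := let: (a, b, c) := T in
  exists x y z, [/\ v = x *: a + y *: b + z *: c, 0 <= x, 0 <= y & 0 <= z].

Lemma seed_reflect U t T i : planar_tight U -> seed3 U t T ->
  seed3 U t (reflect_chamber ( *:%R t) i T).
Proof.
case: T => [[a b] c] tU; case: i => [|[|i]] /=.
- exact: seed_step_a.
- exact: seed_step_b.
- exact: seed_step_c.
Qed.

Lemma pm_walls U t T w : planar_tight U -> seed3 U t T ->
  {in walls ( *:%R t) w T, forall v, pm U v}.
Proof.
move=> tU; elim: w T => [|i w IH] T //= sT v; rewrite inE => /orP[/eqP ->|].
  case: T sT => [[a b] c] /= sT; have [[pa pb pc _ _] _ _ _ _ _ _] := sT.
  by case: i => [|[|i]].
by apply: IH; exact: seed_reflect.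
Qed.

(** A vector changes the sign of its coordinates in the chambers of a gallery only
    when the gallery crosses its own wall. *)
Lemma nonneg_reflect U t T i v : planar_tight U -> seed3 U t T -> pm U v ->
  nonneg T v -> v = wall i T \/ nonneg (reflect_chamber ( *:%R t) i T) v.
Proof.
move=> tU sT pv; have sT' := seed_reflect i tU sT.
case: T sT sT' => [[a b] c] /= sT sT' [x [y [z [vE x0 y0 z0]]]].
have [[pa pb pc _ _] _ _ _ _ _ _] := sT.
have mult e k : pm U e -> v = k *: e -> 0 <= k -> v = e.
  move=> pe ve k0; have := pm_unit tU pv; rewrite {1 2}ve => v1.
  have k1 : 0 < k.
    by rewrite lt_def k0 andbT; apply: contraTneq (pm_neq0 tU pv) => kz;
       rewrite ve kz scale0r eqxx.
  by rewrite ve (unit_multiple (pm_unit tU pe) v1 k1) scale1r.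
case: i sT' => [|[|i]] sT'; have ch := seed_chamber sT'.
- have E : v = (t * y + z - x) *: (- a) + y *: (b + t *: a) + z *: (a + c).
    by rewrite vE; apply/rowP => j; rewrite !mxE; ring.
  have := pv; rewrite {1}E => /(chamber_sign ch)[[s1 s2 s3]|[s1 s2 s3]].
    by right; exists (t * y + z - x), y, z.
  left; apply: (mult a x) => //; have [yE zE] : y = 0 /\ z = 0 by split; lra.
  by rewrite vE yE zE !scale0r !addr0.
- have E : v = x *: (a + t *: b) + (t * x - y) *: (- b) + z *: c.
    by rewrite vE; apply/rowP => j; rewrite !mxE; ring.
  have := pv; rewrite {1}E => /(chamber_sign ch)[[s1 s2 s3]|[s1 s2 s3]].
    by right; exists x, (t * x - y), z.
  left; apply: (mult b y) => //; have [xE zE] : x = 0 /\ z = 0 by split; lra.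
  by rewrite vE xE zE !scale0r add0r addr0.
- have E : v = x *: (a + c) + y *: b + (x - z) *: (- c).
    by rewrite vE; apply/rowP => j; rewrite !mxE; ring.
  have := pv; rewrite {1}E => /(chamber_sign ch)[[s1 s2 s3]|[s1 s2 s3]].
    by right; exists x, y, (x - z).
  left; apply: (mult c z) => //; have [xE yE] : x = 0 /\ y = 0 by split; lra.
  by rewrite vE xE yE !scale0r !add0r.
Qed.

Lemma nonneg_gallery U t T w v : planar_tight U -> seed3 U t T -> pm U v ->
  nonneg T v -> v \in walls ( *:%R t) w T \/ nonneg (gallery_end ( *:%R t) w T) v.
Proof.
move=> tU; elim: w T => [|i w IH] T sT pv nT; first by right.
have [->|nT'] := nonneg_reflect i tU sT pv nT; first by left; rewrite mem_head.
have [h|h] := IH _ (seed_reflect i tU sT) pv nT'; last by right.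
by left; rewrite /= inE h orbT.
Qed.

(** A gallery from a chamber to its opposite crosses every plane of the arrangement. *)
Lemma walls_exhaust U t T w : planar_tight U -> seed3 U t T ->
  opposite T (gallery_end ( *:%R t) w T) ->
  forall v, pm U v -> pm (walls ( *:%R t) w T) v.
Proof.
move=> tU sT opp v pv.
have key u : pm U u -> nonneg T u -> u \in walls ( *:%R t) w T.
  move=> pu nT; have [//|] := nonneg_gallery w tU sT pu nT.
  move: nT opp; case: T sT => [[a b] c] /= sT [x [y [z [uE x0 y0 z0]]]] opp.
  have ch := seed_chamber sT; have pu' := pu; rewrite uE in pu'.
  have [_ _ _ /free_dual[p [q [r [pE qE rE]]]] _] := ch.
  have nz : x <= 0 -> y <= 0 -> z <= 0 -> False.
    move=> x1 y1 z1; have [xE yE zE] : [/\ x = 0, y = 0 & z = 0] by split; lra.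
    by have := pm_neq0 tU pu; rewrite uE xE yE zE !scale0r !addr0 eqxx.
  have co x' y' z' : u = x' *: a + y' *: b + z' *: c -> [/\ x = x', y = y' & z = z'].
    move=> E; split.
    - by rewrite -(pE x y z) -uE E pE.
    - by rewrite -(qE x y z) -uE E qE.
    - by rewrite -(rE x y z) -uE E rE.
  case/orP: opp => /eqP -> [x' [y' [z' [uE' x0' y0' z0']]]].
    have [|] := co (- x') (- y') (- z'); first by rewrite uE' !scalerN !scaleNr.
    by move=> xE yE zE; case: nz; rewrite ?xE ?yE ?zE oppr_le0.
  have [|] := co (- x') (- z') (- y').
    by rewrite uE' !scalerN !scaleNr addrAC.
  by move=> xE yE zE; case: nz; rewrite ?xE ?yE ?zE oppr_le0.
have nn u : pm U u -> nonneg T u \/ nonneg T (- u).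
  case: T sT {opp key} => [[a b] c] /= sT pu.
  have [_ _ _ _ chP] := seed_chamber sT.
  have [x [y [z [uE s]]]] := chP u pu; case: s => [[x0 y0 z0]|[x0 y0 z0]].
    by left; exists x, y, z.
  right; exists (- x), (- y), (- z); rewrite !oppr_ge0; split=> //.
  by rewrite uE !opprD !scaleNr.
have pv' : pm U (- v) by rewrite pmN.
by rewrite /pm; have [/(key v pv) ->|/(key _ pv') ->] := nn v pv; rewrite ?orbT.
Qed.
End SeedGalleries.

(** * From Euclidean systems to systems of unit vectors *)

Section Normalise.
Variable R : realType.
Notation V := 'rV[R]_3.
Implicit Types (A : {fset V}) (a b c u v : V) (x y z l : R).

Lemma vsystem_trace A : vsystem_frame A -> \sum_(a <- A) dot a a = 3.
Proof.
move=> fr; pose e (i : 'I_3) : V := delta_mx 0 i.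
have eE i v : dot (e i) v = v 0 i.
  rewrite /dot (bigD1 i) //= big1 ?addr0 => [|j ji]; rewrite !mxE !eqxx /=.
    by rewrite mul1r.
  by rewrite (negPf ji) mul0r.
transitivity (\sum_(i < 3) \sum_(a <- A) dot (e i) a ^+ 2).
  by rewrite exchange_big; apply: eq_bigr => a _; apply: eq_bigr => i _; rewrite eE.
rewrite (eq_bigr (fun=> 1)) ?sumr_const ?card_ord // => i _.
by rewrite fr enorm_sq eE mxE !eqxx.
Qed.

Lemma frame_span (s : seq V) :
  (forall x : V, \sum_(a <- s) dot x a ^+ 2 = dot x x) -> <<s>>%VS = fullv.
Proof.
move=> fr; have pol (x y : V) : \sum_(a <- s) dot x a * dot y a = dot x y.
  have := fr (x + y).
  rewrite (eq_bigr (fun a => dot x a ^+ 2 + dot y a ^+ 2 + 2 * (dot x a * dot y a))).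
    by rewrite !big_split /= -mulr_sumr !fr !dotE (dotC y x); lra.
  by move=> a _; rewrite dotDl; ring.
apply/vspaceP => x; rewrite memvf.
have -> : x = \sum_(a <- s) dot x a *: a.
  apply/eqP; rewrite -subr_eq0 -dot_eq0; set w := x - _.
  rewrite {1}/w dotDl dotNl dot_suml subr_eq0 -[X in X == _]pol.
  by apply/eqP; apply: eq_bigr => a _; rewrite dotZl (dotC w).
by rewrite big_seq memv_suml // => a aS; rewrite memvZ // memv_span.
Qed.

(** The frame condition enters through two of its consequences: the vectors span, and
    the sum of their squared lengths is the dimension. *)
Lemma vsystem_normalise A : euclidean_vsystem A -> equal_lengths A ->
  exists l, [/\ 0 < l, forall a, a \in A -> dot a a = l ^+ 2,
    l ^+ 2 * (size A)%:R = 3 & planar_tight [seq l^-1 *: a | a <- A]].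
Proof.
move=> [A0 Aline fr many two] eqA; have tr := vsystem_trace fr.
have [a0 a0A] : exists a0, a0 \in A.
  case E : (enum_fset A) => [|a0 s]; first by move: tr; rewrite E big_nil; lra.
  by exists a0; rewrite -[_ \in A]/(a0 \in enum_fset A) E mem_head.
have a0n a : a \in A -> a != 0 by move=> aA; apply: contraNneq A0 => <-.
pose l := enorm a0; exists l.
have lE a : a \in A -> dot a a = l ^+ 2.
  by move=> aA; rewrite -enorm_sq (eqA _ _ aA a0A).
have l0 : 0 < l.
  by rewrite lt_def sqrtr_ge0 andbT -sqrf_eq0 -(lE a0 a0A) dot_eq0 a0n.
have ln := lt0r_neq0 l0.
split=> //.
  rewrite -tr big_seq (eq_bigr (fun=> l ^+ 2)) => [|a aA]; last exact: lE.
  rewrite -big_seq big_const_seq count_predT iter_addr_0.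
  by rewrite mulr_natr.
set U := map _ _.
have memP (P : {vspace V}) a : (l^-1 *: a \in P) = (a \in P).
  apply/idP/idP => [h|]; last exact: memvZ.
  by rewrite -(scalerKV ln a) memvZ.
have sumU (P : {vspace V}) v : \sum_(c <- U | c \in P) dot v c ^+ 2 =
    (l ^- 2) * \sum_(a <- A | a \in P) dot v a ^+ 2.
  rewrite big_map mulr_sumr; apply: eq_big => a; first exact: memP.
  by rewrite dotZr exprMn exprVn.
have nA a b : a \in A -> b \in A -> a != - b.
  move=> aA bA; apply/eqP => ab; have [E|nab] := eqVneq a b.
    move: ab; rewrite E => /eqP; rewrite -addr_eq0 -mulr2n -scaler_nat scaler_eq0.
    by rewrite pnatr_eq0 /= (negPf (a0n b bA)).
  rewrite eq_sym in nab; apply: (Aline b a bA aA nab (-1)).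
  by rewrite scaleN1r.
have pmA u : pm U u -> exists2 a, a \in A & u = l^-1 *: a \/ u = - (l^-1 *: a).
  case/orP => /mapP[a aA E]; exists a => //; [by left|right].
  by rewrite -E opprK.
have U1 u : u \in U -> dot u u = 1.
  case/mapP=> a aA ->; rewrite dotZl dotZr lE // mulrA -expr2 exprVn mulVf //.
  by rewrite expf_eq0.
split.
- by rewrite map_inj_uniq ?fset_uniq //; apply: scalerI; rewrite invr_eq0.
- exact: U1.
- move=> _ /mapP[a aA ->]; apply/negP => /mapP[b bA] E.
  have := nA a b aA bA; rewrite -(inj_eq (scalerI (_ : l^-1 != 0))) ?invr_eq0 //.
  by rewrite scalerN -E opprK eqxx.
- apply/vspaceP => x; rewrite memvf.
  have : x \in <<A>>%VS by rewrite frame_span ?memvf // => y; rewrite fr enorm_sq.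
  apply: (subvP (_ : (<<A>> <= <<U>>)%VS)); apply/span_subvP => a aA.
  by rewrite -memP memv_span // map_f.
- move=> u v pu pv nuv nuvN; set P := <<[:: u; v]>>%VS.
  have [a aA ua] := pmA u pu; have [b bA vb] := pmA v pv.
  have uP : u \in P by rewrite memv_span // mem_head.
  have vP : v \in P by rewrite memv_span // !inE eqxx orbT.
  have aP : a \in P by case: ua uP => ->; rewrite ?memvN memP.
  have bP : b \in P by case: vb vP => ->; rewrite ?memvN memP.
  have nab : a != b.
    apply: contraNneq nuv => E; case: ua nuvN => ->; case: vb => ->; rewrite E ?opprK ?eqxx //.
  have dimP : \dim P = 2.
    have u1 w : pm U w -> dot w w = 1 by case/orP => /U1 //; rewrite !dotE opprK.
    by have := unit_pair_free (u1 u pu) (u1 v pv) nuv nuvN; rewrite /free => /eqP.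
  have [ge3|lt3] := leqP 3 #|` [fset c in A | c \in P]%fset|.
    have [nu nuE] := many P dimP ge3; exists (l ^- 2 * nu) => x y.
    rewrite sumU nuE ?enorm_sq ?mulrA //.
    by rewrite memvD ?memvZ.
  have eqf : [fset c in A | c \in P]%fset = [fset a; b]%fset.
    apply/esym/eqP; rewrite eqEfcard; apply/andP; split.
      by apply/fsubsetP => c; rewrite !inE => /orP[]/eqP ->; rewrite ?aA ?bA.
    by rewrite cardfs2 nab.
  have ab := two P dimP a b nab eqf.
  exists 1 => x y; rewrite mul1r sumU.
  have -> : \sum_(c <- A | c \in P) dot (x *: u + y *: v) c ^+ 2 =
      \sum_(c <- [fset a; b]%fset) dot (x *: u + y *: v) c ^+ 2.
    by rewrite big_fset_condE eqf.
  rewrite big_fsetU1 ?inE //= big_seq_fset1.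
  have [aa bb] := (lE a aA, lE b bA).
  have l2 : l ^- 2 * l ^+ 2 = 1 by rewrite mulVf // expf_eq0.
  by case: ua => ->; case: vb => ->; rewrite !dotE aa bb (dotC b a) ab; field.
Qed.
End Normalise.

(** * Exact models of the three root systems *)

Notation quad := (int * int)%type.
Notation quad3 := (quad * quad * quad)%type.

(** A pair [(x, y)] stands for the real number [x + y om], where [om] is a root of
    [om ^+ 2 = p om + q], so that identities between roots become computations with
    integers.  [rd_base] lists three simple roots of squared length [rd_norm] and
    [rd_t] is twice the cosine of the angle of the first two walls.  [rd_word] is a
    reduced word of the longest element: the Coxeter element to the power half the
    Coxeter number. *)
Record root_datum := RootDatum {
  rd_p : int; rd_q : int; rd_t : quad; rd_norm : int;
  rd_base : quad3 * quad3 * quad3; rd_word : seq nat }.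

Section QuadraticIntegers.
Variable D : root_datum.
Let p := rd_p D.
Let q := rd_q D.
Implicit Types (x y : quad) (u v : quad3).

Definition qmul x y : quad :=
  (x.1 * y.1 + q * (x.2 * y.2), x.1 * y.2 + x.2 * y.1 + p * (x.2 * y.2)).
Definition qnorm x : int := x.1 ^+ 2 + p * (x.1 * x.2) - q * x.2 ^+ 2.
Definition qint (n : int) : quad := (n, 0).
Definition qdot u v : quad :=
  qmul u.1.1 v.1.1 + qmul u.1.2 v.1.2 + qmul u.2 v.2.
Definition qscale x u : quad3 := (qmul x u.1.1, qmul x u.1.2, qmul x u.2).

(** Nonzero norms certify that the real vectors with these coordinates differ. *)
Definition qapart u v : bool :=
  [|| qnorm (u.1.1 - v.1.1) != 0, qnorm (u.1.2 - v.1.2) != 0 | qnorm (u.2 - v.2) != 0].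

Definition qparallel u v : bool :=
  [&& qmul u.1.1 v.1.2 == qmul u.1.2 v.1.1, qmul u.1.1 v.2 == qmul u.2 v.1.1
    & qmul u.1.2 v.2 == qmul u.2 v.1.2].

Definition rd_roots := walls (qscale (rd_t D)) (rd_word D) (rd_base D).

(** The reflection of [v] in [r], multiplied by the norm of [r]. *)
Definition qrefl r v : quad3 := qscale (qdot r r) v - qscale (qint 2) (qscale (qdot r v) r).

(** Through these moments the frame condition becomes a finite computation. *)
Definition qmoment (f g : quad3 -> quad) : quad :=
  foldr (fun r s => qmul (f r) (g r) + s) 0 rd_roots.

Definition rd_valid : bool :=
  let N := rd_norm D in let t := rd_t D in let rs := rd_roots in
  let: (a, b, c) := rd_base D in
  [&& 0 < N, qnorm t != 0,
    [&& qdot a b + qdot a b == - qmul (qint N) t,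
        qdot a c + qdot a c == - qint N & qdot b c == 0],
    [&& a \in rs, b \in rs & c \in rs],
    opposite (rd_base D) (gallery_end (qscale t) (rd_word D) (rd_base D)),
    uniq rs,
    all (fun r => qdot r r == qint N) rs,
    all (fun r => all (fun s => (r == s) || qapart r s) rs) rs,
    all (fun r => all (fun s => qapart r (- s)) rs) rs,
    all (fun r => all (fun s => has (fun s' =>
      (qrefl r s == qscale (qint N) s') || (qrefl r s == - qscale (qint N) s')) rs) rs) rs
  & [&& all (fun f => qmul (qint 3) (qmoment f f) == qint (N * (size rs)%:Z))
          [:: (fun u => u.1.1); (fun u => u.1.2); (fun u => u.2)],
        qmoment (fun u => u.1.1) (fun u => u.1.2) == 0,
        qmoment (fun u => u.1.1) (fun u => u.2) == 0
      & qmoment (fun u => u.1.2) (fun u => u.2) == 0]].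

End QuadraticIntegers.

Definition coxeter_word (k : nat) : seq nat := flatten (nseq k [:: 0; 1; 2]%N).

Definition datum_A3 := RootDatum 0 0 (1, 0) 2
  (((1, 0), (- 1, 0), 0), (0, (1, 0), (- 1, 0)), (0, (1, 0), (1, 0)))
  (coxeter_word 2).

Definition datum_B3 := RootDatum 0 2 (0, 1) 2
  (((1, 0), (- 1, 0), 0), (0, (0, 1), 0), ((- 1, 0), 0, (1, 0)))
  (coxeter_word 3).

Definition datum_H3 := RootDatum 1 1 (0, 1) 4
  (((0, - 1), (1, 0), (- 1, 1)), ((2, 0), 0, 0), (0, (- 2, 0), 0))
  (coxeter_word 5).

Lemma datum_A3_valid : rd_valid datum_A3.
Proof. by vm_compute. Qed.

Lemma datum_B3_valid : rd_valid datum_B3.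
Proof. by vm_compute. Qed.

Lemma datum_H3_valid : rd_valid datum_H3.
Proof. by vm_compute. Qed.

Section Realisation.
Variables (R : realType) (D : root_datum) (om : R).
Hypothesis omE : om ^+ 2 = (rd_p D)%:~R * om + (rd_q D)%:~R.
Notation V := 'rV[R]_3.
Implicit Types (x y : quad) (u v : quad3).

Definition qval x : R := x.1%:~R + x.2%:~R * om.
Definition qvec u : V := vec3 (qval u.1.1) (qval u.1.2) (qval u.2).

Lemma qvalD x y : qval (x + y) = qval x + qval y.
Proof. by rewrite /qval !intrD; ring. Qed.

Lemma qvalN x : qval (- x) = - qval x.
Proof. by rewrite /qval !intrN; ring. Qed.

Lemma qval0 : qval 0 = 0.
Proof. by rewrite /qval mul0r addr0. Qed.

Lemma qvalM x y : qval (qmul D x y) = qval x * qval y.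
Proof. by rewrite /qval /qmul !intrD !intrM; ring: omE. Qed.

Lemma qval_int n : qval (qint n) = n%:~R.
Proof. by rewrite /qval mul0r addr0. Qed.

Lemma qval_neq0 x : qnorm D x != 0 -> qval x != 0.
Proof.
rewrite -(intr_eq0 R); apply: contraNneq => x0.
have -> : (qnorm D x)%:~R = qval x * (x.1%:~R + x.2%:~R * ((rd_p D)%:~R - om)).
  by rewrite /qval /qnorm !(intrD, intrN, intrM, expr2); ring: omE.
by rewrite x0 mul0r.
Qed.

Lemma vec3E (x y z : R) (i : 'I_3) : vec3 x y z 0 i = [:: x; y; z]`_i.
Proof. by rewrite mxE. Qed.

Lemma dot3E (a b : V) : dot a b =
  a 0 0 * b 0 0 + a 0 1 * b 0 1 + a 0 2%:R * b 0 2%:R.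
Proof.
rewrite /dot !big_ord_recl big_ord0 addr0 addrA.
by congr (_ + _ * _ + _ * _); congr (_ 0 _); apply: val_inj.
Qed.

Lemma row3P (a b : V) : a 0 0 = b 0 0 -> a 0 1 = b 0 1 -> a 0 2%:R = b 0 2%:R -> a = b.
Proof.
move=> e0 e1 e2; apply/rowP => -[[|[|[|//]]] h].
- by have -> : Ordinal h = 0 by apply: val_inj.
- by have -> : Ordinal h = 1 by apply: val_inj.
- by have -> : Ordinal h = 2%:R by apply: val_inj.
Qed.

Lemma qvecD u v : qvec (u + v) = qvec u + qvec v.
Proof. by apply: row3P; rewrite !mxE /= qvalD. Qed.

Lemma qvecN u : qvec (- u) = - qvec u.
Proof. by apply: row3P; rewrite !mxE /= qvalN. Qed.

Lemma qvecZ x u : qvec (qscale D x u) = qval x *: qvec u.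
Proof. by apply: row3P; rewrite !mxE /= qvalM. Qed.

Lemma dot_qvec u v : dot (qvec u) (qvec v) = qval (qdot D u v).
Proof. by rewrite dot3E !mxE /= /qdot !qvalD !qvalM. Qed.

Lemma qapart_neq u v : qapart D u v -> qvec u != qvec v.
Proof.
move=> ap; apply/eqP => E.
have coord (i : 'I_3) : qvec u 0 i - qvec v 0 i = 0 by rewrite E subrr.
have := coord 0; have := coord 1; have := coord 2%:R.
rewrite !mxE /= -!qvalN -!qvalD => c2 c1 c0.
by case/or3P: ap => /qval_neq0; rewrite ?c0 ?c1 ?c2 eqxx.
Qed.

Lemma qvec_refl u v : qvec (qrefl D u v) =
  dot (qvec u) (qvec u) *: qvec v - 2 *: (dot (qvec u) (qvec v) *: qvec u).
Proof. by rewrite /qrefl qvecD qvecN !qvecZ !dot_qvec qval_int. Qed.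

End Realisation.

(** * Real models *)

Section Model.
Variables (R : realType) (D : root_datum) (om : R).
Hypothesis omE : om ^+ 2 = (rd_p D)%:~R * om + (rd_q D)%:~R.
Hypothesis validD : rd_valid D.
Notation V := 'rV[R]_3.
Implicit Types (a b c r s u v x y : V).

Let qvec := @qvec R om.
Let t := qval om (rd_t D).
Let Nr : R := (rd_norm D)%:~R.
Let n := size (rd_roots D).
Definition real_roots : seq V := map qvec (rd_roots D).
Let base := map_chamber qvec (rd_base D).

Lemma real_roots_facts :
  [/\ 0 < Nr,
    forall r, r \in real_roots -> dot r r = Nr,
    uniq real_roots,
    forall r s, r \in real_roots -> s \in real_roots -> r <> - s &
    forall r s, r \in real_roots -> s \in real_roots ->
      refl r s \in real_roots \/ - refl r s \in real_roots].
Proof.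
move: validD; rewrite /rd_valid; case: (rd_base D) => [[a b] c].
case/and3P=> N0 t0 /and5P[_ _ _ ur /and5P[nr ap1 ap2 cl _]].
have Nr0 : 0 < Nr by rewrite /Nr ltr0z.
have nrR (r : quad3) : r \in rd_roots D -> dot (qvec r) (qvec r) = Nr.
  by move=> rR; rewrite (dot_qvec omE) (eqP (allP nr r rR)) qval_int.
split=> //.
- by move=> _ /mapP[r rR ->]; exact: nrR.
- rewrite map_inj_in_uniq // => r s rR sR E.
  have /orP[/eqP //|/(qapart_neq omE)] := allP (allP ap1 r rR) s sR.
  by rewrite -/qvec E eqxx.
- move=> _ _ /mapP[r rR ->] /mapP[s sR ->] E.
  have /(qapart_neq omE) := allP (allP ap2 r rR) s sR.
  by rewrite qvecN -/qvec E eqxx.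
- move=> _ _ /mapP[r rR ->] /mapP[s sR ->].
  have /hasP[s' s'R h] := allP (allP cl r rR) s sR.
  have reflE : Nr *: refl (qvec r) (qvec s) = qvec (qrefl D r s).
    rewrite /qvec (qvec_refl omE) -/qvec nrR // /refl scalerBr nrR // !scalerA.
    by congr (_ - _ *: _); field; rewrite gt_eqF.
  have sE (z : quad3) : qvec (qscale D (qint (rd_norm D)) z) = Nr *: qvec z.
    by rewrite /qvec (qvecZ omE) qval_int.
  have inj := scalerI (lt0r_neq0 Nr0).
  case/orP: h => /eqP h; [left|right].
    by rewrite (_ : refl _ _ = qvec s') ?map_f //; apply: inj; rewrite reflE h sE.
  rewrite (_ : - refl _ _ = qvec s') ?map_f //; apply: inj.
  by rewrite scalerN reflE h /qvec qvecN -/qvec sE opprK.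
Qed.

Lemma real_roots_frame x :
  \sum_(r <- real_roots) dot x r ^+ 2 = Nr * n%:R / 3 * dot x x.
Proof.
move: validD; rewrite /rd_valid; case: (rd_base D) => [[a b] c].
case/and3P=> N0 t0 /and5P[_ _ _ _ /and5P[_ _ _ _ /and4P[/and4P[m00 m11 m22 _] m01 m02 m12]]].
have momE (f g : quad3 -> quad) : \sum_(r <- rd_roots D) qval om (f r) * qval om (g r) =
    qval om (qmoment D f g).
  rewrite /qmoment; elim: (rd_roots D) => [|r rs IH]; first by rewrite big_nil qval0.
  by rewrite big_cons /= qvalD (qvalM omE) IH.
have diag f : qmul D (qint 3) (qmoment D f f) == qint (rd_norm D * n%:Z) ->
    \sum_(r <- rd_roots D) qval om (f r) * qval om (f r) = Nr * n%:R / 3.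
  rewrite momE => /eqP /(congr1 (qval om)); rewrite (qvalM omE) !qval_int intrM.
  by rewrite -pmulrn => h; rewrite -h; field.
have off f g : qmoment D f g == 0 ->
    \sum_(r <- rd_roots D) qval om (f r) * qval om (g r) = 0.
  by rewrite momE => /eqP ->; exact: qval0.
rewrite big_map.
rewrite (eq_bigr (fun r : quad3 => x 0 0 ^+ 2 * (qval om r.1.1 * qval om r.1.1)
   + x 0 1 ^+ 2 * (qval om r.1.2 * qval om r.1.2)
   + x 0 2%:R ^+ 2 * (qval om r.2 * qval om r.2)
   + 2 * x 0 0 * x 0 1 * (qval om r.1.1 * qval om r.1.2)
   + 2 * x 0 0 * x 0 2%:R * (qval om r.1.1 * qval om r.2)
   + 2 * x 0 1 * x 0 2%:R * (qval om r.1.2 * qval om r.2))); last first.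
  by move=> r _; rewrite dot3E !mxE /=; ring.
rewrite !big_split /= -!mulr_sumr (diag _ m00) (diag _ m11) (diag _ m22).
by rewrite (off _ _ m01) (off _ _ m02) (off _ _ m12) dot3E; ring.
Qed.

Lemma real_base_facts : let: (a, b, c) := base in
  [/\ [/\ a \in real_roots, b \in real_roots & c \in real_roots],
    [/\ t != 0, dot a b = - (t / 2) * Nr, dot a c = - (1 / 2) * Nr & dot b c = 0],
    real_roots = walls ( *:%R t) (rd_word D) base &
    opposite base (gallery_end ( *:%R t) (rd_word D) base)].
Proof.
have [Hw He] := gallery_morph (@qvecD R om) (@qvecN R om) (qvecZ omE (rd_t D))
  (rd_word D) (rd_base D).
rewrite -/qvec -/t -/base in Hw He.
move: validD Hw He; rewrite /rd_valid /base /real_roots /rd_roots.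
case E : (rd_base D) => [[a b] c].
case/and3P=> N0 t0 /and5P[/and3P[ab ac bc] /and3P[aR bR cR] opp _ _] Hw He.
split.
- by rewrite !map_f.
- rewrite !(dot_qvec omE) (eqP bc) qval0.
  move/eqP: ab => /(congr1 (qval om)); rewrite qvalD qvalN (qvalM omE) qval_int -/t -/Nr => ab.
  move/eqP: ac => /(congr1 (qval om)); rewrite qvalD qvalN qval_int -/Nr => ac.
  by split=> //; first exact: (qval_neq0 omE); lra.
- by rewrite Hw.
- rewrite He; case: (gallery_end _ _ _) opp => [[a' b'] c'] /=.
  by case/orP => /eqP[-> -> ->]; rewrite /qvec !qvecN eqxx ?orbT.
Qed.

End Model.

Section ModelSystem.
Variables (R : realType) (D : root_datum) (om : R).
Hypothesis omE : om ^+ 2 = (rd_p D)%:~R * om + (rd_q D)%:~R.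
Hypothesis validD : rd_valid D.
Notation V := 'rV[R]_3.
Implicit Types (a b c r s u v x y : V).

Let t := qval om (rd_t D).
Let Nr : R := (rd_norm D)%:~R.
Let n := size (rd_roots D).
Let roots := real_roots D om.

Definition model_scale : R := Num.sqrt (3 / (Nr * n%:R)).
Definition model : {fset V} := [fset x in [seq model_scale *: r | r <- roots]]%fset.

Let k := model_scale.

Lemma model_scaleE : 0 < k /\ k ^+ 2 * (Nr * n%:R) = 3.
Proof.
have [Nr0 _ _ _ _] := real_roots_facts omE validD.
have n0 : 0 < n%:R :> R.
  rewrite ltr0n; have := real_base_facts omE validD.
  case: (map_chamber _ _) => [[a b] c] [[+ _ _] _ _ _].
  by rewrite /real_roots => /mapP[r]; rewrite /n; case: (rd_roots D).
have d0 : 0 < Nr * n%:R by exact: mulr_gt0.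
rewrite /k /model_scale sqrtr_gt0 sqr_sqrtr; first by split; [exact: divr_gt0|field; rewrite !gt_eqF].
by apply: ltW; exact: divr_gt0.
Qed.

Lemma modelP a : reflect (exists2 r, r \in roots & a = k *: r) (a \in model).
Proof. by rewrite !inE; exact: mapP. Qed.

Lemma model_norm a : a \in model -> dot a a = 3 / n%:R.
Proof.
have [Nr0 nr _ _ _] := real_roots_facts omE validD.
have [k0 kE] := model_scaleE.
case/modelP=> r rR ->; rewrite !dotE (nr r rR) -/Nr mulrA -expr2 -kE.
have : n%:R != 0 :> R by apply: contraTneq (lt0r_neq0 k0) => n0; move: kE; rewrite n0 !mulr0; lra.
by move=> n0; field.
Qed.

Lemma walls_memv (Q : {vspace V}) (z : R) w (T : V * V * V) :
  T.1.1 \in Q -> T.1.2 \in Q -> T.2 \in Q -> {subset walls ( *:%R z) w T <= Q}.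
Proof.
elim: w T => [|i w IH] [[a b] c] //= aQ bQ cQ v; rewrite inE => /orP[/eqP ->|].
  by case: i => [|[|i]].
by apply: IH; case: i => [|[|i]] /=; rewrite ?memvN ?memvD ?memvZ.
Qed.

(** Reflections in roots permute the roots, which gives the conditions on planes.  The
    simple roots cannot be distributed over two summands, since the first one is
    orthogonal to neither of the others. *)
Lemma model_system : [/\ euclidean_vsystem model, irreducible model & equal_lengths model].
Proof.
have [Nr0 nr ur nopp closed] := real_roots_facts omE validD.
have [k0 kE] := model_scaleE; have kn := lt0r_neq0 k0.
have rn0 r : r \in roots -> r != 0 by move=> /nr rr; rewrite -dot_gt0 rr.
have M0 : 0 \notin model.
  apply/modelP => -[r rR /esym/eqP]; rewrite scaler_eq0 (negPf kn) /=.
  by rewrite (negPf (rn0 r rR)).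
have Mline a b : a \in model -> b \in model -> a != b -> forall c : R, b <> c *: a.
  move=> aM bM nab c bc; have aa := model_norm aM; have := model_norm bM.
  have an : dot a a != 0.
    by rewrite dot_eq0; apply: contraNneq M0 => <-.
  rewrite bc !dotE mulrA -expr2 -[RHS]aa -[RHS]mul1r => /(mulIf an) /eqP.
  rewrite sqrf_eq1 => /orP[]/eqP cE; rewrite cE in bc.
    by rewrite bc scale1r eqxx in nab.
  have [[r rR aE] [s sR bE]] := (modelP a aM, modelP b bM).
  apply: (nopp s r sR rR); apply: (scalerI kn).
  by rewrite -bE scalerN -aE bc scaleN1r.
have uk : uniq [seq k *: r | r <- roots].
  by rewrite map_inj_uniq //; exact: scalerI.
have pM : perm_eq model [seq k *: r | r <- roots].
  by apply: uniq_perm; rewrite ?fset_uniq // => x; rewrite !inE.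
have reflM a b : a \in model -> b \in model -> refl a b \in model \/ - refl a b \in model.
  case/modelP=> r rR -> /modelP[s sR ->].
  have -> : refl (k *: r) (k *: s) = k *: refl r s.
    have rr := nr r rR.
    rewrite /refl scalerBr !dotE !scalerA rr; congr (_ - _ *: _).
    by field; rewrite kn gt_eqF.
  rewrite -scalerN; case: (closed r s rR sR) => h; [left|right];
    by apply/modelP; eexists; [exact: h|].
have [many two] := reflection_closed_planes M0 Mline reflM.
have fr : vsystem_frame model.
  move=> x; rewrite (perm_big _ pM) big_map enorm_sq.
  rewrite (eq_bigr (fun r => k ^+ 2 * dot x r ^+ 2)) => [|r _].
    rewrite -mulr_sumr (real_roots_frame omE validD) !mulrA -/Nr -/n.
    have -> : k ^+ 2 * Nr * n%:R = 3 by rewrite -mulrA.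
    by rewrite divff ?mul1r // pnatr_eq0.
  by rewrite dotZr exprMn.
split=> //; last first.
  by move=> a b aM bM; rewrite /enorm !model_norm.
move=> [P [P' [P0 P'0 dirP full ME]]].
have capP v : v \in P -> v \in P' -> v = 0.
  move=> vP vP'; apply/eqP; rewrite -memv0.
  by move: dirP; rewrite directv_addE => /and3P[_ _ /eqP <-]; rewrite memv_cap vP.
have PP a : a \in model -> a \in P \/ a \in P'.
  by rewrite {1}ME !inE => /orP[]/andP[_ h]; [left|right].
have connect (Q Q' : {vspace V}) : (forall v, v \in Q -> v \in Q' -> v = 0) ->
    (forall a, a \in model -> a \in Q \/ a \in Q') ->
    forall a b, a \in model -> b \in model -> a \in Q -> dot a b != 0 -> b \in Q.
  move=> cap QQ a b aM bM aQ nab.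
  have [//|bQ'] := QQ b bM.
  have an : a != 0 by apply: contraNneq M0 => <-.
  have kn' : 2 * dot a b / dot a a != 0.
    by rewrite !mulf_neq0 ?invr_neq0 ?dot_eq0 ?pnatr_eq0.
  have rQ : refl a b \in Q \/ refl a b \in Q'.
    by case: (reflM a b aM bM) => /QQ; rewrite ?memvN.
  case: rQ => h; first by rewrite -(subrK ((2 * dot a b / dot a a) *: a) b) memvD // memvZ.
  case/eqP: an; apply: cap => //.
  rewrite -(scalerK kn' a) memvZ // -[X in X \in _](subKr b) memvB //.
have base := real_base_facts omE validD.
move: base; case E : (map_chamber _ _) => [[a b] c] [[aR bR cR] [t0 ab ac _] wallsE _].
have inM r : r \in roots -> k *: r \in model by move=> rR; apply/modelP; exists r.
have nz (w : R) : w != 0 -> k * (k * (- w * Nr)) != 0.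
  by move=> w0; rewrite !mulf_neq0 ?oppr_eq0 // gt_eqF.
have key (Q Q' : {vspace V}) : (forall v, v \in Q -> v \in Q' -> v = 0) ->
    (forall a, a \in model -> a \in Q \/ a \in Q') -> k *: a \in Q -> Q' = 0%VS.
  move=> cap QQ aQ.
  have bQ : k *: b \in Q.
    apply: (connect Q Q' cap QQ (k *: a)); rewrite ?inM // !dotE ab; apply: nz.
    by rewrite mulf_neq0 // invr_neq0 // pnatr_eq0.
  have cQ : k *: c \in Q.
    by apply: (connect Q Q' cap QQ (k *: a)); rewrite ?inM // !dotE ac; apply: nz; lra.
  have unk r : k *: r \in Q -> r \in Q by move=> h; rewrite -(scalerK kn r) memvZ.
  have rQ r : r \in roots -> r \in Q.
    have [a' b' c'] := And3 (unk a aQ) (unk b bQ) (unk c cQ).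
    have := @walls_memv Q t (rd_word D) (a, b, c) a' b' c'.
    by rewrite -wallsE; apply.
  apply/vspaceP => v; rewrite memv0; apply/idP/eqP => [vQ'|->]; last exact: mem0v.
  apply: cap => //; have : v \in <<model>>%VS.
    by rewrite frame_span ?memvf // => x; rewrite fr enorm_sq.
  apply: subvP; apply/span_subvP => e /modelP[r rR ->].
  by rewrite memvZ // rQ.
have [aP|aP'] := PP (k *: a) (inM a aR).
  by move: P'0; rewrite (key P P') // eqxx.
move: P0; rewrite (key P' P) ?eqxx // => [v|e /PP[]]; [|by right|by left].
by move=> h1 h2; apply: capP.
Qed.
End ModelSystem.

(** * Completeness of the models *)

Section Classification.
Variables (R : realType) (D : root_datum) (om : R).
Hypothesis omE : om ^+ 2 = (rd_p D)%:~R * om + (rd_q D)%:~R.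
Hypothesis validD : rd_valid D.
Notation V := 'rV[R]_3.
Implicit Types (a b c r s u v x y : V).

Let t := qval om (rd_t D).
Let Nr : R := (rd_norm D)%:~R.
Let n := size (rd_roots D).
Let roots := real_roots D om.
Let k : R := model_scale R D.

(** This counts lines: [X] and [Y] may represent a line by opposite vectors. *)
Lemma pm_size (X Y : seq V) : uniq X ->
  (forall x y, x \in X -> y \in X -> x <> - y) ->
  (forall x, x \in X -> pm Y x) -> (size X <= size Y)%N.
Proof.
move=> uX nopp XY; pose rho x := if x \in Y then x else - x.
rewrite -(size_map rho); apply: uniq_leq_size.
  rewrite map_inj_in_uniq // => x y xX yX; rewrite /rho.
  case: ifP => _; case: ifP => _ // E; last exact: oppr_inj.
    by case: (nopp x y xX yX).
  by case: (nopp y x yX xX).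
move=> _ /mapP[x /XY/orP[xY ->|xY ->]]; rewrite /rho; first by rewrite xY.
by case: ifP.
Qed.

Lemma base_free : let: (a, b, c) := map_chamber (@qvec R om) (rd_base D) in
  free [:: a; b; c].
Proof.
have [[_ _ fr _ _] _ _] := model_system omE validD.
have := real_base_facts omE validD.
case: (map_chamber _ _) => [[a b] c] [_ _ wallsE _].
have mem v : v \in [:: a; b; c] -> v \in <<[:: a; b; c]>>%VS by exact: memv_span.
have sub := @walls_memv R <<[:: a; b; c]>>%VS t (rd_word D) (a, b, c)
  (mem a _) (mem b _) (mem c _).
rewrite /free eq_sym eqn_leq dim_span andbT.
suff -> : <<[:: a; b; c]>>%VS = fullv by rewrite dimvf.
apply/eqP; rewrite eqEsubv subvf.
have <- : <<model D om>>%VS = fullv by apply: frame_span => x; rewrite fr enorm_sq.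
apply/span_subvP => e /modelP[r rR ->]; rewrite memvZ //.
by move: rR; rewrite wallsE; apply: sub; rewrite !inE eqxx ?orbT.
Qed.

(** The isometry, up to scale, that maps the base of the model to a seed. *)
Lemma seed_transport a b c : dot a a = 1 -> dot b b = 1 -> dot c c = 1 ->
  dot a b = - (t / 2) -> dot a c = - (1 / 2) -> dot b c = 0 ->
  exists M : 'M[R]_3,
    map_chamber (fun v : V => v *m M) (map_chamber (@qvec R om) (rd_base D)) = (a, b, c) /\
    forall x y, dot (x *m M) (y *m M) = Nr^-1 * dot x y.
Proof.
move=> a1 b1 c1 ab ac bc; have := base_free; have := real_base_facts omE validD.
have [Nr0 nr _ _ _] := real_roots_facts omE validD.
case: (map_chamber _ _) => [[a0 b0] c0] [[aR bR cR] [_ ab0 ac0 bc0] _ _] f0.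
have [p [q [r [pE qE rE]]]] := free_dual f0.
pose M := p^T *m a + q^T *m b + r^T *m c.
have ME (x y z : R) : (x *: a0 + y *: b0 + z *: c0) *m M = x *: a + y *: b + z *: c.
  by rewrite /M !mulmxDr !mulmx_outer !(dotC (_ + _)) pE qE rE.
have span v := free3_coord v f0.
exists M; split.
  rewrite /=; congr (_, _, _).
  - by have := ME 1 0 0; rewrite !scale1r !scale0r !addr0.
  - by have := ME 0 1 0; rewrite !scale1r !scale0r !add0r !addr0.
  - by have := ME 0 0 1; rewrite !scale1r !scale0r !add0r.
move=> x y; have [x1 [x2 [x3 ->]]] := span x; have [y1 [y2 [y3 ->]]] := span y.
rewrite !ME !dotE a1 b1 c1 (dotC b a) (dotC c a) (dotC c b) ab ac bc.
rewrite (nr a0 aR) (nr b0 bR) (nr c0 cR) (dotC b0 a0) (dotC c0 a0) (dotC c0 b0).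
by rewrite ab0 ac0 bc0 -/Nr -/t; field; rewrite gt_eqF.
Qed.

(** A gallery from the seed to the opposite chamber shows that the seed determines the
    whole system; the same gallery in the model gives the same vectors up to the
    isometry between the two seeds. *)
Lemma model_complete (A : {fset V}) (l : R) a b c : 0 < l ->
  (forall e, e \in A -> dot e e = l ^+ 2) -> l ^+ 2 * (size A)%:R = 3 ->
  planar_tight [seq l^-1 *: e | e <- A] ->
  seed [seq l^-1 *: e | e <- A] t a b c -> orth_proj_equiv A (model D om).
Proof.
move=> l0 lE lsize tU sd; set U := map _ _ in tU sd.
have ln := lt0r_neq0 l0.
have [ch ab ac bc _ _ _] := sd; have [pa pb pc _ _] := ch.
have [M [ME iso]] := seed_transport (pm_unit tU pa) (pm_unit tU pb) (pm_unit tU pc) ab ac bc.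
have [Nr0 nr ur nopp _] := real_roots_facts omE validD.
have [k0 kE] := model_scaleE omE validD; have kn := lt0r_neq0 k0.
have Nn := lt0r_neq0 Nr0.
have := real_base_facts omE validD; move: ME.
case: (map_chamber _ (rd_base D)) => [[a0 b0] c0] ME [_ _ wallsE opp].
pose f (v : V) := v *m M.
have [Hw He] := gallery_morph (tm := *:%R t) (tm' := *:%R t) (f := f)
  (fun x y => mulmxDl x y M) (fun x => mulNmx x M) (fun x => esym (scalemxAl t x M))
  (rd_word D) (a0, b0, c0).
rewrite ME -wallsE in Hw; rewrite ME in He.
have opp' : opposite (a, b, c) (gallery_end ( *:%R t) (rd_word D) (a, b, c)).
  rewrite He; case: (gallery_end _ _ _) opp => [[a1 b1] c1] /=.
  by case: ME => <- <- <-; case/orP => /eqP[-> -> ->]; rewrite /f !mulNmx eqxx ?orbT.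
have UR v : pm U v -> exists2 r, r \in roots & v = f r \/ v = - f r.
  move=> /(walls_exhaust (T := (a, b, c)) tU sd opp'); rewrite Hw => /orP[]/mapP[r rR E].
    by exists r; [|left].
  by exists r; [|right; rewrite -E opprK].
have RU r : r \in roots -> pm U (f r).
  move=> rR; apply: (pm_walls (T := (a, b, c)) (w := rd_word D) tU sd).
  by rewrite Hw map_f.
have finj : injective f.
  move=> x y /eqP; rewrite -subr_eq0 -mulmxBl -dot_eq0 iso mulf_eq0 invr_eq0.
  by rewrite (negPf Nn) /= dot_eq0 subr_eq0 => /eqP.
have sizeE : size U = n.
  apply/eqP; rewrite eqn_leq; apply/andP; split.
    rewrite /n -(size_map (@qvec R om)) -(size_map f); apply: pm_size.
    - exact: tight_uniq tU.
    - by move=> x y xU yU xy; have := tight_line tU yU; rewrite -xy xU.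
    - move=> x xU; have [r rR E] : exists2 r, r \in roots & x = f r \/ x = - f r.
        by apply: UR; rewrite /pm xU.
      by rewrite /pm; case: E => ->; rewrite ?opprK (map_f f rR) ?orbT.
  rewrite /n -(size_map (@qvec R om)) -(size_map f); apply: pm_size.
  - by rewrite map_inj_uniq.
  - move=> _ _ /mapP[x xR ->] /mapP[y yR ->]; rewrite /f -mulNmx => /finj.
    exact: nopp.
  - by move=> _ /mapP[x xR ->]; exact: RU.
have lk : l ^+ 2 = k ^+ 2 * Nr.
  have n0 : n%:R != 0 :> R.
    by apply: contraTneq (ltr01 : 0 < 1 :> R) => n0; move: kE; rewrite -/n n0 !mulr0; lra.
  have E : k ^+ 2 * (Nr * n%:R) = 3 by exact: kE.
  by apply: (mulIf n0); rewrite -[RHS]mulrA [RHS]E -lsize -sizeE size_map.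
(* [M] divides squared lengths by [Nr]; this multiple of its transpose undoes it. *)
pose G : 'M[R]_3 := (k * Nr / l) *: M^T.
have MMT x : x *m M *m M^T = Nr^-1 *: x.
  apply/eqP; rewrite -subr_eq0 -dot_eq0; set w := _ - _.
  by rewrite {1}/w dotDl dotNl dot_mulmx trmxK iso dotZl subrr.
have MTM : M *m ((Nr *: M^T)) = 1%:M.
  apply/row_matrixP => i; rewrite !rowE -scalemxAr scalemxAr mulmxA.
  by rewrite -scalemxAr MMT scalerA divff // scale1r mulmx1.
have TMM := mulmx1C MTM.
have isoT x y : dot (x *m M^T) (y *m M^T) = Nr^-1 * dot x y.
  rewrite dot_mulmx trmxK -mulmxA.
  have -> : M^T *m M = Nr^-1 *: 1%:M.
    by rewrite -TMM -scalemxAl scalerA mulVf // scale1r.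
  by rewrite -scalemxAr mulmx1 dotZr.
have fG r : l *: f r *m G = k *: r.
  rewrite /G /f -scalemxAl -scalemxAr MMT !scalerA; congr (_ *: _).
  by field; rewrite Nn ln.
have orthG : orthogonal_group G.
  apply: dot_preserving_orthogonal => x y.
  rewrite /G -!scalemxAr !dotE isoT !mulrA -[RHS]mul1r; congr (_ * _).
  have -> : k * Nr / l * k * Nr / l / Nr = (k ^+ 2 * Nr) / l ^+ 2.
    by field; rewrite Nn ln.
  by rewrite -lk divff // expf_eq0.
have AR e : e \in A -> exists2 r, r \in roots & e *m G = k *: r \/ e *m G = - (k *: r).
  move=> eA; have pe : pm U (l^-1 *: e) by rewrite /pm map_f.
  have [r rR E] := UR _ pe.
  exists r => //; have -> : e = l *: (l^-1 *: e) by rewrite scalerA divff // scale1r.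
  by case: E => ->; [left|right]; rewrite ?scalerN ?mulNmx fG.
pose g e := if e *m G \in model D om then e *m G else - (e *m G).
have gM e : e \in A -> g e \in model D om.
  move=> eA; rewrite /g; case: ifPn => // h; have [r rR [E|E]] := AR e eA.
    by case/negP: h; rewrite E; apply/modelP; exists r.
  by rewrite E opprK; apply/modelP; exists r.
have Ginj : injective (fun e : V => e *m G).
  move=> x y /= /(congr1 (fun v => v *m G^T)); rewrite -!mulmxA.
  by rewrite (orthG : G *m G^T = 1%:M) !mulmx1.
have AN x y : x \in A -> y \in A -> x <> - y.
  move=> xA yA E; have := tight_line tU (map_f _ yA).
  by rewrite -scalerN -E => /negP; apply; apply: map_f.
exists G => //; exists g; last by move=> e _; rewrite /g; case: ifP; [left|right].
split.
- by move=> e /gM.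
- move=> x y; rewrite !inE /= => xA yA; rewrite /g.
  case: ifP => _; case: ifP => _ E.
  + exact: Ginj.
  + by case: (AN x y xA yA); apply: Ginj; rewrite /= mulNmx.
  + by case: (AN y x yA xA); apply: Ginj; rewrite /= mulNmx.
  + by apply: Ginj; apply: oppr_inj.
- move=> m /modelP[r rR mE].
  have [e eA E] : exists2 e, e \in A & l *: f r = e \/ l *: f r = - e.
    case/orP: (RU r rR) => /mapP[e eA E]; exists e => //.
      by left; rewrite E scalerA divff // scale1r.
    by right; rewrite -[f r]opprK E scalerN scalerA divff // scale1r.
  have mG : m = e *m G \/ m = - (e *m G).
    by case: E => E; [left|right]; rewrite mE -fG E ?mulNmx.
  exists e => //; rewrite /g; case: mG => mG.
    by rewrite -mG; case: ifPn => //; rewrite mE => /modelP[]; exists r.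
  case: ifPn => // h; exfalso.
  have [_ _ _ nopp' _] := real_roots_facts omE validD.
  move: h => /modelP[s sR sE]; apply: (nopp' r s rR sR); apply: (scalerI kn).
  by rewrite -mE mG sE scalerN.
Qed.

End Classification.

(** * Mirrors of the regular solids *)

Section SolidChecks.
Variables (D : root_datum) (rho : quad) (vs : seq quad3).

(** The last condition covers all candidates for a mirror: a reflection that moves a
    vertex [v] to a vertex [v'] has the normal [v - v'], which either is a root or
    moves some vertex [w] to a point that is not a vertex. *)
Definition solid_valid : bool :=
  let rs := rd_roots D in let N := rd_norm D in
  [&& all (fun v => qdot D v v == rho) vs,
    all (fun r => all (fun v => has (fun v' =>
      qrefl D r v == qscale D (qint N) v') vs) vs) rs,
    all (fun r => has (fun v => qnorm D (qdot D r v) != 0) vs) rs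
  & all (fun v => all (fun v' => let d := v - v' in
      [|| v == v', has (qparallel D d) rs
        | has (fun w => all (fun w' =>
            qapart D (qrefl D d w) (qscale D (qdot D d d) w')) vs) vs]) vs) vs].
End SolidChecks.

Definition tetrahedron_vertices : seq quad3 :=
  [seq (qint u.1.1, qint u.1.2, qint u.2) | u <-
    [:: (1, 1, 1); (1, - 1, - 1); (- 1, 1, - 1); (- 1, - 1, 1)]].

Definition cube_vertices : seq quad3 :=
  flatten [seq [:: (qint x, qint y, qint 1); (qint x, qint y, qint (- 1))]
    | x <- [:: 1; - 1], y <- [:: 1; - 1]].

Definition icosahedron_vertices : seq quad3 :=
  flatten [seq [:: (0, qint x, (0, y)); (qint x, (0, y), 0); ((0, y), 0, qint x)]
    | x <- [:: 1; - 1], y <- [:: 1; - 1]].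

Lemma tetrahedron_valid : solid_valid datum_A3 (qint 3) tetrahedron_vertices.
Proof. by vm_compute. Qed.

Lemma cube_valid : solid_valid datum_B3 (qint 3) cube_vertices.
Proof. by vm_compute. Qed.

Lemma icosahedron_valid : solid_valid datum_H3 (2, 1) icosahedron_vertices.
Proof. by vm_compute. Qed.

Section ConvexHull.
Variables (R : realType) (d : nat).
Notation V := 'rV[R]_d.
Implicit Types (S : set V) (x v a : V).

Lemma mem_convex_hull S v : S v -> convex_hull S v.
Proof.
move=> Sv; exists 1%N, (fun=> v), (fun=> 1); rewrite !big_ord1 scale1r.
by split.
Qed.

Lemma convex_hull_mulmx S (G : 'M[R]_d) x :
  (forall v, S v -> S (v *m G)) -> convex_hull S x -> convex_hull S (x *m G).
Proof.
move=> SG [m [v [c [Sv c0 c1 ->]]]]; exists m, (fun i => v i *m G), c.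
split=> // [i|]; first exact: SG.
by rewrite mulmx_suml; apply: eq_bigr => i _; rewrite scalemxAl.
Qed.

(** The sphere through the vertices is strictly convex. *)
Lemma convex_hull_sphere S (rho : R) x : (forall v, S v -> dot v v = rho) ->
  convex_hull S x -> dot x x = rho -> S x.
Proof.
move=> Srho [m [v [c [Sv c0 c1 xE]]]] xx.
have le i : 0 <= c i * (rho - dot x (v i)).
  rewrite mulr_ge0 //; have := dot_ge0 (x - v i).
  by rewrite !dotE xx (Srho _ (Sv i)) (dotC (v i) x); lra.
have : \sum_i c i * (rho - dot x (v i)) = 0.
  rewrite (eq_bigr (fun i => c i * rho - dot x (c i *: v i))) => [|i _].
    by rewrite sumrB -mulr_suml c1 -dot_sumr -xE xx mul1r subrr.
  by rewrite dotZr mulrBr.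
move/eqP; rewrite psumr_eq0 // => /allP z.
have [i ci] : exists i, c i != 0.
  apply: contrapT => no; have : \sum_i c i = 0.
    rewrite big1 // => i _; apply/eqP; apply: contraT => ci.
    by case: no; exists i.
  by rewrite c1 => /eqP; rewrite oner_eq0.
have := z i (mem_index_enum _); rewrite /= mulf_eq0 (negPf ci) subr_eq0 /= => /eqP E.
suff -> : x = v i by exact: Sv.
apply/eqP; rewrite -subr_eq0 -dot_eq0 !dotE xx (Srho _ (Sv i)) (dotC (v i) x) -E.
by apply/eqP; ring.
Qed.

Lemma mulmx_reflection a x : x *m reflection a = refl a x.
Proof.
rewrite /reflection /refl mulmxBr mulmx1 -scalemxAr mulmx_outer scalerA (dotC x a).
by congr (_ - _ *: _); ring.
Qed.

Lemma reflection_orthogonal a : a != 0 -> orthogonal_group (reflection a).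
Proof.
move=> a0; apply: dot_preserving_orthogonal => x y.
by rewrite !mulmx_reflection dot_refl reflK.
Qed.

Lemma refl_scale (k : R) a x : k != 0 -> refl (k *: a) x = refl a x.
Proof.
move=> k0; rewrite /refl !dotE scalerA; have [->|a0] := eqVneq a 0; first by rewrite !scaler0.
by congr (_ - _ *: _); field; rewrite k0 dot_eq0 a0.
Qed.

Lemma hyperplane_scale (k : R) a : k != 0 -> hyperplane (k *: a) = hyperplane a.
Proof.
move=> k0; apply/seteqP; split=> x; rewrite /hyperplane /= dotZl.
  by move/eqP; rewrite mulf_eq0 (negPf k0) => /eqP.
by move=> ->; rewrite mulr0.
Qed.

Lemma symmetry_of_hull S (rho : R) (G : 'M[R]_d) : (forall v, S v -> dot v v = rho) ->
  symmetry_group (convex_hull S) G -> forall v, S v -> S (v *m G).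
Proof.
move=> Srho [orthG hull] v Sv; apply: (convex_hull_sphere Srho).
  by rewrite -hull; exists v => //; exact: mem_convex_hull.
by rewrite dot_mulmx -mulmxA (orthG : G *m G^T = 1%:M) mulmx1 Srho.
Qed.

Lemma reflection_symmetry S a : a != 0 -> (forall v, S v -> S (refl a v)) ->
  symmetry_group (convex_hull S) (reflection a).
Proof.
move=> a0 Sa; split; first exact: reflection_orthogonal.
have stable x : convex_hull S x -> convex_hull S (x *m reflection a).
  by apply: convex_hull_mulmx => v /Sa; rewrite mulmx_reflection.
apply/seteqP; split=> x; first by case=> y /stable h <-.
move=> hx; exists (x *m reflection a); first exact: stable.
by rewrite !mulmx_reflection reflK.
Qed.

End ConvexHull.

Section SolidMirrors.
Variables (R : realType) (D : root_datum) (om : R).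
Hypothesis omE : om ^+ 2 = (rd_p D)%:~R * om + (rd_q D)%:~R.
Hypothesis validD : rd_valid D.
Variables (rho : quad) (vs : seq quad3).
Hypothesis validS : solid_valid D rho vs.
Notation V := 'rV[R]_3.
Variable S : set V.
Hypothesis SE : forall v, S v <-> exists2 u, u \in vs & v = qvec om u.

Lemma qparallelP (u u' : quad3) : qparallel D u u' -> qvec om u' != 0 ->
  exists k : R, qvec om u = k *: qvec om u'.
Proof.
move=> /and3P[/eqP e1 /eqP e2 /eqP e3] n0.
have val := fun x y => qvalM omE x y.
have f1 := congr1 (qval om) e1; have f2 := congr1 (qval om) e2.
have f3 := congr1 (qval om) e3; rewrite !val in f1 f2 f3.
set a := qvec om u; set b := qvec om u' in n0 *.
exists (dot a b / dot b b); apply: (scalerI (_ : dot b b != 0)); first by rewrite dot_eq0.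
rewrite scalerA mulrC divfK ?dot_eq0 // !dot3E.
move: f1 f2 f3; rewrite /a /b => f1 f2 f3; apply: row3P; rewrite !mxE /=;
  move: (qval om u.1.1) (qval om u.1.2) (qval om u.2) (qval om u'.1.1)
    (qval om u'.1.2) (qval om u'.2) f1 f2 f3 => x0 x1 x2 y0 y1 y2 f1 f2 f3.
- have h1 := congr1 (fun z => z * y1) f1; have h2 := congr1 (fun z => z * y2) f2.
  by rewrite /= in h1 h2; lra.
- have h1 := congr1 (fun z => z * y0) f1; have h2 := congr1 (fun z => z * y2) f3.
  by rewrite /= in h1 h2; lra.
- have h1 := congr1 (fun z => z * y0) f2; have h2 := congr1 (fun z => z * y1) f3.
  by rewrite /= in h1 h2; lra.
Qed.

(** A symmetry of the solid permutes the vertices, as they are the points of the solid at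
    maximal distance from the centre; so a mirror is normal to a difference of two
    vertices, which leaves finitely many cases. *)
Lemma mirrors_of_solid :
  mirrors (symmetry_group (convex_hull S)) = arrangement_of (model D om).
Proof.
have [Nr0 nr ur nopp closed] := real_roots_facts omE validD.
have [k0 kE] := model_scaleE omE validD; have kn := lt0r_neq0 k0.
have rn0 r : r \in real_roots D om -> r != 0 by move=> /nr rr; rewrite -dot_gt0 rr.
move: validS => /and4P[norms stable moved pairs].
have Srho v : S v -> dot v v = qval om rho.
  by move=> /SE[u uvs ->]; rewrite (dot_qvec omE) (eqP (allP norms u uvs)).
have arr r : r \in real_roots D om -> arrangement_of (model D om) (hyperplane r).
  move=> rR; exists (model_scale R D *: r); last exact: hyperplane_scale.
  by apply/modelP; exists r.
have Sroot r v : r \in real_roots D om -> S v -> S (refl r v).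
  move=> /mapP[u uR ->] /SE[w wvs ->].
  have /hasP[w' w'vs /eqP E] := allP (allP stable u uR) w wvs.
  apply/SE; exists w' => //; apply: (scalerI (lt0r_neq0 Nr0)).
  have := congr1 (qvec om) E; rewrite (qvec_refl omE) (qvecZ omE) qval_int => <-.
  rewrite nr ?map_f // /refl scalerBr !scalerA nr ?map_f //.
  by congr (_ - _ *: _); field; rewrite gt_eqF.
apply/seteqP; split=> h; last first.
  case=> _ /modelP[r rR ->] <-; exists r; last by rewrite hyperplane_scale.
  split; first exact: rn0.
  by apply: reflection_symmetry; [exact: rn0|move=> v; exact: Sroot].
case=> a [a0 /(symmetry_of_hull Srho) sym] <-.
have {}sym v : S v -> S (refl a v) by move=> /sym; rewrite mulmx_reflection.
(* A normal orthogonal to all vertices would be orthogonal to all roots, which span. *)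
have [v Sv mv] : exists2 v, S v & refl a v != v.
  apply: contrapT => no; have fixed v : S v -> dot a v = 0.
    move=> Sv; apply/eqP; apply: contraT => av; case: no; exists v => //.
    rewrite /refl -subr_eq0 addrAC subrr add0r oppr_eq0 scaler_eq0 (negPf a0) orbF.
    by rewrite !mulf_neq0 ?invr_neq0 ?dot_eq0 ?pnatr_eq0.
  have ar r : r \in real_roots D om -> dot a r = 0.
    move=> rR; have := rR => /mapP[u uR rE].
    have /hasP[w wvs nz] := allP moved u uR.
    have Sw : S (qvec om w) by apply/SE; exists w.
    have := fixed _ (Sroot r _ rR Sw).
    rewrite /refl !dotE (fixed _ Sw) add0r => /eqP; rewrite oppr_eq0 mulf_eq0 => /orP[|/eqP //].
    rewrite rE (dot_qvec omE u w) !mulf_eq0 (negPf (qval_neq0 omE nz)) pnatr_eq0 /=.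
    by rewrite invr_eq0 dot_eq0 -rE (negPf (rn0 r rR)).
  have : \sum_(r <- real_roots D om) dot a r ^+ 2 = 0.
    by rewrite big_seq big1 // => r /ar ->; rewrite expr0n.
  rewrite (real_roots_frame omE validD) => /eqP; rewrite mulf_eq0 dot_eq0 (negPf a0) orbF.
  rewrite mulf_eq0 invr_eq0 pnatr_eq0 orbF => /eqP z.
  by move: kE; rewrite z mulr0; lra.
have [[u uvs vE] [u' u'vs vE']] := ((SE v).1 Sv, (SE _).1 (sym v Sv)).
pose e := u - u'.
have eE : qvec om e = v - refl a v by rewrite /e qvecD qvecN -vE -vE'.
have [k kn0 ek] : exists2 k : R, k != 0 & qvec om e = k *: a.
  exists (2 * dot a v / dot a a); last by rewrite eE /refl opprB addrCA subrr addr0.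
  apply: contraNneq mv => z; apply/eqP.
  by rewrite /refl z scale0r subr0.
have e0 : qvec om e != 0 by rewrite ek scaler_eq0 (negPf kn0).
have := allP (allP pairs u uvs) u' u'vs => /or3P[/eqP uu|/hasP[r rR par]|/hasP[w wvs far]].
- by case/eqP: mv; rewrite vE' vE uu.
- have rR' : qvec om r \in real_roots D om by exact: map_f.
  have [l lE] := qparallelP par (rn0 _ rR').
  have ln : l != 0 by apply: contraNneq e0 => z; rewrite lE z scale0r.
  rewrite -(hyperplane_scale a kn0) -ek lE hyperplane_scale //; exact: arr.
- exfalso; have Sw : S (qvec om w) by apply/SE; exists w.
  have [w' w'vs E] := (SE _).1 (sym _ Sw).
  have := qapart_neq omE (allP far w' w'vs).
  rewrite (qvec_refl omE) (qvecZ omE) -(dot_qvec omE) -E => /negP; apply; apply/eqP.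
  rewrite -(refl_scale a _ kn0) -ek /refl scalerBr !scalerA.
  by congr (_ - _ *: _); field; rewrite dot_eq0.
Qed.
End SolidMirrors.

(** * Classification *)

Section Assembly.
Variable R : realType.
Notation V := 'rV[R]_3.

Lemma splits_reducible (A : {fset V}) (l : R) : l != 0 ->
  splits [seq l^-1 *: a | a <- A] -> reducible A.
Proof.
move=> l0 [a [b [c [fabc sp]]]].
have := fabc; rewrite -[[:: a; b; c]]/([:: a; b] ++ [:: c]) cat_free span_seq1.
case/and3P=> fab fc dir; exists <<[:: a; b]>>%VS, <[c]>%VS.
have a0 := free_not0 fab (mem_head _ _); have c0 := free_not0 fc (mem_head _ _).
split=> //.
- by apply: contraNneq a0 => E; rewrite -memv0 -E memv_span // mem_head.
- by apply: contraNneq c0 => E; rewrite -memv0 -E memv_line.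
- rewrite -span_seq1 -span_cat; apply/eqP; rewrite eqEdim subvf dimvf.
  by rewrite (eqP (fabc : free ([:: a; b] ++ [:: c]))).
- apply/fsetP => x; rewrite !inE -andb_orr; case: (boolP (x \in A)) => //= xA.
  have := sp (l^-1 *: x) (map_f _ xA).
  have un (P : {vspace V}) : l^-1 *: x \in P -> x \in P.
    by move=> h; rewrite -(scalerKV l0 x) memvZ.
  by case/orP=> /un ->; rewrite ?orbT.
Qed.

Lemma equiv_model_norm (D D' : root_datum) (om om' : R) :
  om ^+ 2 = (rd_p D)%:~R * om + (rd_q D)%:~R -> rd_valid D ->
  om' ^+ 2 = (rd_p D')%:~R * om' + (rd_q D')%:~R -> rd_valid D' ->
  orth_proj_equiv (model D om) (model D' om') ->
  3 / (size (rd_roots D))%:R = 3 / (size (rd_roots D'))%:R :> R.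
Proof.
move=> omE vD omE' vD' [G orthG [f [fM _ _] fE]].
have := real_base_facts omE vD.
case: (map_chamber _ _) => [[a b] c] [[aR _ _] _ _ _].
have aM : model_scale R D *: a \in model D om by apply/modelP; exists a.
have faM : f (model_scale R D *: a) \in model D' om' by exact: fM.
rewrite -(model_norm omE vD aM) -(model_norm omE' vD' faM).
have iso (v : V) : dot (v *m G) (v *m G) = dot v v.
  by rewrite dot_mulmx -mulmxA (orthG : G *m G^T = 1%:M) mulmx1.
by case: (fE _ aM) => ->; rewrite ?dotNl ?dotNr ?opprK iso.
Qed.

Lemma linearly_equivalent_refl d (H K : set (set 'rV[R]_d)) : H = K ->
  linearly_equivalent H K.
Proof.
move=> <-; exists 1%:M; first exact: unitmx1.
have id1 (h : set 'rV[R]_d) : [set x *m 1%:M | x in h]%classic = h.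
  apply/seteqP; split=> x; first by case=> y hy <-; rewrite mulmx1.
  by move=> hx; exists x; rewrite ?mulmx1.
apply/seteqP; split=> h; first by case=> h' Hh' <-; rewrite id1.
by move=> Hh; exists h.
Qed.

Let om2 : R := Num.sqrt 2.

Lemma datum_A3_root : (0 : R) ^+ 2 = (rd_p datum_A3)%:~R * 0 + (rd_q datum_A3)%:~R.
Proof. by rewrite /= expr0n mulr0 addr0. Qed.

Lemma datum_B3_root : om2 ^+ 2 = (rd_p datum_B3)%:~R * om2 + (rd_q datum_B3)%:~R.
Proof. by rewrite /= sqr_sqrtr // mul0r add0r. Qed.

Lemma golden_sq : golden_ratio R ^+ 2 = golden_ratio R + 1.
Proof.
have s5 : (Num.sqrt 5 : R) ^+ 2 = 5 by rewrite sqr_sqrtr.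
by rewrite /golden_ratio; lra.
Qed.

Lemma datum_H3_root : golden_ratio R ^+ 2 =
  (rd_p datum_H3)%:~R * golden_ratio R + (rd_q datum_H3)%:~R.
Proof. by rewrite golden_sq /= mul1r. Qed.

Lemma vsystem_equiv_model (A : {fset V}) : euclidean_vsystem A -> irreducible A ->
  equal_lengths A ->
  [\/ orth_proj_equiv A (model datum_A3 0), orth_proj_equiv A (model datum_B3 om2)
    | orth_proj_equiv A (model datum_H3 (golden_ratio R))].
Proof.
move=> vA irr eqA; have [l [l0 lE lsize tU]] := vsystem_normalise vA eqA.
have [|t [a [b [c sd]]]] := seed_exists tU.
  by move/(splits_reducible (lt0r_neq0 l0)).
have t0 := seed_gt0 sd.
have [_ _ _ _ []] := seed_planes tU sd => tE.
- constructor 1; apply: (model_complete datum_A3_root datum_A3_valid l0 lE lsize tU (a := a) (b := b) (c := c)).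
  by rewrite (_ : qval _ _ = t) // tE /qval /= mul0r addr0.
- constructor 2; apply: (model_complete datum_B3_root datum_B3_valid l0 lE lsize tU (a := a) (b := b) (c := c)).
  rewrite (_ : qval _ _ = t) // /qval /= mul1r add0r; apply/esym.
  by rewrite /om2 -tE sqrtr_sqr gtr0_norm.
- constructor 3; apply: (model_complete datum_H3_root datum_H3_valid l0 lE lsize tU (a := a) (b := b) (c := c)).
  rewrite (_ : qval _ _ = t) // /qval /= mul1r add0r.
  have /eqP : (golden_ratio R - t) * (golden_ratio R + t - 1) = 0.
    by have := golden_sq; lra.
  have g1 : 1 < golden_ratio R.
    have : 1 < Num.sqrt 5 :> R by rewrite -[X in X < _]sqrtr1 ltr_sqrt // ltr1n.
    by rewrite /golden_ratio; lra.
  by rewrite mulf_eq0 subr_eq0 => /orP[/eqP //|/eqP]; lra.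
Qed.

Lemma tetrahedron_mirrors :
  mirrors (symmetry_group (@tetrahedron R)) = arrangement_of (model datum_A3 0).
Proof.
apply: (mirrors_of_solid datum_A3_root datum_A3_valid tetrahedron_valid) => v.
have E (x y z : int) : qvec 0 (qint x, qint y, qint z) = vec3 x%:~R y%:~R z%:~R :> V.
  by rewrite /qvec !qval_int.
split.
  case=> [[[->|->]|->]|->]; [exists (qint 1, qint 1, qint 1)
    | exists (qint 1, qint (- 1), qint (- 1)) | exists (qint (- 1), qint 1, qint (- 1))
    | exists (qint (- 1), qint (- 1), qint 1)] => //; by rewrite E ?intrN.
case=> u; rewrite !inE => /or4P[]/eqP -> ->; rewrite E ?intrN.
- by left; left; left.
- by left; left; right.
- by left; right.
- by right.
Qed.

Lemma cube_mirrors :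
  mirrors (symmetry_group (@cube R)) = arrangement_of (model datum_B3 om2).
Proof.
apply: (mirrors_of_solid datum_B3_root datum_B3_valid cube_valid) => v.
have E (x y z : int) : qvec om2 (qint x, qint y, qint z) = vec3 x%:~R y%:~R z%:~R :> V.
  by rewrite /qvec !qval_int.
split=> [h|[u + ->] i].
  have sgn i : exists2 x : int, x \in [:: 1; -1] & v 0 i = x%:~R.
    by case: (h i) => ->; [exists 1|exists (-1); rewrite ?intrN].
  have [[x xs x0] [y ys y1] [z zs z2]] := And3 (sgn 0) (sgn 1) (sgn 2%:R).
  exists (qint x, qint y, qint z); last first.
    by rewrite E; apply: row3P; rewrite mxE.
  by move: xs ys zs; rewrite !inE => /orP[]/eqP-> /orP[]/eqP-> /orP[]/eqP->.
have val n : n = 1 \/ n = -1 -> qval om2 (qint n) = 1 \/ qval om2 (qint n) = - 1.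
  by case=> ->; rewrite qval_int; [left|right].
rewrite !inE /qvec => h; rewrite vec3E.
by case: i => -[|[|[|//]]] hi /=;
  repeat case/orP: h => [/eqP ->|h]; rewrite /=; try (apply: val; auto);
  move/eqP: h => ->; apply: val; auto.
Qed.

Lemma icosahedron_mirrors :
  mirrors (symmetry_group (@icosahedron R)) =
  arrangement_of (model datum_H3 (golden_ratio R)).
Proof.
apply: (mirrors_of_solid datum_H3_root datum_H3_valid icosahedron_valid) => v.
set om := golden_ratio R; pose sg (b : bool) : int := if b then - 1 else 1.
have sgE b : (sg b)%:~R = (-1) ^+ b :> R by case: b; rewrite ?expr1 ?expr0 ?intrN.
have vi b : qval om (qint (sg b)) = (-1) ^+ b by rewrite qval_int sgE.
have vg b : qval om (0, sg b) = (-1) ^+ b * om by rewrite /qval /= sgE add0r.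
split.
  case=> s [t []] ->; [exists (0, qint (sg s), (0, sg t))
    | exists (qint (sg s), (0, sg t), 0) | exists ((0, sg t), 0, qint (sg s))];
    by [case: s; case: t|rewrite /qvec /= ?vi ?vg ?qval0].
case=> u + ->; have mem : u \in icosahedron_vertices -> exists s t, [\/
    u = (0, qint (sg s), (0, sg t)), u = (qint (sg s), (0, sg t), 0)
    | u = ((0, sg t), 0, qint (sg s))].
  move=> /flattenP[L /allpairsP[[x y] [/= xs ys ->]]].
  have sgP z : z \in [:: 1; -1] -> exists b, z = sg b.
    by rewrite !inE => /orP[]/eqP ->; [exists false|exists true].
  have [s ->] := sgP x xs; have [r ->] := sgP y ys.
  by rewrite !inE => /or3P[]/eqP ->; exists s, r;
    [constructor 1|constructor 2|constructor 3].
move=> /mem[s [t h]]; exists s, t; rewrite -vi -vg -(qval0 om).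
by case: h => ->; [constructor 1|constructor 2|constructor 3].
Qed.
End Assembly.

Theorem corollary1p4 (R : realType) :
  let system (A : {fset 'rV[R]_3}) :=
    [/\ euclidean_vsystem A, irreducible A & equal_lengths A] in
  exists A1 A2 A3 : {fset 'rV[R]_3},
    [/\ [/\ system A1, system A2 & system A3],
        [/\ ~ orth_proj_equiv A1 A2, ~ orth_proj_equiv A1 A3
          & ~ orth_proj_equiv A2 A3],
        forall A, system A ->
          [\/ orth_proj_equiv A A1, orth_proj_equiv A A2
            | orth_proj_equiv A A3]
      & [/\ linearly_equivalent (arrangement_of A1)
              (mirrors (symmetry_group (@tetrahedron R))),
            linearly_equivalent (arrangement_of A2)
              (mirrors (symmetry_group (@cube R)))
          & linearly_equivalent (arrangement_of A3)
              (mirrors (symmetry_group (@icosahedron R)))]].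
Proof.
move=> system; exists (model datum_A3 0), (model datum_B3 (Num.sqrt 2)).
exists (model datum_H3 (golden_ratio R)).
have [eA eB eH] := And3 (datum_A3_root R) (datum_B3_root R) (datum_H3_root R).
split.
- split; [exact: model_system eA datum_A3_valid|exact: model_system eB datum_B3_valid
    |exact: model_system eH datum_H3_valid].
- split.
  + by move=> /(equiv_model_norm eA datum_A3_valid eB datum_B3_valid) /=; lra.
  + by move=> /(equiv_model_norm eA datum_A3_valid eH datum_H3_valid) /=; lra.
  + by move=> /(equiv_model_norm eB datum_B3_valid eH datum_H3_valid) /=; lra.
- by move=> A [vA irr eqA]; exact: vsystem_equiv_model.
- split; apply: linearly_equivalent_refl; apply: esym.
  + exact: tetrahedron_mirrors.
  + exact: cube_mirrors.
  + exact: icosahedron_mirrors.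
Qed.
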